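(* Suppose that the compact connected metric graph $G$ has $m$ edges in total and minimum edge length $a_0$, and let $h(t,q)=H(t,q,q)$ be the diagonal restriction of the heat kernel $H$ of the Kirchhoff-Neumann Laplacian on $G$. For a point $q\in G$, let $v_0$ be the nearest vertex (possibly with $q=v_0$), with $d_0$ the degree of $v_0$, and let $d(q,v_0)$ be the distance from $q$ to $v_0$ in $G$. Then for any $t_0<a_0^2/(2\log m)$, $$h(t,q)=\frac{1}{\sqrt{4\pi t}}\left[1+\left(\frac{2}{d_0}-1\right)e^{-d(q,v_0)^2/t}+O\bigl(me^{-a_0^2/4t}\bigr)\right]$$ for $t\in(0,t_0]$, where the constant in the error estimate depends only on $t_0$.
   Context: A compact metric graph $G$ consists of finitely many vertices and finitely many edges, each edge identified with an interval of finite positive length; loops are allowed. The vertex $v_0$ is an original vertex of $G$, not a degree-two vertex inserted artificially at an interior edge point. The Kirchhoff-Neumann Laplacian $-\Delta$ is the self-adjoint operator on $L^2(G)$ associated to the quadratic form $\|u'\|^2$ with domain $H^1(G)$. It acts as $-d^2/dx^2$ on each edge, on functions that are continuous on $G$ and whose outward derivatives sum to zero at each vertex. $H(t,q_1,q_2)$ is the integral kernel of $e^{t\Delta}$. The notation $O(F)$ denotes a quantity bounded in absolute value by a constant times $F$.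
   Formalization: For m = 1, where a0^2/(2 log m) is read as infinite and no constant depending only on t0 exists (circle with a0 tending to 0), the constant is allowed to depend on t0 and a0; for m >= 2 it depends only on t0 as stated. *)

(* Defs.v *)
From HB Require Import structures.
From mathcomp Require Import all_boot all_order all_algebra.
From mathcomp Require Import all_classical all_reals all_analysis.
Set Implicit Arguments.
Unset Strict Implicit.
Unset Printing Implicit Defensive.
Import Order.TTheory GRing.Theory Num.Theory.
Import numFieldNormedType.Exports.
Local Open Scope classical_set_scope.
Local Open Scope ring_scope.

(* Loops ([src e = tgt e]) and parallel edges are allowed. The edge [e] is
   parametrised by [0, len e], with 0 at [src e] and [len e] at [tgt e]. *)
Record metric_graph (R : realType) := MetricGraph {
  vert : finType;
  edge : finType;
  src : edge -> vert;
  tgt : edge -> vert;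
  len : edge -> R;
  len_gt0 : forall e, 0 < len e }.

(* A loop contributes 2 to the degree of its vertex. *)
Definition degree (R : realType) (G : metric_graph R) (v : vert G) : nat :=
  (#|[set e : edge G | src e == v]| + #|[set e : edge G | tgt e == v]|)%N.

Definition min_edge_length (R : realType) (G : metric_graph R) (a : R) : Prop :=
  (exists e : edge G, len e = a) /\ (forall e : edge G, a <= len e).

Inductive gpoint (R : realType) (G : metric_graph R) :=
  | Vertex of vert G
  | Interior of {p : edge G * R | 0 < p.2 < len p.1}.

(* The point of coordinate [x] on the closed edge [e]; coordinates outside
   [0, len e] are sent to the nearest end of the edge. *)
Definition pt (R : realType) (G : metric_graph R) (e : edge G) (x : R) :
    gpoint G :=
  match insub (e, x) with
  | Some p => Interior p
  | None => Vertex (if x <= 0 then src e else tgt e)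
  end.

(* [route p q r]: some path from p to q of length r is a concatenation of
   finitely many segments, each contained in a closed edge. *)
Inductive route (R : realType) (G : metric_graph R) :
    gpoint G -> gpoint G -> R -> Prop :=
  | route_nil p : route p p 0
  | route_cons e x y q r :
      0 <= x <= len e -> 0 <= y <= len e ->
      route (pt e y) q r -> route (pt e x) q (`|x - y| + r).

Definition gdist (R : realType) (G : metric_graph R) (p q : gpoint G) : R :=
  inf [set r | route p q r].

Definition gball (R : realType) (G : metric_graph R) (p : gpoint G) (eps : R)
    (q : gpoint G) : Prop :=
  exists2 r, route p q r & r < eps.

Definition nearest_vertex (R : realType) (G : metric_graph R) (q : gpoint G)
    (v0 : vert G) : Prop :=
  forall v : vert G, gdist q (Vertex v0) <= gdist q (Vertex v).

Section Topology.
Variables (R : realType) (G : metric_graph R).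
Implicit Types (p q s : gpoint G).

Lemma route_trans p q s a b : route p q a -> route q s b -> route p s (a + b).
Proof.
elim=> {p q a} [p|e x y q r hx hy _ IH] qs; first by rewrite add0r.
by rewrite -addrA; apply: route_cons => //; exact: IH.
Qed.

Lemma route_sym p q a : route p q a -> route q p a.
Proof.
elim=> {p q a} [p|e x y q r hx hy _ IH]; first exact: route_nil.
rewrite addrC; apply: route_trans IH _.
rewrite distrC -[X in route _ _ X]addr0.
by apply: route_cons => //; exact: route_nil.
Qed.

Lemma gball_center p (e : R) : 0 < e -> gball p e p.
Proof. by move=> e0; exists 0 => //; exact: route_nil. Qed.

Lemma gball_sym p q (e : R) : gball p e q -> gball q e p.
Proof. by case=> r pq re; exists r => //; exact: route_sym. Qed.

Lemma gball_triangle p q s (e1 e2 : R) :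
  gball p e1 q -> gball q e2 s -> gball p (e1 + e2) s.
Proof.
case=> a pq ae [b qs be]; exists (a + b); last exact: ltrD.
exact: route_trans qs.
Qed.

HB.instance Definition _ := gen_eqMixin (gpoint G).
HB.instance Definition _ := gen_choiceMixin (gpoint G).
HB.instance Definition _ :=
  hasNbhs.Build (gpoint G) (nbhs_ (entourage_ (@gball R G))).
HB.instance Definition _ := Nbhs_isPseudoMetric.Build R (gpoint G)
  erefl gball_center gball_sym gball_triangle erefl.

End Topology.

Section L2.
Variables (R : realType) (G : metric_graph R).
Local Notation mu := (@lebesgue_measure R).

(* Elements of L^2(G) are represented by functions on G, two functions being
   identified when they agree almost everywhere. Derivatives depend on the
   orientation of the edges and have no value at the vertices, so they are
   families of functions of the edge coordinate. *)
Definition edgewise (f : gpoint G -> R) : edge G -> R -> R :=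
  fun e x => f (pt e x).

Definition edge_sq_int (f : edge G -> R -> R) : Prop :=
  forall e, measurable_fun `[0, len e] (f e) /\
    mu.-integrable `[0, len e] (fun x => ((f e x) ^+ 2)%:E).

Definition edge_inner (f g : edge G -> R -> R) : R :=
  \sum_(e : edge G) (\int[mu]_(x in `[0, len e]) (f e x * g e x))%R.

Definition L2 (f : gpoint G -> R) : Prop := edge_sq_int (edgewise f).

Definition L2inner (f g : gpoint G -> R) : R :=
  edge_inner (edgewise f) (edgewise g).

Definition L2norm (f : gpoint G -> R) : R := Num.sqrt (L2inner f f).

Definition L2eq (f g : gpoint G -> R) : Prop :=
  forall e : edge G, ae_eq mu `[0, len e]%classic (edgewise f e) (edgewise g e).

(* u belongs to H^1(G) and its derivative on each edge is du. Continuity at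
   the vertices is built in, since u has a single value at each vertex. *)
Definition H1 (u : gpoint G -> R) (du : edge G -> R -> R) : Prop :=
  edge_sq_int du /\
  forall e (x : R), 0 <= x <= len e ->
    u (pt e x) = u (pt e 0) + (\int[mu]_(y in `[0, x]) du e y)%R.

(* u is in the domain of -Delta, and -Delta u = f: the operator associated to
   the form ||u'||^2 with domain H^1(G). *)
Definition neg_laplacian (u f : gpoint G -> R) : Prop :=
  [/\ L2 u, L2 f &
  exists w dw, [/\ L2eq u w, H1 w dw &
    forall v dv, H1 v dv -> edge_inner dw dv = L2inner f v]].

(* T is a strongly continuous semigroup of bounded linear operators on L^2(G). *)
Definition C0_semigroup (T : R -> (gpoint G -> R) -> (gpoint G -> R)) : Prop :=
  [/\ forall (t : R) f, 0 <= t -> L2 f -> L2 (T t f),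
      forall (t c : R) f g, 0 <= t -> L2 f -> L2 g ->
        L2eq (T t (fun p => c * f p + g p)) (fun p => c * T t f p + T t g p),
      forall t : R, 0 <= t ->
        exists M : R, forall f, L2 f -> L2norm (T t f) <= M * L2norm f,
      forall f, L2 f -> L2eq (T 0 f) f /\
        (forall s t : R, 0 <= s -> 0 <= t -> L2eq (T (s + t) f) (T s (T t f))) &
      forall f, L2 f -> L2norm (T t f \- f) @[t --> 0^'+] --> (0 : R)].

Definition generator (T : R -> (gpoint G -> R) -> (gpoint G -> R))
    (u g : gpoint G -> R) : Prop :=
  [/\ L2 u, L2 g &
    L2norm (fun p => t^-1 * (T t u p - u p) - g p) @[t --> 0^'+] --> (0 : R)].

(* T t = e^{t Delta}, t >= 0. *)
Definition heat_semigroup (T : R -> (gpoint G -> R) -> (gpoint G -> R)) : Prop :=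
  C0_semigroup T /\
  forall u g, generator T u g <-> neg_laplacian u (\- g).

(* The kernel is determined by the operators only almost everywhere;
   continuity selects the version that can be restricted to the diagonal. *)
Definition heat_kernel (H : R -> gpoint G -> gpoint G -> R) : Prop :=
  exists2 T, heat_semigroup T &
  forall t : R, 0 < t ->
    continuous (fun z : gpoint G * gpoint G => H t z.1 z.2) /\
    forall f, L2 f -> L2eq (T t f) (fun p => L2inner (H t p) f).

Definition heat_diag (H : R -> gpoint G -> gpoint G -> R) (t : R) (q : gpoint G)
    : R :=
  H t q q.

(* The expansion of h(t, q), uniformly in q and in 0 < t <= t0, with constant
   C in the error term and a the minimum edge length. *)
Definition diag_expansion (a : R) (H : R -> gpoint G -> gpoint G -> R)
    (t0 C : R) : Prop :=
  forall (q : gpoint G) (v0 : vert G), nearest_vertex q v0 ->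
  forall t : R, 0 < t <= t0 ->
  exists2 err : R,
    `|err| <= C * (#|edge G|%:R * expR (- a ^+ 2 / (4 * t))) &
    heat_diag H t q = (Num.sqrt (4 * pi * t))^-1 *
      (1 + (2 / (degree v0)%:R - 1) *
             expR (- gdist q (Vertex v0) ^+ 2 / t) + err).

End L2.

(* Main.v *)
Require Import Defs.
From HB Require Import structures.
From mathcomp Require Import all_boot all_order all_algebra.
From mathcomp Require Import all_classical all_reals all_analysis.
From mathcomp Require Import measurable_realfun.
From mathcomp Require Import ring lra.
Set Implicit Arguments.
Unset Strict Implicit.
Unset Printing Implicit Defensive.
Import Order.TTheory GRing.Theory Num.Theory.
Import numFieldNormedType.Exports.
Local Open Scope classical_set_scope.
Local Open Scope ring_scope.

(* Method of images. For q inside an edge, emit from q the heat kernel of the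
   line and scatter it at every vertex with the Kirchhoff coefficients (2 / d
   transmitted, 2 / d - 1 reflected). A wave that has run along n whole edges
   has travelled at least n a0, so the sum of all waves converges like
   (4 m)^n exp (- n^2 a0^2 / 4 t); it solves the heat equation with the vertex
   conditions, and its initial value is the point mass at q. The energy
   inequality identifies its evolution with that of the semigroup, and letting
   the initial time tend to 0 identifies it with H(t, ., q). On the diagonal,
   the direct wave and its reflection at the nearest vertex are the main terms.
   With theta = exp (- a0^2 / 4 t), the bound on t0 says that m theta^2 <= 1, so
   that m^n theta^(n^2) <= m theta theta^((n - 1)^2) and the remaining waves add
   up to O(m theta). A vertex q is a limit of interior points. *)

(** * Square-integrable functions on the edges *)

(** [heat_semigroup] fixes the operators only through their generator; hence the energy argument,
    which asks of the candidate solution nothing but one-sided regularity in time. At time 0 the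
    candidate is a point mass, outside L^2(G), so uniqueness is applied from the starting times 1 /
    (n + 1): they are countably many, one null set serves them all, and the continuity of [H]
    removes it in the limit. The scattered waves vanish at the initial time because they have
    travelled at least [rho], the distance from q to the ends of its edge; their bounds use a
    profile only beyond [rho]. The constant must not see the graph. For m >= 2 the bound on t0 gives
    theta <= m^(-1/2) <= 2^(-1/2), so the powers of theta left once m theta is extracted are summed
    with theta replaced by the fixed number 2^(-1/2). For m = 1 only t <= t0 keeps theta away from
    1, hence the dependence on the edge length. *)

Section SquareIntegrable.
Variable R : realType.
Local Notation mu := (@lebesgue_measure R).
Implicit Types (f g h : R -> R) (a b : R).

(** The condition of [edge_sq_int] on one edge: [edge_sq_int f] is convertible to
    [forall e, sqint 0 (len e) (f e)]. *)
Definition sqint a b f := measurable_fun `[a, b] f /\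
  mu.-integrable `[a, b] (fun x => ((f x) ^+ 2)%:E).

Lemma integrable_mul_sqint a b f g : sqint a b f -> sqint a b g ->
  mu.-integrable `[a, b] (EFin \o (fun x => f x * g x)).
Proof.
move=> [mf f2] [mg g2].
apply: (@le_integrable _ _ _ mu `[a, b]%classic _ _ ((fun x => ((f x) ^+ 2)%:E) \+ (fun x => ((g x) ^+ 2)%:E))%E) => //.
- by apply/measurable_EFinP; exact: measurable_funM.
- move=> x _ /=; rewrite lee_fin [leRHS]ger0_norm ?addr_ge0 ?sqr_ge0// normrM.
  rewrite -[X in _ <= X + _]real_normK ?num_real// -[X in _ <= _ + X]real_normK ?num_real//.
  by have := sqr_ge0 (`|f x| - `|g x|); have := mulr_ge0 (normr_ge0 (f x)) (normr_ge0 (g x)); nra.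
- exact: integrableD.
Qed.

Lemma sqint_lin a b c f g : sqint a b f -> sqint a b g ->
  sqint a b (fun x => c * f x + g x).
Proof.
move=> [mf f2] [mg g2]; split.
  by apply: measurable_funD => //; exact: measurable_funM.
have -> : (fun x => ((c * f x + g x) ^+ 2)%:E) =
   (fun x => ((c ^+ 2)%:E * ((f x) ^+ 2)%:E + (((2 * c)%:E * (f x * g x)%:E) + ((g x) ^+ 2)%:E))%E).
  by apply/funext => x; rewrite -!EFinM -!EFinD; congr (_%:E); ring.
apply: integrableD => //; first exact: integrableZl.
apply: integrableD => //; apply: integrableZl => //.
exact: (@integrable_mul_sqint a b f g).
Qed.

Lemma integrable_bounded a b f (M : R) : measurable_fun `[a, b] f ->
  (forall x, a <= x <= b -> `|f x| <= M) -> mu.-integrable `[a, b] (EFin \o f).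
Proof.
move=> mf fM; apply: measurable_bounded_integrable => //.
  by rewrite /= lebesgue_measure_itv /=; case: ifP => // _; rewrite -EFinB ltry.
exists M; split; first by rewrite num_real.
move=> y My x /=; rewrite in_itv /= => xab.
by apply: le_trans (fM _ xab) (ltW My).
Qed.

Lemma sqint_bounded a b f (M : R) : measurable_fun `[a, b] f ->
  (forall x, a <= x <= b -> `|f x| <= M) -> sqint a b f.
Proof.
move=> mf fM; split => //.
apply: (@integrable_bounded _ _ _ (M ^+ 2)); first exact: measurable_funX.
move=> x xab; rewrite ger0_norm ?sqr_ge0// -real_normK ?num_real//.
by rewrite lerXn2r ?nnegrE ?normr_ge0 ?fM// (le_trans _ (fM _ xab)).
Qed.

Lemma Rintegral_bounded a b f (M : R) : a <= b -> measurable_fun `[a, b] f ->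
  (forall x, a <= x <= b -> `|f x| <= M) ->
  `|\int[mu]_(x in `[a, b]) f x| <= M * (b - a).
Proof.
move=> ab mf fM.
have fi := integrable_bounded mf fM.
apply: le_trans (le_normr_Rintegral _ fi) _ => //.
have -> : M * (b - a) = \int[mu]_(x in `[a, b]) M.
  rewrite Rintegral_cst//= lebesgue_measure_itv/= lte_fin.
  by move: ab; rewrite le_eqVlt => /orP[/eqP ->|->]; rewrite ?ltxx ?subrr.
apply: le_Rintegral => //.
- by apply: (@integrable_bounded _ _ _ M) => [|x xab]; rewrite ?normr_id ?fM//;
    exact: measurableT_comp.
- by apply: (@integrable_bounded _ _ _ `|M|) => //; exact: measurable_cst.
Qed.

Lemma ae_eq_Rintegral a b f g : measurable_fun `[a, b] f -> measurable_fun `[a, b] g ->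
  ae_eq mu `[a, b]%classic f g -> \int[mu]_(x in `[a, b]) f x = \int[mu]_(x in `[a, b]) g x.
Proof.
move=> mf mg fg; rewrite /Rintegral; congr fine.
apply: ae_eq_integral => //; try exact/measurable_EFinP.
by apply: filterS fg => x /= fgx /fgx ->.
Qed.

End SquareIntegrable.

Section EdgeFamilies.
Variables (R : realType) (G : metric_graph R).
Local Notation mu := (@lebesgue_measure R).
Implicit Types (f g h : edge G -> R -> R).

Definition edge_lin (c : R) f g : edge G -> R -> R := fun e x => c * f e x + g e x.

Definition edge_norm f := Num.sqrt (edge_inner f f).

Definition edge_ae f g := forall e : edge G, ae_eq mu `[0, len e]%classic (f e) (g e).

Lemma edge_sq_lin c f g : edge_sq_int f -> edge_sq_int g ->
  edge_sq_int (edge_lin c f g).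
Proof. by move=> hf hg e; apply: sqint_lin; [exact: hf|exact: hg]. Qed.

Lemma edge_innerC f g : edge_inner f g = edge_inner g f.
Proof.
by rewrite /edge_inner; apply: eq_bigr => e _; apply: eq_Rintegral => x _; rewrite mulrC.
Qed.

Lemma edge_inner_lin c f g h : edge_sq_int f -> edge_sq_int g -> edge_sq_int h ->
  edge_inner (edge_lin c f g) h = c * edge_inner f h + edge_inner g h.
Proof.
move=> hf hg hh; rewrite /edge_inner mulr_sumr -big_split/=; apply: eq_bigr => e _.
have ifh := integrable_mul_sqint (hf e) (hh e).
have igh := integrable_mul_sqint (hg e) (hh e).
rewrite -RintegralZl// -RintegralD//; last exact: (integrableZl _ c ifh).
by apply: eq_Rintegral => x _; rewrite /edge_lin mulrDl mulrA.
Qed.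

Lemma edge_inner_linr c f g h : edge_sq_int f -> edge_sq_int g -> edge_sq_int h ->
  edge_inner h (edge_lin c f g) = c * edge_inner h f + edge_inner h g.
Proof.
by move=> hf hg hh; rewrite edge_innerC edge_inner_lin// ![edge_inner _ h]edge_innerC.
Qed.

Lemma edge_inner_ge0 f : 0 <= edge_inner f f.
Proof.
by apply: sumr_ge0 => e _; apply: Rintegral_ge0 => x _; rewrite -expr2 sqr_ge0.
Qed.

Lemma edge_norm_ge0 f : 0 <= edge_norm f. Proof. exact: sqrtr_ge0. Qed.

Lemma edge_norm_sq f : edge_norm f ^+ 2 = edge_inner f f.
Proof. by rewrite sqr_sqrtr// edge_inner_ge0. Qed.

Lemma edge_norm_lin_sq c f g : edge_sq_int f -> edge_sq_int g ->
  edge_norm (edge_lin c f g) ^+ 2 =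
  c ^+ 2 * edge_norm f ^+ 2 + 2 * c * edge_inner f g + edge_norm g ^+ 2.
Proof.
move=> hf hg; have hl := edge_sq_lin c hf hg.
rewrite !edge_norm_sq edge_inner_lin// !edge_inner_linr// [edge_inner g f]edge_innerC.
by ring.
Qed.

(** The squared norm of [c f + g] is a quadratic polynomial in [c] that is nowhere negative; its
    value at [- i / a ^+ 2] is the inequality. *)
Lemma edge_CS f g : edge_sq_int f -> edge_sq_int g ->
  `|edge_inner f g| <= edge_norm f * edge_norm g.
Proof.
move=> hf hg.
have Q c : 0 <= c ^+ 2 * edge_norm f ^+ 2 + 2 * c * edge_inner f g + edge_norm g ^+ 2.
  by rewrite -edge_norm_lin_sq// sqr_ge0.
have a0 := edge_norm_ge0 f; have b0 := edge_norm_ge0 g.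
move: Q a0 b0; set a := edge_norm f; set b := edge_norm g; set i := edge_inner f g.
move=> Q a0 b0; rewrite -ler_sqr ?nnegrE ?mulr_ge0// real_normK ?num_real// exprMn.
have [a_eq0|a_neq0] := eqVneq a 0.
  (* With [a = 0] the polynomial is affine in [c], and a nonzero slope would let it take the value
     -1. *)
  have i0 : i = 0.
    apply/eqP/negPn/negP => i0.
    have := Q (- (b ^+ 2 + 1) / (2 * i)).
    rewrite a_eq0 expr0n mulr0 add0r.
    have -> : 2 * (- (b ^+ 2 + 1) / (2 * i)) * i = - (b ^+ 2 + 1).
      by field; rewrite i0.
    by lra.
  by rewrite i0 a_eq0 expr0n mul0r.
have := Q (- i / a ^+ 2).
have -> : (- i / a ^+ 2) ^+ 2 * a ^+ 2 + 2 * (- i / a ^+ 2) * i + b ^+ 2 =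
   b ^+ 2 - i ^+ 2 / a ^+ 2 by field.
have a2 : 0 < a ^+ 2 by rewrite exprn_gt0// lt_neqAle eq_sym a_neq0.
by rewrite subr_ge0 ler_pdivrMr// mulrC.
Qed.

Lemma edge_norm_lin c f g : edge_sq_int f -> edge_sq_int g ->
  edge_norm (edge_lin c f g) <= `|c| * edge_norm f + edge_norm g.
Proof.
move=> hf hg; rewrite -ler_sqr ?nnegrE ?edge_norm_ge0//; last first.
  by rewrite addr_ge0 ?mulr_ge0 ?edge_norm_ge0.
rewrite edge_norm_lin_sq// sqrrD exprMn real_normK ?num_real// lerD2r lerD2l.
rewrite -[leRHS]mulr_natl -[leLHS]mulrA; apply: ler_wpM2l => //.
apply: le_trans (ler_norm _) _; rewrite normrM -mulrA ler_wpM2l//.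
exact: edge_CS.
Qed.

Lemma edge_norm_bounded f (M : R) : 0 <= M -> (forall e, measurable_fun `[0, len e] (f e)) ->
  (forall e (x : R), 0 <= x <= len e -> `|f e x| <= M) ->
  edge_norm f <= M * Num.sqrt (\sum_(e : edge G) len e).
Proof.
move=> M0 mf fM.
have L0 : 0 <= \sum_(e : edge G) len e by apply: sumr_ge0 => e _; exact/ltW/len_gt0.
rewrite -ler_sqr ?nnegrE ?edge_norm_ge0 ?mulr_ge0 ?sqrtr_ge0//.
rewrite edge_norm_sq exprMn sqr_sqrtr// mulr_sumr; apply: ler_sum => e _.
have := @Rintegral_bounded R 0 (len e) (fun x => f e x * f e x) (M ^+ 2).
rewrite subr0 => H; apply: le_trans (ler_norm _) _; apply: H.
- exact/ltW/len_gt0.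
- exact: measurable_funM.
- by move=> x xl; rewrite normrM expr2 ler_pM ?fM.
Qed.

Lemma edge_inner_ae f g h : edge_sq_int f -> edge_sq_int g -> edge_sq_int h ->
  edge_ae f g -> edge_inner f h = edge_inner g h.
Proof.
move=> hf hg hh fg; apply: eq_bigr => e _; apply: ae_eq_Rintegral.
- by apply: measurable_funM; [exact: (hf e).1|exact: (hh e).1].
- by apply: measurable_funM; [exact: (hg e).1|exact: (hh e).1].
- by apply: filterS (fg e) => x /= fgx /fgx ->.
Qed.

Lemma edge_norm_ae f g : edge_sq_int f -> edge_sq_int g ->
  edge_ae f g -> edge_norm f = edge_norm g.
Proof.
move=> hf hg fg; congr Num.sqrt.
by rewrite (edge_inner_ae hf hg)// edge_innerC (edge_inner_ae hf hg)// edge_innerC.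
Qed.

Lemma edge_ae_sym f g : edge_ae f g -> edge_ae g f.
Proof. by move=> fg e; apply: filterS (fg e) => x /= fgx /fgx. Qed.

Lemma edge_ae_trans f g h : edge_ae f g -> edge_ae g h -> edge_ae f h.
Proof.
move=> fg gh e; apply: filterS2 (fg e) (gh e) => x /= fgx ghx xe.
by rewrite fgx// ghx.
Qed.

Lemma edge_ae_lin c f g f' g' : edge_ae f f' -> edge_ae g g' ->
  edge_ae (edge_lin c f g) (edge_lin c f' g').
Proof.
move=> ff gg e; apply: filterS2 (ff e) (gg e) => x /= fx gx xe.
by rewrite /edge_lin fx// gx.
Qed.

Lemma edge_norm0_ae f : edge_sq_int f -> edge_norm f = 0 -> edge_ae f (fun _ _ => 0).
Proof.
move=> hf f0 e.
have i0 : edge_inner f f = 0 by rewrite -edge_norm_sq f0 expr0n.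
have e0 : (\int[mu]_(x in `[0%R, len e]) (f e x * f e x))%R = 0.
  apply/eqP; move/eqP: i0; rewrite psumr_eq0 => [/allP/(_ e)|e' _].
    by rewrite mem_index_enum => /(_ isT)/implyP/(_ isT).
  by apply: Rintegral_ge0 => x _; rewrite -expr2 sqr_ge0.
have iff := integrable_mul_sqint (hf e) (hf e).
have := (@ae_eq_integral_abs _ _ _ mu `[0, len e]%classic _ (EFin \o (fun x => f e x * f e x))).
case=> //; first exact: measurable_int iff.
move=> H _; apply: filterS (H _) => [x /= Hx /Hx [/eqP]|].
  by rewrite mulf_eq0 orbb => /eqP.
under eq_integral do rewrite /= ger0_norm -?expr2 ?sqr_ge0//.
have /fineK : (\int[mu]_(x in `[0%R, len e]) (EFin \o (fun x => f e x * f e x)%R) x)%E \is a fin_num.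
  exact: integrable_fin_num.
rewrite -/(Rintegral _ _ _) e0 => <-.
by [].
Qed.

End EdgeFamilies.

(** * One-sided continuity and one-sided derivatives *)

Section RightContinuity.
Variable R : realType.

(* [d x y] stands for the distance between the values at [x] and [y] of a
   right-continuous function. Nest intervals of vanishing oscillation. *)
Lemma right_continuous_continuity_point (d : R -> R -> R) (a b : R) :
  (forall x y z, a <= x -> a <= y -> a <= z -> d x z <= d x y + d y z) ->
  (forall x y, a <= x -> a <= y -> d x y = d y x) ->
  (forall x (e : R), a <= x -> 0 < e -> exists2 k : R, 0 < k & forall y, x <= y < x + k -> d x y < e) ->
  a < b ->
  exists2 c, a < c < b &
    forall e : R, 0 < e -> exists2 k : R, 0 < k & forall y, `|y - c| < k -> d c y < e.
Proof.
move=> dtri dsym drc ab.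
(* Right-continuity at the midpoint [m] gives a short interval starting at [m] with small
   oscillation. Strict nesting at both ends puts the common point inside every interval, so
   two-sided neighbourhoods fit. The pair [(0, 0)] is a dummy for invalid intervals. *)
have step (p : nat * (R * R)) : exists q : R * R, a <= p.2.1 -> p.2.1 < p.2.2 ->
    [/\ p.2.1 < q.1, q.1 < q.2, q.2 < p.2.2 &
     forall y, q.1 <= y <= q.2 -> d q.1 y < p.1.+1%:R^-1].
  case: p => n [u v] /=; have [au|] := leP a u; last by exists (0, 0).
  have [uv|] := ltP u v; last by exists (0, 0).
  pose m := (u + v) / 2.
  have am : a <= m by rewrite /m; lra.
  have n0 : 0 < n.+1%:R^-1 :> R by rewrite invr_gt0 ltr0n.
  have [k k0 hk] := drc m _ am n0.
  exists (m, m + Num.min (k / 2) ((v - m) / 2)) => _ _ /=.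
  have hv : 0 < v - m by rewrite /m; lra.
  have h0 : 0 < Num.min (k / 2) ((v - m) / 2) by rewrite lt_min !divr_gt0.
  have h1 : Num.min (k / 2) ((v - m) / 2) <= k / 2 by rewrite ge_min lexx.
  have h2 : Num.min (k / 2) ((v - m) / 2) <= (v - m) / 2 by rewrite ge_min lexx orbT.
  split.
  - by rewrite /m; lra.
  - by lra.
  - by lra.
  - by move=> y /andP[y1 y2]; apply: hk; rewrite y1/=; lra.
have [f hf] := boolp.choice step.
pose I := fix I n : R * R := if n is k.+1 then f (k, I k) else (a, b).
have I1 n : a <= (I n).1 < (I n).2.
  elim: n => [|n /andP[IH1 IH2]] /=; first by rewrite lexx ab.
  have [h1 h2 _ _] := hf (n, I n) IH1 IH2.
  by rewrite h2 (le_trans IH1 (ltW h1)).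
have I2 n : [/\ (I n).1 < (I n.+1).1, (I n.+1).2 < (I n).2 &
     forall y, (I n.+1).1 <= y <= (I n.+1).2 -> d (I n.+1).1 y < n.+1%:R^-1].
  by have /andP[h1 h2] := I1 n; have [? ? ? ?] := hf (n, I n) h1 h2; split.
have mono1 n k : (I n).1 <= (I (n + k)%N).1.
  elim: k => [|k IH]; first by rewrite addn0.
  by rewrite addnS (le_trans IH)// ltW//; case: (I2 (n + k)%N).
have mono2 n k : (I (n + k)%N).2 <= (I n).2.
  elim: k => [|k IH]; first by rewrite addn0.
  by rewrite addnS (le_trans _ IH)// ltW//; case: (I2 (n + k)%N).
have cross n m : (I n).1 <= (I m).2.
  have h1 := mono1 n m; have h2 := mono2 m n; rewrite addnC in h2.
  by apply: le_trans h1 (le_trans _ h2); have /andP[_ /ltW] := I1 (n + m)%N.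
pose A := range (fun n => (I n).1).
have A0 : A !=set0 by exists (I 0%N).1; exists 0%N.
have ubA m : ubound A (I m).2 by move=> _ [n _ <-]; exact: cross.
have hA : has_sup A by split => //; exists (I 0%N).2; exact: ubA.
pose c := sup A.
have lec n : (I n).1 <= c by apply: ub_le_sup; [case: hA|exists n].
have gec n : c <= (I n).2 by apply: ge_sup.
have ltc n : (I n).1 < c by apply: lt_le_trans (lec n.+1); case: (I2 n).
have gtc n : c < (I n).2 by apply: le_lt_trans (gec n.+1) _; case: (I2 n).
exists c; first by have := ltc 0%N; have := gtc 0%N; rewrite /= => -> ->.
move=> e e0.
have [n hn] : exists n : nat, n.+1%:R^-1 < e / 2.
  by have [n' h] := ltr_add_invr (divr_gt0 e0 (ltr0n R 2)); exists n'; rewrite add0r in h.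
have [_ _ osc] := I2 n.
have l1 := ltc n.+1; have l2 := gtc n.+1.
exists (Num.min (c - (I n.+1).1) ((I n.+1).2 - c)); first by rewrite lt_min !subr_gt0 l1 l2.
move=> y; rewrite lt_min => /andP[y1 y2].
have /andP[ya yb] : (I n.+1).1 <= y <= (I n.+1).2.
  by move: y1 y2; rewrite !ltr_norml => /andP[? ?] /andP[? ?]; apply/andP; split; lra.
have /andP[aI _] := I1 n.+1.
have o1 := osc y; rewrite ya yb in o1; have {}o1 := o1 isT.
have o2 := osc c; rewrite (ltW l1) (ltW l2) in o2; have {}o2 := o2 isT.
have ac := le_trans aI (ltW l1); have ay := le_trans aI ya.
have := dtri c (I n.+1).1 y ac aI ay; rewrite (dsym c (I n.+1).1)// => H.
apply: le_lt_trans H _; rewrite [e]splitr.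
by apply: ltrD; [exact: lt_trans o2 hn|exact: lt_trans o1 hn].
Qed.

(** A generator controls right derivatives only, so the mean value theorem is replaced by real
    induction on the set of [x] up to which [phi y <= e * y]. The absence of upward jumps from the
    left puts the supremum in the set; the bound on the right derivative pushes the set beyond it.
    Then [e] tends to 0. *)
Lemma nonincreasing_of_right_derivative (phi : R -> R) :
  phi 0 = 0 ->
  (forall r e : R, 0 <= r -> 0 < e -> exists2 k : R, 0 < k &
     forall h, 0 < h < k -> phi (r + h) <= phi r + e * h) ->
  (forall r e : R, 0 < r -> 0 < e -> exists2 k : R, 0 < k &
     forall h, 0 < h < k -> h <= r -> phi r <= phi (r - h) + e) ->
  forall r, 0 <= r -> phi r <= 0.
Proof.
move=> phi0 hR hL r r0.
suff H e : 0 < e -> phi r <= e * r.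
  apply/ler_addgt0Pr => e e0; rewrite add0r.
  apply: le_trans (H (e / (r + 1)) _) _; first by rewrite divr_gt0// ltr_wpDl.
  rewrite -mulrA ler_piMr// ?(ltW e0)//.
  by rewrite mulrC ler_pdivrMr ?ltr_wpDl// mul1r lerDl.
move=> e0.
pose S := [set x | 0 <= x <= r /\ forall y, 0 <= y <= x -> phi y <= e * y].
have S0 : S 0.
  by split; [rewrite lexx|move=> y; rewrite -eq_le => /eqP <-; rewrite phi0 mulr0].
have hS : has_sup S by split; [exists 0|exists r => x [/andP[]]].
pose c := sup S.
have c0 : 0 <= c by apply: ub_le_sup => //; case: hS.
have cr : c <= r by apply: ge_sup; [exists 0|move=> x [/andP[]]].
have below y : 0 <= y < c -> phi y <= e * y.
  move=> /andP[y0 yc].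
  have [x [_ Sx] yx] := sup_gt (ex_intro _ 0 S0) yc.
  by apply: Sx; rewrite y0 ltW.
have Sc : phi c <= e * c.
  have [->|cn0] := eqVneq c 0; first by rewrite phi0 mulr0.
  have cpos : 0 < c by rewrite lt_neqAle eq_sym cn0.
  apply/ler_addgt0Pr => e' e'0.
  have [k k0 hk] := hL c e' cpos e'0.
  pose h := Num.min (k / 2) c.
  have h0 : 0 < h by rewrite lt_min cpos divr_gt0.
  have hk2 : h <= k / 2 by rewrite ge_min lexx.
  have hc : h <= c by rewrite ge_min lexx orbT.
  have {}hk := hk h _ hc; apply: le_trans (hk _) _; first by rewrite h0/=; lra.
  rewrite lerD2r; apply: le_trans (below _ _) _; first by apply/andP; split; lra.
  by apply: ler_wpM2l; [exact: ltW|lra].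
have [cltr|rlec] := ltP c r; last first.
  by have -> : r = c by apply/eqP; rewrite eq_le rlec cr.
have [k k0 hk] := hR c e c0 e0.
pose h := Num.min (k / 2) (r - c).
have h0 : 0 < h by rewrite lt_min subr_gt0 cltr divr_gt0.
have hk2 : h <= k / 2 by rewrite ge_min lexx.
have hc : h <= r - c by rewrite ge_min lexx orbT.
have : S (c + h).
  split; first by apply/andP; split; lra.
  move=> y /andP[y0 yc]; have [ylt|yge] := ltP y c; first by apply: below; rewrite y0.
  have [->//|ync] := eqVneq y c.
  have yc' : c < y by rewrite lt_neqAle eq_sym ync.
  have := hk (y - c); rewrite subrKC => H.
  by apply: le_trans (H _) _; [apply/andP; split; lra|move: Sc; lra].
have ub := (ub_le_sup hS.2); move=> /ub; rewrite -/c; lra.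
Qed.

End RightContinuity.

Section EdgeDistance.
Variables (R : realType) (G : metric_graph R).
Local Notation mu := (@lebesgue_measure R).
Implicit Types (f g h : edge G -> R -> R).

Lemma edge_sqZ c f : edge_sq_int f -> edge_sq_int (fun e x => c * f e x).
Proof.
move=> hf e; have [mf f2] := hf e; split; first exact: measurable_funM.
have -> : (fun x => ((c * f e x) ^+ 2)%:E) = (fun x => ((c ^+ 2)%:E * ((f e x) ^+ 2)%:E)%E).
  by apply/funext => x; rewrite -EFinM exprMn.
exact: integrableZl.
Qed.

Lemma edge_normZ c f : edge_sq_int f -> edge_norm (fun e x => c * f e x) = `|c| * edge_norm f.
Proof.
move=> hf; rewrite /edge_norm -sqrtr_sqr -sqrtrM ?sqr_ge0//; congr Num.sqrt.
rewrite /edge_inner mulr_sumr; apply: eq_bigr => e _.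
rewrite -RintegralZl//; last exact: (integrable_mul_sqint (hf e) (hf e)).
by apply: eq_Rintegral => x _; ring.
Qed.

Lemma edge_inner_sub f g h : edge_sq_int f -> edge_sq_int g -> edge_sq_int h ->
  edge_inner (edge_lin (-1) g f) h = edge_inner f h - edge_inner g h.
Proof. by move=> *; rewrite edge_inner_lin// mulN1r addrC. Qed.

Lemma edge_ae_refl f : edge_ae f f.
Proof. by move=> e; apply: aeW. Qed.

Definition edge_dist f g := edge_norm (edge_lin (-1) g f).

Lemma edge_dist_tri f g h : edge_sq_int f -> edge_sq_int g -> edge_sq_int h ->
  edge_dist f h <= edge_dist f g + edge_dist g h.
Proof.
move=> hf hg hh; rewrite /edge_dist.
have -> : edge_lin (-1) h f = edge_lin 1 (edge_lin (-1) g f) (edge_lin (-1) h g).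
  by apply/funext => e; apply/funext => x; rewrite /edge_lin; ring.
apply: le_trans (edge_norm_lin _ _ _) _; try exact: edge_sq_lin.
by rewrite normr1 mul1r.
Qed.

Lemma edge_distC f g : edge_sq_int f -> edge_sq_int g -> edge_dist f g = edge_dist g f.
Proof.
move=> hf hg; rewrite /edge_dist.
have -> : edge_lin (-1) g f = (fun e x => -1 * edge_lin (-1) f g e x).
  by apply/funext => e; apply/funext => x; rewrite /edge_lin; ring.
by rewrite edge_normZ ?normrN1 ?mul1r//; exact: edge_sq_lin.
Qed.

Lemma edge_dist_ae f g f' g' : edge_sq_int f -> edge_sq_int g ->
  edge_sq_int f' -> edge_sq_int g' -> edge_ae f f' -> edge_ae g g' ->
  edge_dist f g = edge_dist f' g'.
Proof.
move=> hf hg hf' hg' ff gg; apply: edge_norm_ae; try exact: edge_sq_lin.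
exact: edge_ae_lin.
Qed.

Lemma edge_dist0_ae f g : edge_sq_int f -> edge_sq_int g -> edge_dist f g = 0 -> edge_ae f g.
Proof.
move=> hf hg h0 e.
apply: filterS (edge_norm0_ae (edge_sq_lin (-1) hg hf) h0 e) => x H /H.
by rewrite /edge_lin mulN1r addrC => /subr0_eq.
Qed.

End EdgeDistance.

(** * Sobolev functions and dissipativity *)

Section H1.
Variables (R : realType) (G : metric_graph R).
Local Notation mu := (@lebesgue_measure R).
Implicit Types (u v : gpoint G -> R).

Lemma sqint_integrable (a b x : R) (f : R -> R) : sqint a b f -> x <= b ->
  mu.-integrable `[a, x] (EFin \o f).
Proof.
move=> hf xb.
have h1 : sqint a b (fun _ => 1).
  by apply: (@sqint_bounded _ _ _ _ 1) => [|y _]; [exact: measurable_cst|rewrite normr1].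
have := integrable_mul_sqint hf h1.
have -> : (fun x => f x * 1) = f by apply/funext => y; rewrite mulr1.
move=> H; apply: (@integrableS _ _ _ mu `[a, b]%classic) => //.
by apply: subset_itvl; rewrite bnd_simp.
Qed.

Lemma H1_continuous u du e : H1 u du ->
  {within `[0, len e], continuous (edgewise u e)}.
Proof.
move=> [sq hu].
have l0 := ltW (len_gt0 e).
have ic := sqint_integrable (sq e) (lexx (len e)).
have c1 := parameterized_integral_continuous l0 ic.
have c2 : {within `[0, len e], continuous (fun x => u (pt e 0) + \int[mu]_(y in `[0, x]) du e y)}.
  by move=> x; apply: cvgD; [exact: cvg_cst|exact: c1].
apply: subspace_eq_continuous c2 => x.
by rewrite inE/= in_itv/= => xl; rewrite [RHS]hu.
Qed.

Lemma sqint_continuous (a b : R) (f : R -> R) : {within `[a, b], continuous f} -> sqint a b f.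
Proof.
move=> cf; have mf : measurable_fun `[a, b] f by exact: subspace_continuous_measurable_fun.
have cpt : compact (f @` `[a, b]) by apply: continuous_compact => //; exact: segment_compact.
have [M [_ hM]] := compact_bounded cpt.
apply: (@sqint_bounded _ _ _ _ (M + 1)) => // x xab.
by apply: (hM (M + 1)); [rewrite ltrDl|exists x].
Qed.

Lemma H1_L2 u du : H1 u du -> L2 u.
Proof. by move=> hu e; apply: sqint_continuous; exact: H1_continuous hu. Qed.

Lemma H1_lin c u du v dv : H1 u du -> H1 v dv ->
  H1 (fun p => c * u p + v p) (edge_lin c du dv).
Proof.
move=> [squ hu] [sqv hv]; split; first exact: edge_sq_lin.
move=> e x xl; have /andP[_ xle] := xl; rewrite hu// hv// /edge_lin.
have iu := sqint_integrable (squ e) xle; have iv := sqint_integrable (sqv e) xle.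
by rewrite RintegralD// ?RintegralZl//; [ring|exact: (integrableZl _ c iu)].
Qed.

(** Test both weak equations against the difference of the [H1] representatives: they subtract to
    the squared norm of the difference of the derivatives. *)
Lemma neg_laplacian_dissipative u1 f1 u2 f2 :
  neg_laplacian u1 f1 -> neg_laplacian u2 f2 ->
  0 <= edge_inner (edge_lin (-1) (edgewise f2) (edgewise f1))
                  (edge_lin (-1) (edgewise u2) (edgewise u1)).
Proof.
move=> [Lu1 Lf1 [w1 [dw1 [uw1 Hw1 P1]]]] [Lu2 Lf2 [w2 [dw2 [uw2 Hw2 P2]]]].
have Hv := H1_lin (-1) Hw2 Hw1; set v := (fun p => _) in Hv.
set dv := edge_lin _ _ _ in Hv.
have Lv := H1_L2 Hv.
have sf := edge_sq_lin (-1) Lf2 Lf1.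
have su := edge_sq_lin (-1) Lu2 Lu1.
rewrite edge_innerC (edge_inner_ae su (g := edgewise v))//; last first.
  by apply: edge_ae_lin; [exact: uw2|exact: uw1].
rewrite edge_innerC edge_inner_sub//; last first.
have := P1 _ _ Hv; rewrite /L2inner => <-; have := P2 _ _ Hv; rewrite /L2inner => <-.
rewrite -edge_inner_sub; [exact: edge_inner_ge0|exact: Hw1.1|exact: Hw2.1|exact: Hv.1].
Qed.

End H1.

(** * Uniqueness for the heat semigroup *)

Section Semigroup.
Variables (R : realType) (G : metric_graph R).
Local Notation mu := (@lebesgue_measure R).
Implicit Types (f g : gpoint G -> R).
Variable T : R -> (gpoint G -> R) -> (gpoint G -> R).
Hypothesis hC : C0_semigroup T.

Let dist f g := edge_dist (edgewise f) (edgewise g).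

Lemma semigroup_L2 t f : 0 <= t -> L2 f -> L2 (T t f).
Proof. by case: hC => h _ _ _ _; exact: h. Qed.

Lemma semigroup_lin t c f g : 0 <= t -> L2 f -> L2 g ->
  L2eq (T t (fun p => c * f p + g p)) (fun p => c * T t f p + T t g p).
Proof. by case: hC => _ h _ _ _; exact: h. Qed.

Lemma L2_lin c f g : L2 f -> L2 g -> L2 (fun p => c * f p + g p).
Proof. by move=> hf hg; exact: (edge_sq_lin c hf hg). Qed.

(** The bound depends on [t] and nothing makes it uniform near a given time. Composing with [T s]
    therefore carries continuity at 0 to the right of [s], but says nothing on the left. *)
Lemma semigroup_bound t : 0 <= t ->
  exists2 M : R, 0 <= M & forall f, L2 f -> L2norm (T t f) <= M * L2norm f.
Proof.
case: hC => _ _ h _ _ /h [M hM]; exists `|M| => // f /hM H.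
by apply: le_trans H _; rewrite ler_wpM2r ?sqrtr_ge0// ler_norm.
Qed.

Lemma semigroup_add s t f : 0 <= s -> 0 <= t -> L2 f -> L2eq (T (s + t) f) (T s (T t f)).
Proof. by case: hC => _ _ _ h _ s0 t0 hf; case: (h f hf) => _; exact. Qed.

Lemma semigroup_right0 f e : L2 f -> 0 < e ->
  exists2 k : R, 0 < k & forall t, 0 < t < k -> dist (T t f) f < e.
Proof.
case: hC => _ _ _ _ h hf e0.
have /cvgrPdist_lt/(_ e e0) := h f hf.
move=> [k /= k0 hk]; exists k => // t /andP[t0 tk].
have := hk t; rewrite /= distrC subr0 gtr0_norm// tk => /(_ isT t0).
rewrite sub0r normrN ger0_norm ?sqrtr_ge0//.
rewrite /dist /edge_dist /L2norm /L2inner -/(edge_norm _).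
congr (edge_norm _ < _); apply/funext => i; apply/funext => x.
by rewrite /edge_lin /edgewise/= mulN1r addrC.
Qed.

Lemma semigroup_dist t : 0 <= t ->
  exists2 M : R, 0 <= M & forall f g, L2 f -> L2 g -> dist (T t f) (T t g) <= M * dist f g.
Proof.
move=> t0; have [M M0 hM] := semigroup_bound t0; exists M => // f g hf hg.
have := hM _ (L2_lin (-1) hg hf).
rewrite /L2norm /L2inner -!/(edge_norm _).
rewrite (edge_norm_ae _ _ (semigroup_lin (-1) t0 hg hf)) //.
- exact: semigroup_L2 (L2_lin _ hg hf).
- exact: L2_lin (semigroup_L2 t0 hg) (semigroup_L2 t0 hf).
Qed.

Lemma semigroup_dist_shift t s s' f : 0 <= t -> 0 <= s -> 0 <= s' -> L2 f ->
  dist (T (t + s) f) (T (t + s') f) = dist (T t (T s f)) (T t (T s' f)).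
Proof.
move=> t0 s0 s0' hf; apply: edge_dist_ae;
  try (by do ?[apply: semigroup_L2 => //; rewrite ?addr_ge0//]); exact: semigroup_add.
Qed.

Lemma semigroup0 f : L2 f -> L2eq (T 0 f) f.
Proof. by case: hC => _ _ _ h _ hf; case: (h f hf). Qed.

Lemma semigroup_right_continuous s f e : 0 <= s -> L2 f -> 0 < e ->
  exists2 k : R, 0 < k & forall t, s <= t < s + k -> dist (T s f) (T t f) < e.
Proof.
move=> s0 hf e0; have [M M0 hM] := semigroup_dist s0.
(* [M + 1] instead of [M], which may be 0. *)
have [|k k0 hk] := @semigroup_right0 f (e / (M + 1)) hf; first by rewrite divr_gt0// ltr_wpDl.
exists k => // t /andP[st tk].
have [->|nst] := eqVneq t s.
  rewrite /dist /edge_dist.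
  have hL := semigroup_L2 s0 hf.
  have -> : edge_lin (-1) (edgewise (T s f)) (edgewise (T s f)) =
      (fun i x => 0 * edgewise (T s f) i x).
    by apply/funext => i; apply/funext => x; rewrite /edge_lin; ring.
  by rewrite edge_normZ// normr0 mul0r.
have ts : 0 < t - s by rewrite subr_gt0 lt_neqAle eq_sym nst.
have hts : 0 < t - s < k by rewrite ts ltrBlDl.
have -> : dist (T s f) (T t f) = dist (T (s + 0) f) (T (s + (t - s)) f).
  by rewrite addr0 subrKC.
rewrite semigroup_dist_shift// ?(ltW ts)//.
have L1 := semigroup_L2 (lexx 0) hf; have L2' := semigroup_L2 (ltW ts) hf.
apply: le_lt_trans (hM _ _ L1 L2') _.
have -> : dist (T 0 f) (T (t - s) f) = dist (T (t - s) f) f.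
  rewrite /dist edge_distC//.
  apply: edge_dist_ae => //; last exact: semigroup0.
  exact: edge_ae_refl.
have := hk _ hts; rewrite ltr_pdivlMr ?ltr_wpDl// => H.
apply: le_lt_trans H; rewrite mulrC ler_wpM2l ?lerDl//.
exact: edge_norm_ge0.
Qed.

(* Right-continuity yields a point of continuity c < r, which T (r - c) moves
   to r. *)
Lemma semigroup_left_continuous r f e : 0 < r -> L2 f -> 0 < e ->
  exists2 k : R, 0 < k & forall h, 0 < h < k -> h <= r -> dist (T r f) (T (r - h) f) < e.
Proof.
move=> r0 hf e0.
have Lt t : 0 <= t -> edge_sq_int (edgewise (T t f)) by move=> t0; exact: semigroup_L2.
have [||x e' x0 e'0||c /andP[c0 cr] hc] :=
    @right_continuous_continuity_point R (fun x y => dist (T x f) (T y f)) 0 r.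
- by move=> x y z x0 y0 z0; apply: edge_dist_tri; exact: Lt.
- by move=> x y x0 y0; apply: edge_distC; exact: Lt.
- exact: semigroup_right_continuous.
- exact: r0.
have rc : 0 <= r - c by rewrite subr_ge0 ltW.
have [M M0 hM] := semigroup_dist rc.
have [|k k0 hk] := hc (e / (M + 1)); first by rewrite divr_gt0// ltr_wpDl.
exists (Num.min k c); first by rewrite lt_min k0.
move=> h /andP[h0]; rewrite lt_min => /andP[hk' hc'] _.
have ch : 0 <= c - h by rewrite subr_ge0 ltW.
have -> : dist (T r f) (T (r - h) f) = dist (T (r - c + c) f) (T (r - c + (c - h)) f).
  by congr (dist (T _ f) (T _ f)); ring.
rewrite semigroup_dist_shift// ?(ltW c0)//.
apply: le_lt_trans (hM _ _ (semigroup_L2 (ltW c0) hf) (semigroup_L2 ch hf)) _.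
have := hk (c - h); rewrite [c - h - c]addrAC subrr sub0r normrN gtr0_norm// => /(_ hk').
rewrite ltr_pdivlMr ?ltr_wpDl// => H.
apply: le_lt_trans H; rewrite mulrC ler_wpM2l ?lerDl//.
exact: edge_norm_ge0.
Qed.

End Semigroup.

Section Uniqueness.
Variables (R : realType) (G : metric_graph R).
Implicit Types (f g u : gpoint G -> R).
Variable T : R -> (gpoint G -> R) -> (gpoint G -> R).
Hypothesis hT : heat_semigroup T.

Let hC : C0_semigroup T := hT.1.

(** The norm of [u' - u - t g]. Free of division by [t], it can be carried along by a bounded
    operator and compared for two orbits. *)
Definition increment_error (t : R) (u' u g : gpoint G -> R) :=
  edge_norm (edge_lin (- t) (edgewise g) (edge_lin (-1) (edgewise u) (edgewise u'))).

Lemma generatorP u g : L2 u -> L2 g ->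
  (generator T u g <-> forall e : R, 0 < e -> exists2 k : R, 0 < k &
     forall t, 0 < t < k -> increment_error t (T t u) u g <= e * t).
Proof.
move=> hu hg.
have E t : 0 < t -> L2norm (fun p => t^-1 * (T t u p - u p) - g p) =
    t^-1 * increment_error t (T t u) u g.
  move=> t0; rewrite -[X in X * _]gtr0_norm ?invr_gt0// /increment_error -edge_normZ.
    rewrite /L2norm /L2inner -/(edge_norm _); congr edge_norm.
    apply/funext => i; apply/funext => x; rewrite /edgewise /edge_lin.
    by field; rewrite gt_eqF.
  do 2 apply: edge_sq_lin => //; exact: (semigroup_L2 hC (ltW t0) hu).
split=> [[_ _ H] e e0|H].
  move/cvgrPdist_lt/(_ e e0) : H => [k /= k0 hk]; exists k => // t /andP[t0 tk].
  have := hk t; rewrite /= distrC subr0 gtr0_norm// tk => /(_ isT t0).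
  rewrite sub0r normrN ger0_norm ?sqrtr_ge0// E// mulrC ltr_pdivrMr//.
  exact: ltW.
split => //; apply/cvgrPdist_le => e e0.
have [k k0 hk] := H e e0; exists k => //= t.
rewrite /= distrC subr0 => tk t0; rewrite gtr0_norm// in tk.
rewrite sub0r normrN ger0_norm ?sqrtr_ge0// E// mulrC ler_pdivrMr//.
by apply: hk; rewrite t0.
Qed.

(** [T r] commutes with [T t], so up to null sets it maps the remainder at [u] to the remainder at
    [T r u], and its boundedness preserves the rate o(t). *)
Lemma generator_orbit r u g : 0 <= r -> generator T u g -> generator T (T r u) (T r g).
Proof.
move=> r0 gug; have [hu hg _] := gug.
have hru := semigroup_L2 hC r0 hu; have hrg := semigroup_L2 hC r0 hg.
apply/generatorP => // e e0.
have [M M0 hM] := semigroup_bound hC r0.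
have [k k0 hk] := (generatorP hu hg).1 gug (e / (M + 1)) (divr_gt0 e0 (ltr_wpDl M0 ltr01)).
exists k => // t t0k; have /andP[t0 tk] := t0k.
have ht := semigroup_L2 hC (ltW t0) hu.
have h1 := L2_lin (-1) hu ht; have h2 := L2_lin (- t) hg h1.
have := hM _ h2; rewrite /L2norm /L2inner -!/(edge_norm _).
set A := edge_norm (edgewise (T r _)) => HA.
have -> : increment_error t (T t (T r u)) (T r u) (T r g) = A.
  apply: edge_norm_ae.
  - do 2 apply: edge_sq_lin => //; exact: (semigroup_L2 hC (ltW t0) hru).
  - exact: (semigroup_L2 hC r0 h2).
  - apply: edge_ae_sym.
    apply: edge_ae_trans (semigroup_lin hC (- t) r0 hg h1) _.
    apply: edge_ae_lin; first exact: edge_ae_refl.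
    apply: edge_ae_trans (semigroup_lin hC (-1) r0 hu ht) _.
    apply: edge_ae_lin; first exact: edge_ae_refl.
    apply: edge_ae_trans (edge_ae_sym (semigroup_add hC r0 (ltW t0) hu)) _.
    by rewrite addrC; exact: (semigroup_add hC (ltW t0) r0 hu).
apply: le_trans HA _; have := hk t t0k.
rewrite /increment_error; set B := edge_norm _ => HB.
apply: le_trans (ler_wpM2l M0 HB) _.
rewrite mulrA ler_wpM2r ?(ltW t0)//.
rewrite mulrCA ler_piMr ?(ltW e0)// ler_pdivrMr ?mul1r ?lerDl//.
exact: ltr_wpDl.
Qed.

Variables (K L : R -> gpoint G -> R).
Hypothesis KL2 : forall r, 0 <= r -> L2 (K r).
Hypothesis K_heat : forall r, 0 <= r -> neg_laplacian (K r) (\- L r).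
Hypothesis K_deriv : forall r e : R, 0 <= r -> 0 < e -> exists2 k : R, 0 < k &
  forall h, 0 < h < k -> increment_error h (K (r + h)) (K r) (L r) <= e * h.
Hypothesis K_left : forall r e : R, 0 < r -> 0 < e -> exists2 k : R, 0 < k &
  forall h, 0 < h < k -> h <= r -> edge_dist (edgewise (K r)) (edgewise (K (r - h))) < e.

Lemma L2_opp f : L2 (\- f) -> L2 f.
Proof.
move=> hf; have := edge_sqZ (-1) hf.
by congr edge_sq_int; apply/funext => e; apply/funext => x; rewrite /edgewise/= mulN1r opprK.
Qed.

Let LL2 r : 0 <= r -> L2 (L r).
Proof. by move=> /K_heat[_ h _]; exact: L2_opp. Qed.

(* The squared norm of the difference of two solutions has nonpositive right
   derivative, by dissipativity. *)
Lemma heat_solution_unique t : 0 <= t -> L2eq (T t (K 0)) (K t).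
Proof.
have u2 := KL2 (lexx 0).
have gen0 : generator T (K 0) (L 0) by apply/(hT.2 _ _).2; exact: K_heat.
have gen r : 0 <= r -> neg_laplacian (T r (K 0)) (\- T r (L 0)).
  by move=> r0; apply/(hT.2 _ _).1; exact: generator_orbit.
have Tu r : 0 <= r -> L2 (T r (K 0)) by move=> r0; exact: semigroup_L2.
have TL r : 0 <= r -> L2 (T r (L 0)) by move=> r0; apply: semigroup_L2 => //; exact: LL2.
pose phi r := edge_dist (edgewise (T r (K 0))) (edgewise (K r)) ^+ 2.
suff H r : 0 <= r -> phi r <= 0.
  move=> t0; apply: edge_dist0_ae; [exact: Tu|exact: KL2|].
  apply/eqP; rewrite -sqrf_eq0 eq_le (H t t0)/=; exact: sqr_ge0.
apply: nonincreasing_of_right_derivative.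
- have := edge_dist_ae (Tu 0 (lexx 0)) (KL2 (lexx 0)) u2 u2 (semigroup0 hC u2) (edge_ae_refl _).
  rewrite /phi => ->; rewrite /edge_dist.
  have -> : edge_lin (-1) (edgewise (K 0)) (edgewise (K 0)) = (fun i x => 0 * edgewise (K 0) i x).
    by apply/funext => i; apply/funext => x; rewrite /edge_lin; ring.
  by rewrite edge_normZ// normr0 mul0r expr0n.
- move=> {}r eta r0 eta0.
  pose z := edge_lin (-1) (edgewise (K r)) (edgewise (T r (K 0))).
  pose g := edge_lin (-1) (edgewise (L r)) (edgewise (T r (L 0))).
  have zs : edge_sq_int z by apply: edge_sq_lin; [exact: KL2|exact: Tu].
  have gs : edge_sq_int g by apply: edge_sq_lin; [exact: LL2|exact: TL].
  have gz : edge_inner g z <= 0.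
    have := neg_laplacian_dissipative (gen r r0) (K_heat r0).
    rewrite -/z; have -> : edge_lin (-1) (edgewise (\- L r)) (edgewise (\- T r (L 0))) =
       (fun i x => -1 * g i x).
      by apply/funext => i; apply/funext => x; rewrite /edge_lin /g /edge_lin /edgewise/=; ring.
    (* The opposite of [g], written as -2 g + g so that [edge_inner_lin] applies. *)
    have -> : (fun i x => -1 * g i x) = edge_lin (-2) g g.
      by apply/funext => i; apply/funext => x; rewrite /edge_lin; ring.
    rewrite edge_inner_lin//; lra.
  set A := edge_norm z; set B := edge_norm g.
  have A0 : 0 <= A by exact: edge_norm_ge0.
  have B0 : 0 <= B by exact: edge_norm_ge0.
  (* Budget for the right derivative: with [N <= A + B] the two remainders contribute at most
     [2 e (A + B) + e], kept below [eta / 2] by this choice; [k3] keeps [h * B ^+ 2] below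
     [eta / 2]. *)
  pose e := Num.min 1 (eta / (4 * (A + B + 1))).
  have D0 : 0 < 4 * (A + B + 1) by lra.
  have e0 : 0 < e by rewrite lt_min ltr01 divr_gt0.
  have e1 : e <= 1 by rewrite ge_min lexx.
  have e2 : e * (4 * (A + B + 1)) <= eta.
    by rewrite -ler_pdivlMr// ge_min lexx orbT.
  have [k1 k10 hk1] := (generatorP (Tu r r0) (TL r r0)).1 ((hT.2 _ _).2 (gen r r0)) (e / 2) (divr_gt0 e0 (ltr0n _ 2)).
  have [k2 k20 hk2] := K_deriv r0 (divr_gt0 e0 (ltr0n R 2)).
  pose k3 := Num.min 1 (eta / (2 * (B ^+ 2 + 1))).
  have BB : 0 <= B ^+ 2 by exact: sqr_ge0.
  have D3 : 0 < 2 * (B ^+ 2 + 1) by lra.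
  exists (Num.min k1 (Num.min k2 k3)); first by rewrite !lt_min k10 k20 ltr01 divr_gt0.
  move=> h; rewrite !lt_min => /andP[h0 /andP[hk1' /andP[hk2' /andP[h1 h3]]]].
  rewrite ltr_pdivlMr// in h3.
  have r1 := hk1 h; rewrite h0 hk1' in r1; have {}r1 := r1 isT.
  have r2 := hk2 h; rewrite h0 hk2' in r2; have {}r2 := r2 isT.
  have rh0 : 0 <= r + h by rewrite addr_ge0// ltW.
  set r1' := increment_error _ _ _ _ in r1; set r2' := increment_error _ _ _ _ in r2.
  pose w1 := edge_lin (- h) (edgewise (T r (L 0))) (edge_lin (-1) (edgewise (T r (K 0))) (edgewise (T h (T r (K 0))))).
  pose w2 := edge_lin (- h) (edgewise (L r)) (edge_lin (-1) (edgewise (K r)) (edgewise (K (r + h)))).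
  have w1s : edge_sq_int w1.
    apply: edge_sq_lin; first exact: TL.
    apply: edge_sq_lin; first exact: Tu.
    by apply: (semigroup_L2 hC (ltW h0)); exact: Tu.
  have w2s : edge_sq_int w2.
    apply: edge_sq_lin; first exact: LL2.
    by apply: edge_sq_lin; exact: KL2.
  have Tt : edge_ae (edgewise (T (r + h) (K 0))) (edgewise (T h (T r (K 0)))).
    by rewrite addrC; exact: (semigroup_add hC (ltW h0) r0 u2).
  have Hn : edge_dist (edgewise (T (r + h) (K 0))) (edgewise (K (r + h))) <=
      edge_norm (edge_lin h g z) + e * h.
    rewrite (edge_dist_ae _ _ _ _ Tt (edge_ae_refl _)); last 4 first.
    - exact: Tu.
    - exact: KL2.
    - by apply: (semigroup_L2 hC (ltW h0)); exact: Tu.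
    - exact: KL2.
    rewrite /edge_dist.
    (* The new difference is [z + h g], an explicit Euler step from the old one, plus the difference
       of the two remainders. *)
    have -> : edge_lin (-1) (edgewise (K (r + h))) (edgewise (T h (T r (K 0)))) =
       edge_lin 1 (edge_lin (-1) w2 w1) (edge_lin h g z).
      apply/funext => i; apply/funext => x.
      by rewrite /w1 /w2 /g /z /edge_lin; ring.
    apply: le_trans (edge_norm_lin 1 (edge_sq_lin (-1) w2s w1s) (edge_sq_lin h gs zs)) _.
    rewrite normr1 mul1r addrC lerD2l.
    apply: le_trans (edge_norm_lin (-1) w2s w1s) _.
    rewrite normrN1 mul1r; move: r1 r2; rewrite /r1' /r2' /increment_error -/w1 -/w2; lra.
  (* Dissipativity discards the cross term [2 h <g, z>], the only one of first order in [h]. *)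
  have Hs : edge_norm (edge_lin h g z) ^+ 2 <= A ^+ 2 + h ^+ 2 * B ^+ 2.
    rewrite edge_norm_lin_sq// -/A -/B.
    by have : h * edge_inner g z <= 0 by [rewrite mulr_ge0_le0// ltW]; lra.
  have Hl : edge_norm (edge_lin h g z) <= A + h * B.
    by have := edge_norm_lin h gs zs; rewrite gtr0_norm// addrC.
  have N0 := edge_norm_ge0 (edge_lin h g z).
  have -> : phi r = A ^+ 2 by [].
  rewrite /phi; move: Hn Hs Hl N0; set N := edge_norm _; set P := edge_dist _ _ => Hn Hs Hl N0.
  have P0 : 0 <= P by exact: edge_norm_ge0.
  have hB : h * B <= B by rewrite ler_piMl// ltW.
  have PN : P ^+ 2 <= (N + e * h) ^+ 2.
    by rewrite lerXn2r ?nnegrE// addr_ge0// mulr_ge0// ltW.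
  apply: le_trans PN _.
  have E1 : (N + e * h) ^+ 2 = N ^+ 2 + h * (2 * e * N + e * (e * h)) by ring.
  rewrite E1; apply: (@le_trans _ _ (A ^+ 2 + h * (h * B ^+ 2 + (2 * e * N + e * (e * h))))).
    by have := Hs; have -> : h ^+ 2 * B ^+ 2 = h * (h * B ^+ 2) by [ring]; rewrite mulrDr; lra.
  rewrite lerD2l [leRHS]mulrC; apply: ler_wpM2l; first exact: ltW.
  have q1 : e * N <= e * (A + B) by apply: ler_wpM2l; [exact: ltW|lra].
  have q2 : e * (e * h) <= e * 1.
    apply: ler_wpM2l; first exact: ltW.
    by rewrite mulr_ile1// ltW.
  have q3 : h * (2 * (B ^+ 2 + 1)) < eta := h3.
  have := ltW h0; lra.
- move=> {}r e r0 e0.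
  set A := edge_dist (edgewise (T r (K 0))) (edgewise (K r)).
  have A0 : 0 <= A by exact: edge_norm_ge0.
  pose eta := Num.min 1 (e / (2 * A + 2)).
  have D0 : 0 < 2 * A + 2 by lra.
  have eta0 : 0 < eta by rewrite lt_min ltr01 divr_gt0.
  have eta1 : eta <= 1 by rewrite ge_min lexx.
  have eta2 : eta * (2 * A + 2) <= e by rewrite -ler_pdivlMr// ge_min lexx orbT.
  have eta20 := divr_gt0 eta0 (ltr0n R 2).
  have [k1 k10 hk1] := semigroup_left_continuous hC r0 u2 eta20.
  have [k2 k20 hk2] := K_left r0 eta20.
  exists (Num.min k1 k2); first by rewrite lt_min k10.
  move=> h; rewrite lt_min => /andP[h0 /andP[hk1' hk2']] hr.
  have d1 := hk1 h; rewrite h0 hk1' in d1; have {}d1 := d1 isT hr.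
  have d2 := hk2 h; rewrite h0 hk2' in d2; have {}d2 := d2 isT hr.
  have rh : 0 <= r - h by rewrite subr_ge0.
  rewrite /phi -/A; set B := edge_dist _ (edgewise (K (r - h))).
  have B0 : 0 <= B by exact: edge_norm_ge0.
  have s1 := Tu r (ltW r0); have s2 := Tu _ rh; have s3 := KL2 (ltW r0); have s4 := KL2 rh.
  have t1 := edge_dist_tri s1 s2 s3; have t2 := edge_dist_tri s2 s4 s3.
  have t3 := edge_dist_tri s2 s1 s4; have t4 := edge_dist_tri s1 s3 s4.
  rewrite (edge_distC s4 s3) in t2; rewrite (edge_distC s2 s1) in t3.
  have AB : A <= B + eta by move: t1 t2; rewrite -/A -/B; lra.
  have BA : B <= A + eta by move: t3 t4; rewrite -/A -/B; lra.
  have [le|lt] := leP A B; first by have := lerXn2r 2 A0 B0 le; lra.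
  have : (A - B) * (A + B) <= eta * (2 * A + 2).
    by apply: ler_pM; lra.
  have -> : (A - B) * (A + B) = A ^+ 2 - B ^+ 2 by ring.
  lra.
Qed.

End Uniqueness.

(** * Waves scattered at the vertices *)

Section RealLemmas.
Variable R : realType.
Local Notation mu := (@lebesgue_measure R).

Lemma exists_half_expn_lt (D e : R) : 0 < e -> exists k : nat, forall j, (k <= j)%N -> D * 2^-1 ^+ j < e.
Proof.
move=> e0.
have h : (fun k : nat => D * 2^-1 ^+ k) @ \oo --> D * 0.
  by apply: cvgMr; apply: cvg_expr; rewrite ger0_norm ?invr_ge0// invf_lt1// ltr1n.
rewrite mulr0 in h; move/cvgrPdist_lt/(_ e e0) : h => [k _ hk]; exists k => j kj.
by have := hk j kj; rewrite /= sub0r normrN => /(le_lt_trans (ler_norm _)).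
Qed.

Lemma half_expn_le (A D : R) : (forall k : nat, A <= D * 2^-1 ^+ k) -> A <= 0.
Proof.
move=> h; apply/ler_addgt0Pr => e e0; rewrite add0r.
have [k hk] := exists_half_expn_lt D e0.
exact: le_trans (h k) (ltW (hk k _)).
Qed.

(** Identities proved for truncated sums of waves pass to the limit by this lemma, both sides being
    close to their truncations at the rate [2^-k]. *)
Lemma half_expn_eq (A B D : R) : (forall k : nat, `|A - B| <= D * 2^-1 ^+ k) -> A = B.
Proof.
by move=> /half_expn_le; rewrite normr_le0 subr_eq0 => /eqP.
Qed.

Lemma cvg_dist_le (u : nat -> R) (l c d : R) (k : nat) :
  u @ \oo --> l -> (forall j, (k <= j)%N -> `|c - u j| <= d) -> `|c - l| <= d.
Proof.
move=> ul h; apply/ler_addgt0Pr => e e0.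
move/cvgrPdist_lt/(_ e e0) : ul => [N _ hN].
have h1 := hN (maxn N k); have h2 := h (maxn N k).
have {}h1 := h1 (leq_maxl _ _); have {}h2 := h2 (leq_maxr _ _).
have -> : c - l = (c - u (maxn N k)) - (l - u (maxn N k)) by ring.
by apply: le_trans (ler_normB _ _) (lerD h2 (ltW h1)).
Qed.

Lemma dyadic_series (u : nat -> R) (B : R) : (forall n, `|u n| <= B * 2^-1 ^+ n) ->
  series u @ \oo --> limn (series u) /\
  forall k, `|limn (series u) - series u k| <= 2 * B * 2^-1 ^+ k.
Proof.
move=> h.
have hc : cvgn (series u).
  apply: normed_cvg; apply: (@series_le_cvg _ _ (geometric B 2^-1)) => //.
  - by move=> n; exact: normr_ge0.
  - by move=> n; apply: le_trans (h n).
  - by apply: is_cvg_geometric_series; rewrite ger0_norm ?invr_ge0// invf_lt1// ltr1n.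
split=> // k; rewrite distrC; apply: (cvg_dist_le (k := k) hc) => j kj.
rewrite distrC -(subnKC kj); move: (j - k)%N => {kj}j.
have B0 : 0 <= B by have := h 0%N; rewrite expr0 mulr1; exact: le_trans.
(* Strengthened for the induction on [j]: the difference of two geometric tails instead of the whole
   tail at [k]. *)
suff H : `|series u (k + j)%N - series u k| <= 2 * B * 2^-1 ^+ k - 2 * B * 2^-1 ^+ (k + j).
  apply: le_trans H _; rewrite gerBl; apply: mulr_ge0; first lra.
  by rewrite exprn_ge0 ?invr_ge0.
elim: j => [|j IH]; first by rewrite addn0 !subrr normr0.
rewrite addnS [series u (k + j).+1]seriesSr -addrAC; apply: le_trans (ler_normD _ _) _.
have := lerD IH (h (k + j)%N) => /le_trans; apply.
by rewrite exprS; lra.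
Qed.

(** The left side is the [n]-th power of [N * q ^+ n], which is at most 1/2 from some [n0] on. The
    sum in the witness covers the terms before [n0], where the power of [q] is bounded by 1. *)
Lemma gauss_dominated_by_geometric (N q : R) : 0 <= N -> 0 <= q < 1 ->
  exists2 M : R, 0 <= M & forall n, N ^+ n * q ^+ (n * n) <= M * 2^-1 ^+ n.
Proof.
move=> N0 /andP[q0 q1].
have [n0 hn0] : exists n0 : nat, forall n, (n0 <= n)%N -> 2 * N * q ^+ n <= 1.
  have h : (fun k : nat => 2 * N * q ^+ k) @ \oo --> 2 * N * 0.
    by apply: cvgMr; apply: cvg_expr; rewrite ger0_norm.
  rewrite mulr0 in h; move/cvgrPdist_lt/(_ 1 ltr01) : h => [k _ hk]; exists k => n kn.
  by have := hk n kn; rewrite /= sub0r normrN => /(le_lt_trans (ler_norm _)) /ltW.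
have q01 k : 0 <= q ^+ k <= 1.
  by rewrite exprn_ge0//= exprn_ile1// ltW.
have N2 : 0 <= 2 * N by rewrite mulr_ge0.
have E n : N ^+ n * q ^+ (n * n) = (2 * N) ^+ n * q ^+ (n * n) * 2^-1 ^+ n.
  by rewrite exprMn exprVn; field; rewrite expf_neq0.
exists (1 + \sum_(k < n0) (2 * N) ^+ k).
  by rewrite addr_ge0// sumr_ge0// => k _; rewrite exprn_ge0.
move=> n; rewrite E; apply: ler_wpM2r; first by rewrite exprn_ge0 ?invr_ge0.
have [n0n|nn0] := leqP n0 n.
  rewrite exprM -exprMn; apply: (@le_trans _ _ 1).
    by apply: exprn_ile1; [rewrite mulr_ge0//; case/andP: (q01 n)|exact: hn0].
  by rewrite lerDl sumr_ge0// => k _; rewrite exprn_ge0.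
rewrite (bigD1 (Ordinal nn0))//= addrCA.
apply: (@le_trans _ _ ((2 * N) ^+ n)).
  by rewrite ler_piMr ?exprn_ge0//; case/andP: (q01 (n * n)%N).
by rewrite lerDl addr_ge0// sumr_ge0// => k _; rewrite exprn_ge0.
Qed.

Lemma is_derive_finsum (I : Type) (r : seq I) (f : I -> R -> R) (df : I -> R) (x : R) :
  (forall i, is_derive x 1 (f i) (df i)) ->
  is_derive x 1 (fun y => \sum_(i <- r) f i y) (\sum_(i <- r) df i).
Proof.
move=> h; elim: r => [|i r IH].
  have -> : (fun y => \sum_(i <- [::]) f i y) = cst 0 by apply/funext => y; rewrite big_nil.
  by rewrite big_nil; exact: is_derive_cst.
have -> : (fun y => \sum_(j <- i :: r) f j y) = (f i) + (fun y => \sum_(j <- r) f j y).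
  by apply/funext => y; rewrite big_cons.
by rewrite big_cons; exact: is_deriveD.
Qed.

Lemma is_derive_scal (c : R) (f : R -> R) (x df : R) :
  is_derive x 1 f df -> is_derive x 1 (fun y => c * f y) (c * df).
Proof. by move=> h; exact: is_deriveZ. Qed.

Lemma is_derive_translate (c : R) (f : R -> R) (x df : R) :
  is_derive (c + x) 1 f df -> is_derive x 1 (fun y => f (c + y)) df.
Proof.
move=> h; rewrite -[df]mulr1.
have hs : is_derive x 1 (fun y => c + y) 1.
  by rewrite -[X in is_derive _ _ _ X]add0r; exact: is_deriveD.
exact: (@is_derive1_comp R f (fun y => c + y) x df 1 h hs).
Qed.

Lemma is_derive_reflect (c : R) (f : R -> R) (x df : R) :
  is_derive (c - x) 1 f df -> is_derive x 1 (fun y => f (c - y)) (- df).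
Proof.
move=> h; rewrite -[df]mulr1 -mulrN.
have hs : is_derive x 1 (fun y => c - y) (-1).
  by rewrite -[X in is_derive _ _ _ X]add0r; apply: is_deriveD; exact: is_deriveN.
exact: (@is_derive1_comp R f (fun y => c - y) x df (-1) h hs).
Qed.

Lemma is_derive_continuous (f f' : R -> R) :
  (forall y : R, is_derive y 1 f (f' y)) -> continuous f.
Proof.
move=> h x; apply: differentiable_continuous; apply/derivable1_diffP.
by have := h x; case.
Qed.

Lemma Rintegral_is_derive (f f' : R -> R) (x : R) : 0 <= x ->
  (forall y : R, is_derive y 1 f (f' y)) -> continuous f' ->
  \int[mu]_(y in `[0, x]) f' y = f x - f 0.
Proof.
rewrite le_eqVlt => /orP[/eqP <-|x0] hf cf'.
  by rewrite set_itv1 Rintegral_set1 subrr.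
have cf := is_derive_continuous hf.
rewrite /Rintegral (continuous_FTC2 x0 (F := f))//.
- exact: continuous_subspaceT.
- split=> [y _| |]; first by case: (hf y).
  + exact: cvg_at_right_filter (cf 0).
  + exact: cvg_at_left_filter (cf x).
- by move=> y _; rewrite derive1E; case: (hf y).
Qed.

Lemma continuous_measurable_itv (f : R -> R) (D : set R) : measurable D -> continuous f ->
  measurable_fun D f.
Proof. by move=> mD cf; apply: measurable_funTS; exact: continuous_measurable_fun. Qed.

End RealLemmas.

(** * Directed edges and Kirchhoff scattering *)

Section Darts.
Variables (R : realType) (G : metric_graph R).

(* A dart is an edge with a direction of travel; [true] means from [tgt e] to [src e]. *)
Definition dart := (edge G * bool)%type.
Definition dart_from (b : dart) := if b.2 then tgt b.1 else src b.1.
Definition dart_to (b : dart) := if b.2 then src b.1 else tgt b.1.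
Definition dart_rev (b : dart) : dart := (b.1, ~~ b.2).

Lemma dart_revK : involutive dart_rev. Proof. by move=> [e s]; rewrite /dart_rev/= negbK. Qed.

Lemma dart_from_rev b : dart_from (dart_rev b) = dart_to b.
Proof. by case: b => e []. Qed.

Lemma dart_to_rev b : dart_to (dart_rev b) = dart_from b.
Proof. by case: b => e []. Qed.

Lemma sum_dart (F : dart -> R) : \sum_b F b = \sum_e (F (e, false) + F (e, true)).
Proof.
rewrite (eq_bigr (fun b => F (b.1, b.2))) => [|[]//].
rewrite -(pair_bigA _ (fun e s => F (e, s)))/=.
by apply: eq_bigr => e _; rewrite big_bool/= addrC.
Qed.

(** [degree] counts classical sets; boolean predicates suit the big operators. *)
Lemma degreeE (v : vert G) :
  degree v = (#|[pred e : edge G | src e == v]| + #|[pred e : edge G | tgt e == v]|)%N.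
Proof.
by rewrite /degree; congr addn; apply: eq_card => e; rewrite unfold_in /= asboolb.
Qed.

(** A loop yields two darts leaving the same vertex, which agrees with its contribution 2 to the
    degree. *)
Lemma sum_dart_from (v : vert G) (c : R) :
  \sum_(b | dart_from b == v) c = c *+ degree v.
Proof.
rewrite big_mkcond sum_dart big_split/= -!big_mkcond/= !sumr_const -mulrnDr.
by rewrite degreeE.
Qed.

Lemma degree_gt0 (b : dart) : (0 < degree (dart_from b))%N.
Proof.
rewrite degreeE addn_gt0; case: b => e [] /=; apply/orP; [right|left];
  by apply/card_gt0P; exists e; rewrite inE.
Qed.

(* Kirchhoff scattering: the amplitude on the outgoing dart [b] caused by a
   unit wave arriving along [b']. *)
Definition scat (b b' : dart) : R :=
  if dart_to b' == dart_from b then 2 / (degree (dart_from b))%:R - (b' == dart_rev b)%:R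
  else 0.

Lemma scat_bound b b' : `|scat b b'| <= 2.
Proof.
rewrite /scat; case: ifP => _; last by rewrite normr0.
have d1 : 1 <= (degree (dart_from b))%:R :> R by rewrite ler1n degree_gt0.
have d0 : 0 < (degree (dart_from b))%:R :> R by apply: lt_le_trans d1.
have h1 : 0 <= 2 / (degree (dart_from b))%:R :> R by rewrite divr_ge0// ltW.
have h2 : 2 / (degree (dart_from b))%:R <= 2 :> R by rewrite ler_pdivrMr// ler_peMr.
by rewrite ler_norml; case: (b' == _) => /=; apply/andP; split; lra.
Qed.

(** Amplitude is conserved at a vertex of degree d: d copies of 2 / d minus the reflected 1 make 1.
    The weight factors out because all darts fed by [b'] leave the same vertex. In [flux_balance]
    this becomes the Kirchhoff condition on derivatives. *)
Lemma scat_col_sum (w : vert G -> R) b' :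
  \sum_b w (dart_from b) * scat b b' = w (dart_to b').
Proof.
transitivity (\sum_(b | dart_from b == dart_to b')
    (w (dart_to b') * (2 / (degree (dart_to b'))%:R) - w (dart_to b') * (b == dart_rev b')%:R)).
  rewrite [RHS]big_mkcond; apply: eq_bigr => b _.
  rewrite /scat eq_sym; case: eqP => [->|_]; last by rewrite mulr0.
  by rewrite mulrBr -[in b' == _](inv_eq dart_revK) [b == _]eq_sym.
rewrite sumrB sum_dart_from (bigD1 (dart_rev b'))/= ?dart_from_rev// eqxx mulr1.
rewrite big1 => [|b /andP[_ /negbTE ->]]; last by rewrite mulr0.
have d0 := degree_gt0 (dart_rev b'); rewrite dart_from_rev in d0.
rewrite addr0 -[X in X - _]mulr_natr -mulrA divfK ?pnatr_eq0 -?lt0n//; ring.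
Qed.

End Darts.

Section Waves.
Variables (R : realType) (G : metric_graph R) (e0 : edge G) (x0 : R).
Local Notation mu := (@lebesgue_measure R).
Local Notation dart := (dart G).
Implicit Types (p q : R -> R) (b : dart) (n k : nat) (y : R).

(* The source is the point of coordinate [x0] on [e0]; a wave of profile [p]
   reaches the end [dart_to (e0, s)] after travelling [src_dist s]. *)
Definition src_dist (s : bool) : R := if s then x0 else len e0 - x0.

(** Here [y] is measured beyond the end of [b]. Only the two darts of [e0] carry a wave straight
    from the source. *)
Definition init_wave p b y : R := if b.1 == e0 then p (src_dist b.2 + y) else 0.

(** The contribution at distance [y] from the start of [b] of the waves that have run along exactly
    [n] whole edges before entering [b]. A wave that leaves [b'] is its own profile continued past
    the end, hence the argument [len b'.1 + y]. *)
Fixpoint wave n p b y : R :=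
  if n is k.+1 then \sum_b' scat b b' * wave k p b' (len b'.1 + y)
  else \sum_b' scat b b' * init_wave p b' y.

Definition waves_upto k p b y : R := \sum_(0 <= n < k) wave n p b y.
Definition waves p b y : R := limn (series (fun n => wave n p b y)).

Lemma sum_init_wave (F : dart -> R) p y :
  \sum_b F b * init_wave p b y =
  F (e0, false) * p (len e0 - x0 + y) + F (e0, true) * p (x0 + y).
Proof.
rewrite sum_dart (bigD1 e0)//= /init_wave /= eqxx big1 ?addr0// => e /negbTE /= ->.
by rewrite !mulr0 addr0.
Qed.

Lemma wave_lin n c p q b y :
  wave n (fun z => c * p z + q z) b y = c * wave n p b y + wave n q b y.
Proof.
elim: n b y => [|n IH] b y /=; rewrite mulr_sumr -big_split; apply: eq_bigr => b' _ /=.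
  by rewrite /init_wave; case: ifP => _; ring.
by rewrite IH; ring.
Qed.

Lemma waves_upto_lin k c p q b y :
  waves_upto k (fun z => c * p z + q z) b y = c * waves_upto k p b y + waves_upto k q b y.
Proof.
rewrite /waves_upto mulr_sumr -big_split; apply: eq_bigr => n _.
exact: wave_lin.
Qed.

(** The scattering relation at the vertices, with one generation fewer on the right; the gap closes
    in the limit, see [waves_rec]. *)
Lemma waves_upto_rec k p b y :
  waves_upto k.+1 p b y =
  \sum_b' scat b b' * (init_wave p b' y + waves_upto k p b' (len b'.1 + y)).
Proof.
rewrite /waves_upto big_nat_recl//=.
under [RHS]eq_bigr do rewrite mulrDr.
rewrite big_split/=; congr (_ + _).
under [RHS]eq_bigr do rewrite mulr_sumr.
by rewrite exchange_big.
Qed.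

Lemma is_derive_wave n p p' b y : (forall z : R, is_derive z 1 p (p' z)) ->
  is_derive y 1 (wave n p b) (wave n p' b y).
Proof.
move=> hp; elim: n b y => [|n IH] b y; apply: is_derive_finsum => b'; apply: is_derive_scal.
  rewrite /init_wave; case: ifP => _; last exact: is_derive_cst.
  exact: (is_derive_translate (hp (src_dist b'.2 + y))).
exact: (is_derive_translate (IH b' (len b'.1 + y))).
Qed.

Lemma is_derive_waves_upto k p p' b y : (forall z : R, is_derive z 1 p (p' z)) ->
  is_derive y 1 (waves_upto k p b) (waves_upto k p' b y).
Proof.
by move=> hp; apply: is_derive_finsum => n; exact: is_derive_wave.
Qed.

(** The sign [s] on the waves running from [tgt e] to [src e] makes the family stable under
    differentiation, which replaces [s] by [- s] and [p] by its derivative. The solution itself has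
    [s = 1]. *)
Definition field_upto k (s : R) p (e : edge G) x : R :=
  (if e == e0 then p (x - x0) else 0) +
  waves_upto k p (e, false) x + s * waves_upto k p (e, true) (len e - x).

Definition field (s : R) p (e : edge G) x : R :=
  (if e == e0 then p (x - x0) else 0) +
  waves p (e, false) x + s * waves p (e, true) (len e - x).

Lemma fieldE (s : R) p e x : field s p e x = (if e == e0 then p (x - x0) else 0) +
  waves p (e, false) x + s * waves p (e, true) (len e - x).
Proof. by []. Qed.

Lemma init_waveE p b y : init_wave p b y = if b.1 == e0 then p (src_dist b.2 + y) else 0.
Proof. by []. Qed.

Lemma is_derive_field_upto k (s : R) p p' e (x : R) : (forall z : R, is_derive z 1 p (p' z)) ->
  is_derive x 1 (field_upto k s p e) (field_upto k (- s) p' e x).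
Proof.
move=> hp; rewrite /field_upto; apply: is_deriveD; first apply: is_deriveD.
- case: ifP => _; last exact: is_derive_cst.
  have -> : (fun z => p (z - x0)) = (fun z => p (- x0 + z)) by apply/funext => z; rewrite addrC.
  by rewrite [x - x0]addrC; exact: (is_derive_translate (hp (- x0 + x))).
- exact: is_derive_waves_upto.
- rewrite mulNr -mulrN; apply: is_derive_scal.
  exact: (is_derive_reflect (is_derive_waves_upto k (e, true) (len e - x) hp)).
Qed.

Section Bounds.
Variables (rho a : R).
Hypothesis rho0 : 0 < rho.
Hypothesis rho_x0 : rho <= x0.
Hypothesis rho_len : rho <= len e0 - x0.
Hypothesis a0 : 0 < a.
Hypothesis a_min : forall e : edge G, a <= len e.

(** There are 2 m darts, each with a scattering coefficient of absolute value at most 2. *)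
Let N : R := 4 * (#|edge G|)%:R.

(** Each generation costs a factor [N] and adds at least [a] to the distance travelled. The majorant
    is assumed only beyond [rho], which every scattered wave has already covered: near 0 the heat
    profile blows up as time tends to 0. *)
Lemma wave_majorant n p (gam : R -> R) b y :
  (forall z z', 0 <= z <= z' -> gam z' <= gam z) ->
  (forall z, rho <= z -> `|p z| <= gam z) -> 0 <= y ->
  `|wave n p b y| <= 4 * N ^+ n * gam (n%:R * a + y).
Proof.
move=> gmono hp; elim: n b y => [|n IH] b y y0.
  rewrite /= sum_init_wave expr0 mulr1 mul0r add0r.
  have H c : rho <= c -> `|p (c + y)| <= gam y.
    move=> hc; apply: le_trans (hp _ _) (gmono _ _ _).
      by rewrite (le_trans hc)// lerDl.
    by rewrite y0 lerDr (le_trans (ltW rho0)).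
  have G0 : 0 <= gam y by apply: le_trans (H _ rho_x0).
  apply: le_trans (ler_normD _ _) _; rewrite !normrM.
  have h1 := ler_pM (normr_ge0 _) (normr_ge0 _) (scat_bound b (e0, false)) (H _ rho_len).
  have h2 := ler_pM (normr_ge0 _) (normr_ge0 _) (scat_bound b (e0, true)) (H _ rho_x0).
  lra.
rewrite [wave _ _ _ _]/=; apply: le_trans (ler_norm_sum _ _ _) _.
set B := 4 * N ^+ n * gam (n.+1%:R * a + y).
have -> : 4 * N ^+ n.+1 * gam (n.+1%:R * a + y) = \sum_(b' : dart) 2 * B.
  rewrite sumr_const card_prod card_bool -[RHS]mulr_natl natrM /B /N exprS; ring.
apply: ler_sum => b' _; rewrite normrM; apply: ler_pM; rewrite ?normr_ge0 ?scat_bound//.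
have l0 : 0 <= len b'.1 by exact/ltW/len_gt0.
apply: le_trans (IH _ _ _) _; first by rewrite addr_ge0.
rewrite /B; apply: ler_wpM2l.
  by rewrite mulr_ge0// exprn_ge0// /N mulr_ge0.
apply: gmono; rewrite -natr1 mulrDl mul1r -addrA; apply/andP; split.
  by rewrite !addr_ge0// ?mulr_ge0// ltW.
by rewrite lerD2l lerD2r.
Qed.

Section Gauss.
Variables (p : R -> R) (C kap : R).
Hypothesis kap0 : 0 < kap.
Hypothesis hp : forall z, rho <= z -> `|p z| <= C * expR (- kap * z ^+ 2).

Lemma gauss_const_ge0 : 0 <= C.
Proof.
have := le_trans (normr_ge0 _) (hp (lexx rho)).
by rewrite pmulr_lge0// expR_gt0.
Qed.

Lemma wave_gauss n b y : 0 <= y ->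
  `|wave n p b y| <= 4 * C * (N ^+ n * expR (- kap * a ^+ 2) ^+ (n * n)).
Proof.
move=> y0; have C0 := gauss_const_ge0.
have gmono z z' : 0 <= z <= z' -> C * expR (- kap * z' ^+ 2) <= C * expR (- kap * z ^+ 2).
  move=> /andP[z0 zz]; apply: ler_wpM2l => //; rewrite ler_expR !mulNr lerN2.
  by apply: ler_wpM2l; [exact: ltW|rewrite lerXn2r ?nnegrE// (le_trans z0)].
apply: le_trans (wave_majorant n b gmono hp y0) _.
rewrite -[leRHS]mulrA -[leLHS]mulrA ler_pM2l// mulrCA; apply: ler_wpM2l => //.
apply: ler_wpM2l; first by rewrite exprn_ge0// mulr_ge0.
have -> : expR (- kap * a ^+ 2) ^+ (n * n) = expR (- kap * (n%:R * a) ^+ 2).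
  by rewrite -expRM_natl natrM; congr expR; ring.
have na : 0 <= n%:R * a by rewrite mulr_ge0// ltW.
rewrite ler_expR !mulNr lerN2 ler_wpM2l ?(ltW kap0)//.
by rewrite lerXn2r ?nnegrE ?lerDl// addr_ge0.
Qed.

End Gauss.

(** [M] is chosen before the profile. This uniformity lets bounds on profiles, such as Taylor
    remainders in time, be transferred to the sums of waves. *)
Lemma wave_dyadic (kap : R) : 0 < kap -> exists2 M : R, 0 <= M &
  forall p C, (forall z, rho <= z -> `|p z| <= C * expR (- kap * z ^+ 2)) ->
  forall n b y, 0 <= y -> `|wave n p b y| <= M * C * 2^-1 ^+ n.
Proof.
move=> kap0.
have q01 : 0 <= expR (- kap * a ^+ 2) < 1.
  rewrite expR_ge0/= expR_lt1 mulNr oppr_lt0 mulr_gt0// exprn_gt0//.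
have N0 : 0 <= N by rewrite mulr_ge0.
have [M M0 hM] := gauss_dominated_by_geometric N0 q01.
exists (4 * M); first by rewrite mulr_ge0.
move=> p C hp n b y y0.
apply: le_trans (wave_gauss kap0 hp n b y0) _.
have := hM n; have C0 := gauss_const_ge0 hp => H.
have -> : 4 * M * C * 2^-1 ^+ n = 4 * C * (M * 2^-1 ^+ n) by ring.
by apply: ler_wpM2l => //; rewrite mulr_ge0.
Qed.

Definition gauss_dominated p := exists C kap : R, 0 < kap /\
  forall z, rho <= z -> `|p z| <= C * expR (- kap * z ^+ 2).

Lemma waves_cvg p : gauss_dominated p -> exists2 D : R, 0 <= D & forall b y, 0 <= y ->
  (waves_upto ^~ p ^~ b ^~ y) @ \oo --> waves p b y /\
  forall k, `|waves p b y - waves_upto k p b y| <= D * 2^-1 ^+ k.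
Proof.
move=> [C [kap [kap0 hp]]]; have [M M0 hM] := wave_dyadic kap0.
have C0 := gauss_const_ge0 hp.
exists (2 * (M * C)); first by rewrite !mulr_ge0.
move=> b y y0; apply: dyadic_series => n; exact: hM.
Qed.

Lemma waves_bound (kap : R) : 0 < kap -> exists2 M : R, 0 <= M &
  forall p C, (forall z, rho <= z -> `|p z| <= C * expR (- kap * z ^+ 2)) ->
  forall b y, 0 <= y -> `|waves p b y| <= M * C.
Proof.
move=> kap0; have [M M0 hM] := wave_dyadic kap0.
exists (2 * M); first by rewrite mulr_ge0.
move=> p C hp b y y0.
have [_ /(_ 0%N)] := dyadic_series (fun n => hM p C hp n b y y0).
by rewrite expr0 mulr1 -[series _ 0]/(waves_upto 0 p b y) /waves_upto big_geq// subr0 mulrA.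
Qed.

Lemma gauss_dominated_lin c p q : gauss_dominated p -> gauss_dominated q ->
  gauss_dominated (fun z => c * p z + q z).
Proof.
move=> [C [k [k0 hp]]] [D [l [l0 hq]]].
have C0 := gauss_const_ge0 hp; have D0 := gauss_const_ge0 hq.
exists (`|c| * C + D), (Num.min k l); split; first by rewrite lt_min k0.
move=> z hz; apply: le_trans (ler_normD _ _) _; rewrite normrM mulrDl -mulrA.
have mono (u v : R) : v <= u -> expR (- u * z ^+ 2) <= expR (- v * z ^+ 2).
  by move=> uv; rewrite ler_expR !mulNr lerN2 ler_wpM2r ?sqr_ge0.
apply: lerD; last apply: le_trans (hq z hz) _.
  apply: ler_wpM2l => //; apply: le_trans (hp z hz) _.
  by apply: ler_wpM2l => //; apply: mono; rewrite ge_min lexx.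
by apply: ler_wpM2l => //; apply: mono; rewrite ge_min lexx orbT.
Qed.

Lemma waves_lin c p q b y : gauss_dominated p -> gauss_dominated q -> 0 <= y ->
  waves (fun z => c * p z + q z) b y = c * waves p b y + waves q b y.
Proof.
move=> hp hq y0.
have [D1 _ /(_ b y y0)[_ h1]] := waves_cvg hp.
have [D2 _ /(_ b y y0)[_ h2]] := waves_cvg hq.
have [D3 _ /(_ b y y0)[_ h3]] := waves_cvg (gauss_dominated_lin c hp hq).
apply: (@half_expn_eq _ _ _ (D3 + (`|c| * D1 + D2))) => k.
have := h3 k; rewrite waves_upto_lin => {}h3.
set W := waves _ b y in h3 *.
have -> : W - (c * waves p b y + waves q b y) =
  (W - (c * waves_upto k p b y + waves_upto k q b y)) -
  (c * (waves p b y - waves_upto k p b y) + (waves q b y - waves_upto k q b y)) by ring.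
apply: le_trans (ler_normB _ _) _; rewrite mulrDl; apply: lerD => //.
apply: le_trans (ler_normD _ _) _; rewrite mulrDl; apply: lerD => //.
by rewrite normrM -mulrA ler_wpM2l.
Qed.

Lemma waves_rec p b y : gauss_dominated p -> 0 <= y ->
  waves p b y = \sum_b' scat b b' * (init_wave p b' y + waves p b' (len b'.1 + y)).
Proof.
move=> hp y0; have [D D0 h] := waves_cvg hp.
apply: (@half_expn_eq _ _ _ (D + \sum_(b' : dart) 2 * D)) => k.
have E : waves p b y - \sum_b' scat b b' * (init_wave p b' y + waves p b' (len b'.1 + y)) =
  (waves p b y - waves_upto k.+1 p b y) -
  \sum_b' scat b b' * (waves p b' (len b'.1 + y) - waves_upto k p b' (len b'.1 + y)).
  rewrite waves_upto_rec -addrA -opprD; congr (_ - _).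
  by rewrite -big_split; apply: eq_bigr => b' _ /=; ring.
rewrite E; apply: le_trans (ler_normB _ _) _; rewrite mulrDl; apply: lerD.
  apply: le_trans ((h b y y0).2 k.+1) _; apply: ler_wpM2l => //.
  by rewrite exprS ler_piMl ?exprn_ge0 ?invr_ge0// invf_le1// ler1n.
apply: le_trans (ler_norm_sum _ _ _) _; rewrite mulr_suml; apply: ler_sum => b' _.
rewrite normrM -mulrA; apply: ler_pM; rewrite ?normr_ge0 ?scat_bound//.
by apply: (h _ _ _).2; rewrite addr_ge0// ltW// len_gt0.
Qed.

Lemma field_cvg s p : gauss_dominated p -> exists2 D : R, 0 <= D &
  forall e x, 0 <= x <= len e -> forall k, `|field s p e x - field_upto k s p e x| <= D * 2^-1 ^+ k.
Proof.
move=> hp; have [D D0 h] := waves_cvg hp.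
exists (D + `|s| * D); first by rewrite addr_ge0// mulr_ge0.
move=> e x /andP[x_ge xl] k.
have -> : field s p e x - field_upto k s p e x =
  (waves p (e, false) x - waves_upto k p (e, false) x) +
  s * (waves p (e, true) (len e - x) - waves_upto k p (e, true) (len e - x)).
  by rewrite /field /field_upto; ring.
apply: le_trans (ler_normD _ _) _; rewrite mulrDl normrM -mulrA; apply: lerD.
  exact: (h _ _ x_ge).2.
by apply: ler_wpM2l => //; apply: (h _ _ _).2; rewrite subr_ge0.
Qed.

Lemma measurable_field s p e : gauss_dominated p ->
  (forall k, continuous (field_upto k s p e)) -> measurable_fun `[0, len e] (field s p e).
Proof.
move=> hp ck; have [D D0 h] := field_cvg s hp.
apply: (@measurable_fun_cvg _ _ _ _ (fun k => field_upto k s p e)).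
  by move=> k; apply: continuous_measurable_itv.
move=> x /=; rewrite in_itv /= => xl; apply/cvgrPdist_lt => eps eps0.
have [k hk] := exists_half_expn_lt D eps0.
by exists k => // j kj; apply: le_lt_trans (h _ _ xl j) (hk j kj).
Qed.

Lemma field_bounded s p e : gauss_dominated p -> (exists C : R, forall z, `|p z| <= C) ->
  exists M : R, forall x, 0 <= x <= len e -> `|field s p e x| <= M.
Proof.
move=> [C [k [k0 hp]]] [B hB]; have [M M0 hM] := waves_bound k0.
exists (B + M * C + `|s| * (M * C)) => x /andP[x_ge xl].
apply: le_trans (ler_normD _ _) _; apply: lerD; last first.
  by rewrite normrM ler_wpM2l//; apply: (hM p C) => //; rewrite subr_ge0.
apply: le_trans (ler_normD _ _) _; apply: lerD; last exact: (hM p C).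
by case: ifP => _ //; rewrite normr0 (le_trans (normr_ge0 _) (hB 0)).
Qed.

(** Absolute continuity in integral form is what [H1] and [by_parts] ask for. It passes from the
    truncations to the limit by uniform convergence, without differentiating the series. *)
Lemma field_integral s p p' p'' e x :
  gauss_dominated p -> gauss_dominated p' -> (exists C : R, forall z, `|p' z| <= C) ->
  (forall z : R, is_derive z 1 p (p' z)) -> (forall z : R, is_derive z 1 p' (p'' z)) ->
  0 <= x <= len e ->
  field s p e x = field s p e 0 + \int[mu]_(y in `[0, x]) field (- s) p' e y.
Proof.
move=> hp hp' bp' dp dp' xl; have /andP[x_ge xle] := xl.
have [D1 D10 h1] := field_cvg s hp; have [D2 D20 h2] := field_cvg (- s) hp'.
have ck k : continuous (field_upto k (- s) p' e).
  exact: is_derive_continuous (fun y => is_derive_field_upto k (- s) e y dp').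
have mf : measurable_fun `[0, len e] (field (- s) p' e) by exact: measurable_field.
have [M hM] := field_bounded (- s) e hp' bp'.
have sub : `[0, x]%classic `<=` `[0, len e]%classic by apply: subset_itvl; rewrite bnd_simp.
have mf' : measurable_fun `[0, x] (field (- s) p' e) by exact: measurable_funS mf.
have if' : mu.-integrable `[0, x] (EFin \o field (- s) p' e).
  apply: (@integrable_bounded _ _ _ _ M) => // y /andP[y0 yx].
  by apply: hM; rewrite y0 (le_trans yx).
apply: (@half_expn_eq _ _ _ (D1 + (D1 + D2 * x))) => k.
have ik : mu.-integrable `[0, x] (EFin \o field_upto k (- s) p' e).
  apply: continuous_compact_integrable; first exact: segment_compact.
  exact: continuous_subspaceT.
have F := Rintegral_is_derive x_ge (fun y => is_derive_field_upto k s e y dp) (ck k).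
set I := \int[mu]_(y in _) _.
have -> : field s p e x - (field s p e 0 + I) =
   (field s p e x - field_upto k s p e x) - ((field s p e 0 - field_upto k s p e 0) +
     (I - \int[mu]_(y in `[0, x]) field_upto k (- s) p' e y)).
  by rewrite F; ring.
apply: le_trans (ler_normB _ _) _; rewrite mulrDl; apply: lerD; first exact: h1.
apply: le_trans (ler_normD _ _) _; rewrite mulrDl; apply: lerD.
  by apply: h1; rewrite lexx ltW// len_gt0.
rewrite /I -RintegralB// mulrAC -[X in _ * X]subr0; apply: Rintegral_bounded => //.
  apply: measurable_funB => //; exact: continuous_measurable_itv.
by move=> y /andP[y0 yx]; apply: h2; rewrite y0 (le_trans yx).
Qed.

End Bounds.

End Waves.

(** * Integration by parts for absolutely continuous functions *)

Section ByParts.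
Variable R : realType.
Local Notation mu := (@lebesgue_measure R).

Lemma EFin_Rintegral (D : set R) (f : R -> R) : measurable D -> mu.-integrable D (EFin \o f) ->
  (\int[mu]_(x in D) (f x)%:E)%E = (\int[mu]_(x in D) f x)%:E.
Proof. by move=> mD fi; rewrite /Rintegral fineK//; exact: integrable_fin_num. Qed.

Lemma EFin_integral_patch (D : set R) (f : R -> R) : measurable D -> mu.-integrable D (EFin \o f) ->
  (\int[mu]_x ((f \_ D) x)%:E)%E = (\int[mu]_(x in D) f x)%:E.
Proof.
move=> mD fi; rewrite -EFin_Rintegral// [RHS]integral_mkcond.
by apply: eq_integral => x _; rewrite /patch; case: ifP.
Qed.

(* Fubini on the triangle [y <= x]. *)
Lemma triangle_exchange (l M : R) (f g F G : R -> R) : 0 <= l ->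
  measurable_fun `[0, l] f -> (forall x, 0 <= x <= l -> `|f x| <= M) ->
  mu.-integrable `[0, l] (EFin \o g) ->
  (forall x, 0 <= x <= l -> F x = \int[mu]_(y in `[0, x]) f y) ->
  (forall x, 0 <= x <= l -> G x = \int[mu]_(y in `[x, l]) g y) ->
  \int[mu]_(x in `[0, l]) (g x * F x) = \int[mu]_(y in `[0, l]) (f y * G y).
Proof.
move=> l0 mf fM ig hF hG.
have mD := measurable_itv `[(0 : R), l].
pose A : R -> R := f \_ `[0%R, l]%classic; pose B : R -> R := g \_ `[0%R, l]%classic.
have mA := (measurable_restrictT f mD).1 mf; rewrite -/A in mA.
have mg : measurable_fun `[0%R, l]%classic g by apply/measurable_EFinP; exact: measurable_int ig.
have mB := (measurable_restrictT g mD).1 mg; rewrite -/B in mB.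
have if0 : mu.-integrable `[0%R, l]%classic (EFin \o f) by exact: (integrable_bounded mf fM).
(* The integrand cut off outside the triangle; [kx] and [ky] evaluate its two inner integrals. *)
pose k (z : R * R) : R := B z.1 * (A z.2 * (z.2 <= z.1)%R%:R).
have mk : measurable_fun setT k.
  apply: measurable_funM; first exact: measurableT_comp measurable_fst.
  apply: measurable_funM; first exact: measurableT_comp measurable_snd.
  apply: (measurableT_comp (f := fun b : bool => b%:R : R)) => //.
  exact: measurable_fun_ler.
have kx x : (\int[mu]_y (k (x, y))%:E)%E = (((fun x => g x * F x) \_ `[0%R, l]%classic) x)%:E.
  rewrite /patch; case: ifPn => [|xD]; last first.
    under eq_integral do rewrite /k /= /B /patch (negbTE xD) mul0r.
    by rewrite integral0.
  rewrite inE/= in_itv/= => xl; have /andP[x0 xl'] := xl.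
  have sub : `[0, x]%classic `<=` `[0%R, l]%classic by apply: subset_itvl; rewrite bnd_simp.
  have ifx : mu.-integrable `[0, x] (EFin \o f) by exact: integrableS if0.
  rewrite (hF _ xl) -RintegralZl// -EFin_integral_patch//; last exact: (integrableZl _ (g x) ifx).
  apply: eq_integral => y _; congr (_%:E); rewrite /k/= /A /B /patch.
  have -> : x \in `[0%R, l]%classic by rewrite inE/= in_itv/=.
  have [yx|yx] := leP y x; last first.
    rewrite mulr0 mulr0; case: ifP => //; rewrite inE/= in_itv/= => /andP[_].
    by rewrite leNgt yx.
  rewrite mulr1; have [y0|y0] := leP 0 y; last first.
    by rewrite !memNset ?mulr0//= in_itv/= => /andP[]; rewrite leNgt y0.
  by rewrite !mem_set//= in_itv/= y0//= (le_trans yx).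
have ky y : (\int[mu]_x (k (x, y))%:E)%E = (((fun y => f y * G y) \_ `[0%R, l]%classic) y)%:E.
  rewrite /patch; case: ifPn => [|yD]; last first.
    under eq_integral do rewrite /k /= /A /patch (negbTE yD) mul0r mulr0.
    by rewrite integral0.
  rewrite inE/= in_itv/= => yl; have /andP[y0 yl'] := yl.
  have sub : `[y, l]%classic `<=` `[0%R, l]%classic by apply: subset_itvr; rewrite bnd_simp.
  have igy : mu.-integrable `[y, l] (EFin \o g) by exact: integrableS ig.
  rewrite (hG _ yl) -RintegralZl// -EFin_integral_patch//; last exact: (integrableZl _ (f y) igy).
  apply: eq_integral => x _; congr (_%:E); rewrite /k/= /A /B /patch.
  have -> : y \in `[0%R, l]%classic by rewrite inE/= in_itv/=.
  have [yx|yx] := leP y x; last first.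
    rewrite !mulr0; case: ifP => //; rewrite inE/= in_itv/= => /andP[].
    by rewrite leNgt yx.
  rewrite mulr1 [f y * _]mulrC; have [xl|xl] := leP x l; last first.
    by rewrite !memNset ?mul0r//= in_itv/= => /andP[_]; rewrite leNgt xl.
  by rewrite !mem_set ?[g x * _]mulrC//= in_itv/= ?xl ?yx ?(le_trans y0 yx).
(* Tonelli: [f] is bounded by [M] on an interval of length [l], so the inner integral of the
   absolute value is at most [M l |g x|]. *)
have ik : (mu \x mu)%E.-integrable setT (EFin \o k).
  have mk' : measurable_fun setT (EFin \o k) by exact/measurable_EFinP.
  apply/(integrable12ltyP mu mu mk').2 => /=.
  have iB : mu.-integrable `[0%R, l]%classic (EFin \o (fun x => (M * l) * g x)) by exact: (integrableZl _ (M * l) ig).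
  have /integrableP[_] := iB; apply: le_lt_trans.
  rewrite [leRHS]integral_mkcond; apply: ge0_le_integral => //.
  - by move=> x _; exact: integral_ge0.
  - apply: (measurable_fun_fubini_tonelli_F (m2 := mu) (abse \o (EFin \o k))) => //.
    exact: measurableT_comp.
    by move=> x; exact: abse_ge0.
  - have mM : measurable_fun `[0, l] (abse \o (EFin \o (fun x => M * l * g x))).
      by apply: measurableT_comp => //; exact: measurable_int iB.
    exact: ((measurable_restrictT _ mD).1 mM).
  move=> x _ /=; rewrite /patch; case: ifPn => xD; last first.
    under eq_integral do rewrite /k /= /B /patch (negbTE xD) mul0r normr0.
    by rewrite integral0.
  have M0 : 0 <= M by apply: le_trans (fM 0 _); rewrite ?lexx.
  apply: (@le_trans _ _ (\int[mu]_(y in `[0%R, l]%classic) (`|g x| * M)%:E)%E).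
    rewrite [leRHS]integral_mkcond; apply: ge0_le_integral => //.
    - apply/measurable_EFinP; apply: measurableT_comp => //.
      by apply: (measurableT_comp mk); exact: measurable_pair1.
    - have mc : measurable_fun `[0, l] (fun _ : R => (`|g x| * M)%:E) by exact: measurable_cst.
      exact: ((measurable_restrictT _ mD).1 mc).
    move=> y _; rewrite /patch /k/= /B /A /patch xD.
    case: ifPn => yD; last by rewrite mul0r mulr0 normr0.
    rewrite lee_fin !normrM ler_wpM2l//.
    have -> : `|((y <= x)%R%:R : R)| = (y <= x)%R%:R by rewrite ger0_norm.
    apply: (@le_trans _ _ `|f y|).
      by rewrite ler_piMr//; case: (y <= x); rewrite ?ler01.
    by apply: fM; move: yD; rewrite inE/= in_itv.
  rewrite integral_cst//= lebesgue_measure_itv/= lte_fin.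
  move: (l0); rewrite le_eqVlt => /orP[/eqP <-|lpos].
    by rewrite ltxx mule0 lee_fin.
  rewrite lpos -EFinD -EFinM lee_fin subr0 !normrM (ger0_norm M0) (gtr0_norm lpos).
  by have -> : `|g x| * M * l = M * l * `|g x| by ring.
have := Fubini ik; rewrite /fubini_F /fubini_G /=.
under eq_integral do rewrite kx.
under [X in _ = X -> _]eq_integral do rewrite ky.
by move=> /(congr1 fine) H; rewrite [LHS]Rintegral_mkcond [RHS]Rintegral_mkcond; exact: H.
Qed.

(** [v] is given as an integral, with no pointwise derivative, so the product rule is replaced by
    [triangle_exchange] applied to [f x - f 0] and [v l - v x]. *)
Lemma by_parts (l M : R) (f f' v dv : R -> R) : 0 <= l ->
  measurable_fun `[0, l] f' -> (forall x, 0 <= x <= l -> `|f' x| <= M) ->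
  (forall x, 0 <= x <= l -> f x = f 0 + \int[mu]_(y in `[0, x]) f' y) ->
  mu.-integrable `[0, l] (EFin \o dv) ->
  (forall x, 0 <= x <= l -> v x = v 0 + \int[mu]_(y in `[0, x]) dv y) ->
  mu.-integrable `[0, l] (EFin \o (fun x => f x * dv x)) ->
  mu.-integrable `[0, l] (EFin \o (fun x => f' x * v x)) ->
  \int[mu]_(x in `[0, l]) (f x * dv x) =
  f l * v l - f 0 * v 0 - \int[mu]_(x in `[0, l]) (f' x * v x).
Proof.
move=> l0 mf' f'M hf iv hv ifv if'v.
have if' : mu.-integrable `[0, l] (EFin \o f') by exact: (integrable_bounded mf' f'M).
have ll : 0 <= l <= l by rewrite l0 lexx.
have := @triangle_exchange l M f' dv (fun x => f x - f 0) (fun x => v l - v x) l0 mf' f'M iv.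
move=> H; have {H} := H _ _.
have -> : \int[mu]_(x in `[0, l]) (dv x * (f x - f 0)) =
   \int[mu]_(x in `[0, l]) (f x * dv x) - f 0 * (v l - v 0).
  have -> : v l - v 0 = \int[mu]_(x in `[0, l]) dv x by rewrite (hv _ ll); ring.
  rewrite -RintegralZl// -RintegralB//; last exact: (integrableZl _ (f 0) iv).
  by apply: eq_Rintegral => x _; ring.
have -> : \int[mu]_(x in `[0, l]) (f' x * (v l - v x)) =
   (f l - f 0) * v l - \int[mu]_(x in `[0, l]) (f' x * v x).
  have -> : f l - f 0 = \int[mu]_(x in `[0, l]) f' x by rewrite (hf _ ll); ring.
  rewrite -RintegralZr// -RintegralB//; last exact: (integrableZr _ (v l) if').
  by apply: eq_Rintegral => x _; ring.
move=> H; have : \int[mu]_(x in `[0, l]) (f x * dv x) =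
    (f l - f 0) * v l - \int[mu]_(x in `[0, l]) (f' x * v x) + f 0 * (v l - v 0).
  rewrite -H => [|x xl|x /andP[x0 xl]]; first by rewrite subrK.
    by rewrite (hf _ xl) addrC addKr.
  rewrite (hv _ ll) (hv x) ?x0// opprD addrACA subrr add0r.
  rewrite Rintegral_itvB ?bnd_simp//.
  rewrite Rintegral_itv_obnd_cbnd//; apply: integrableS iv => //.
  by apply: subset_itvr; rewrite bnd_simp.
by move=> ->; ring.
Qed.

End ByParts.

(** * The scattered field as a function on the graph *)

Section Points.
Variables (R : realType) (G : metric_graph R).
Implicit Types (e : edge G) (x : R).

Lemma pt0 e : pt e 0 = Vertex (src e).
Proof. by rewrite /pt insubF /= ?lexx// ltxx. Qed.

Lemma pt_len e : pt e (len e) = Vertex (tgt e).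
Proof.
rewrite /pt; case: insubP => [u /=|_]; first by rewrite ltxx andbF.
by rewrite leNgt len_gt0.
Qed.

Lemma pt_cases e x : 0 <= x <= len e ->
  [\/ x = 0, x = len e | 0 < x < len e].
Proof.
move=> /andP[]; rewrite le_eqVlt => /orP[/eqP <-|x0]; first by constructor 1.
by rewrite le_eqVlt => /orP[/eqP ->|xl]; [constructor 2|constructor 3; rewrite x0].
Qed.

Lemma pt_interior e x (h : 0 < x < len e) :
  pt e x = Interior (exist (fun p : edge G * R => 0 < p.2 < len p.1) (e, x) h).
Proof.
rewrite /pt; case: insubP => [u /= _ hu|]; last by rewrite h.
by congr Interior; apply: val_inj; rewrite /= hu.
Qed.

End Points.

Section GraphField.
Variables (R : realType) (G : metric_graph R) (e0 : edge G) (x0 : R).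
Local Notation mu := (@lebesgue_measure R).
Local Notation dart := (dart G).
Implicit Types (p : R -> R) (b : dart).
Variables (rho a : R).
Hypothesis rho0 : 0 < rho.
Hypothesis rho_x0 : rho <= x0.
Hypothesis rho_len : rho <= len e0 - x0.
Hypothesis a0 : 0 < a.
Hypothesis a_min : forall e : edge G, a <= len e.

Local Notation waves := (waves e0 x0).
Local Notation field := (field e0 x0).
Local Notation init_wave := (init_wave e0 x0).

(** All that reaches the end of [b] along [b], straight from the source or scattered. *)
Definition arriving p b := init_wave p b 0 + waves p b (len b.1).

Lemma waves_at0 p b : gauss_dominated rho p ->
  waves p b 0 = \sum_b' scat b b' * arriving p b'.
Proof.
move=> hp; rewrite (waves_rec rho0 rho_x0 rho_len a0 a_min)//.
by apply: eq_bigr => b' _; rewrite addr0.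
Qed.

(** The reflected part -1 of [scat] cancels the wave arriving on the reversed dart. What is left
    depends only on the vertex, which is continuity there. *)
Lemma vertex_value p b : gauss_dominated rho p ->
  arriving p (dart_rev b) + waves p b 0 =
  2 / (degree (dart_from b))%:R * \sum_(b' | dart_to b' == dart_from b) arriving p b'.
Proof.
move=> hp; rewrite waves_at0// mulr_sumr.
have -> : \sum_b' scat b b' * arriving p b' =
   \sum_(b' | dart_to b' == dart_from b) 2 / (degree (dart_from b))%:R * arriving p b' -
   \sum_(b' | dart_to b' == dart_from b) (b' == dart_rev b)%:R * arriving p b'.
  rewrite -sumrB [RHS]big_mkcond; apply: eq_bigr => b' _ /=.
  by rewrite /scat; case: ifP => _; ring.
rewrite [X in _ + (_ - X)](bigD1 (dart_rev b)) ?dart_to_rev//= eqxx mul1r.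
by rewrite [X in _ - (_ + X)]big1 => [|b' /andP[_ /negbTE ->]]; [ring|rewrite mul0r].
Qed.

Lemma field_start s p e : field s p e 0 =
  (if e == e0 then p (- x0) else 0) + waves p (e, false) 0 + s * waves p (e, true) (len e).
Proof. by rewrite fieldE sub0r subr0. Qed.

Lemma field_end s p e : field s p e (len e) =
  arriving p (e, false) + s * waves p (e, true) 0.
Proof.
rewrite fieldE subrr /arriving !init_waveE /= addr0.
by case: eqP => [->|].
Qed.

(** These are the boundary terms of the integration by parts. Grouped by vertices they are incoming
    minus outgoing waves, which cancel by [scat_col_sum]. Oddness lets the direct wave at the start
    of [e0] count as arriving on the reversed dart. *)
Lemma flux_balance p (v : vert G -> R) : gauss_dominated rho p -> (forall z, p (- z) = - p z) ->
  \sum_e (field (-1) p e (len e) * v (tgt e) - field (-1) p e 0 * v (src e)) = 0.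
Proof.
move=> hp podd.
have E e : field (-1) p e (len e) * v (tgt e) - field (-1) p e 0 * v (src e) =
  (arriving p (e, false) * v (dart_to (e, false)) + arriving p (e, true) * v (dart_to (e, true))) -
  (waves p (e, false) 0 * v (dart_from (e, false)) + waves p (e, true) 0 * v (dart_from (e, true))).
  rewrite field_end field_start /arriving /dart_to /dart_from !init_waveE /= !addr0 podd.
  by case: ifP => _; ring.
under eq_bigr do rewrite E.
rewrite sumrB -(sum_dart (fun b => arriving p b * v (dart_to b))).
rewrite -(sum_dart (fun b => waves p b 0 * v (dart_from b))).
apply/eqP; rewrite subr_eq0; apply/eqP; symmetry.
under eq_bigr do rewrite waves_at0// mulr_suml.
rewrite exchange_big/=; apply: eq_bigr => b' _.
rewrite -(scat_col_sum v b') mulr_sumr; apply: eq_bigr => b _; ring.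
Qed.

(** At a vertex the value is the right side of [vertex_value], which singles out no edge. *)
Definition graph_field p (q : gpoint G) : R :=
  match q with
  | Vertex v => 2 / (degree v)%:R * \sum_(b | dart_to b == v) arriving p b
  | Interior z => field 1 p (val z).1 (val z).2
  end.

Lemma graph_fieldE p e (x : R) : gauss_dominated rho p -> (forall z, p (- z) = p z) ->
  0 <= x <= len e -> graph_field p (pt e x) = field 1 p e x.
Proof.
move=> hp peven /pt_cases [->|->|h].
- rewrite pt0 /graph_field -[src e]/(dart_from (e, false)) -vertex_value// field_start.
  rewrite /arriving !init_waveE /= addr0 peven mul1r.
  by rewrite /dart_rev/=; ring.
- rewrite pt_len /graph_field -[tgt e]/(dart_from (e, true)) -vertex_value// field_end.
  by rewrite /dart_rev/= mul1r.
- by rewrite (pt_interior h).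
Qed.

Section Regular.
Variables p p' p'' p3 : R -> R.
Hypothesis dp : forall z : R, is_derive z 1 p (p' z).
Hypothesis dp' : forall z : R, is_derive z 1 p' (p'' z).
Hypothesis dp'' : forall z : R, is_derive z 1 p'' (p3 z).
Hypothesis gp : gauss_dominated rho p.
Hypothesis gp' : gauss_dominated rho p'.
Hypothesis gp'' : gauss_dominated rho p''.
Hypothesis bp : exists C : R, forall z, `|p z| <= C.
Hypothesis bp' : exists C : R, forall z, `|p' z| <= C.
Hypothesis bp'' : exists C : R, forall z, `|p'' z| <= C.
Hypothesis peven : forall z, p (- z) = p z.
Hypothesis p'odd : forall z, p' (- z) = - p' z.
Hypothesis p''even : forall z, p'' (- z) = p'' z.

Lemma measurable_field_derivable s q q' e : gauss_dominated rho q ->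
  (forall z : R, is_derive z 1 q (q' z)) -> measurable_fun `[0, len e] (field s q e).
Proof.
move=> hq dq; apply: (measurable_field rho0 rho_x0 rho_len a0 a_min) => // k.
by apply: (@is_derive_continuous _ _ (field_upto e0 x0 k (- s) q' e)) => y;
  exact: is_derive_field_upto.
Qed.

Lemma edge_sq_field s q q' : gauss_dominated rho q -> (exists C : R, forall z, `|q z| <= C) ->
  (forall z : R, is_derive z 1 q (q' z)) -> edge_sq_int (field s q).
Proof.
move=> hq bq dq e.
have [M hM] := field_bounded rho0 rho_x0 rho_len a0 a_min s e hq bq.
by apply: (@sqint_bounded _ _ _ _ M) => //; exact: measurable_field_derivable dq.
Qed.

Lemma edge_sq_graph_field q q' : gauss_dominated rho q -> (exists C : R, forall z, `|q z| <= C) ->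
  (forall z : R, is_derive z 1 q (q' z)) -> (forall z, q (- z) = q z) -> L2 (graph_field q).
Proof.
move=> hq bq dq qeven e; have [mf sq] := edge_sq_field 1 hq bq dq e.
have E x : `[0, len e]%classic x -> edgewise (graph_field q) e x = field 1 q e x.
  by rewrite /= in_itv/= => xl; exact: graph_fieldE.
split.
  by apply: eq_measurable_fun mf => x; rewrite inE => /E.
by apply: eq_integrable sq => // x; rewrite inE => /E ->.
Qed.

Lemma graph_field_H1 : H1 (graph_field p) (field (-1) p').
Proof.
split; first exact: edge_sq_field dp'.
move=> e x xl; have l0 : 0 <= (0 : R) <= len e by rewrite lexx ltW// len_gt0.
rewrite !graph_fieldE//.
exact: (field_integral rho0 rho_x0 rho_len a0 a_min (p'' := p'') 1).
Qed.

(** Integrate by parts on every edge; the boundary terms add up to 0 by [flux_balance], since the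
    derivative of an even profile is odd. *)
Lemma graph_field_neg_laplacian : neg_laplacian (graph_field p) (\- graph_field p'').
Proof.
have L2'' := edge_sq_graph_field gp'' bp'' dp'' p''even.
split; first exact: edge_sq_graph_field dp _.
  have := edge_sqZ (-1) L2''; congr edge_sq_int.
  by apply/funext => e; apply/funext => x; rewrite /edgewise/= mulN1r.
exists (graph_field p), (field (-1) p'); split; [by move=> e; exact: aeW|exact: graph_field_H1|].
move=> v dv Hv.
have Lv := H1_L2 Hv; have [sdv hv] := Hv.
have s' := edge_sq_field (-1) gp' bp' dp'.
have s'' := edge_sq_field 1 gp'' bp'' dp''.
rewrite /L2inner /edge_inner.
have E e : \int[mu]_(x in `[0, len e]) (field (-1) p' e x * dv e x) =
  (field (-1) p' e (len e) * v (Vertex (tgt e)) - field (-1) p' e 0 * v (Vertex (src e)))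
  + \int[mu]_(x in `[0, len e]) (edgewise (\- graph_field p'') e x * edgewise v e x).
  have l0 : 0 <= len e by exact/ltW/len_gt0.
  have [M hM] := field_bounded rho0 rho_x0 rho_len a0 a_min 1 e gp'' bp''.
  rewrite (@by_parts _ (len e) M _ (field 1 p'' e) (edgewise v e))//.
  - rewrite /edgewise pt_len pt0; congr (_ + _); rewrite -mulN1r -RintegralZl//.
      apply: eq_Rintegral => x; rewrite inE/= in_itv/= => xl.
      by rewrite graph_fieldE//; ring.
    exact: (integrable_mul_sqint (s'' e) (Lv e)).
  - exact: measurable_field_derivable dp''.
  - move=> x xl; rewrite -[in field 1 _ _](opprK 1).
    exact: (field_integral rho0 rho_x0 rho_len a0 a_min (p'' := p3) (-1)).
  - exact: (sqint_integrable (sdv e) (lexx _)).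
  - move=> x xl; rewrite /edgewise hv//.
  - exact: (integrable_mul_sqint (s' e) (sdv e)).
  - exact: (integrable_mul_sqint (s'' e) (Lv e)).
rewrite (eq_bigr _ (fun e _ => E e)) big_split/=.
by rewrite (flux_balance (fun w => v (Vertex w)) gp' p'odd) add0r.
Qed.

End Regular.

End GraphField.

(** * The heat kernel of the line *)

Section RealDerivatives.
Variable R : realType.
Implicit Types (f g : R -> R) (x df dg : R).

Lemma is_derive_mulf f g x df dg : is_derive x 1 f df -> is_derive x 1 g dg ->
  is_derive x 1 (fun y => f y * g y) (df * g x + f x * dg).
Proof.
move=> hf hg; apply: (is_derive_eq (is_deriveM hf hg)).
by rewrite /GRing.scale/=; ring.
Qed.

Lemma is_derive_addf f g x df dg : is_derive x 1 f df -> is_derive x 1 g dg ->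
  is_derive x 1 (fun y => f y + g y) (df + dg).
Proof. by move=> hf hg; exact: is_deriveD. Qed.

Lemma is_derive_invf f x df : f x != 0 -> is_derive x 1 f df ->
  is_derive x 1 (fun y => (f y)^-1) (- df / f x ^+ 2).
Proof.
move=> f0 hf; apply: (is_derive_eq (is_deriveV f0 hf)).
by rewrite /GRing.scale/=; field.
Qed.

Lemma is_derive_expf f x df : is_derive x 1 f df ->
  is_derive x 1 (fun y => expR (f y)) (df * expR (f x)).
Proof.
move=> hf; rewrite mulrC.
exact: (@is_derive1_comp R expR f x (expR (f x)) df (is_derive_expR (f x)) hf).
Qed.

Lemma is_derive_idf x : is_derive x 1 (fun y : R => y) 1.
Proof. exact: is_derive_id. Qed.

Lemma is_derive_cstf (c x : R) : is_derive x 1 (fun _ : R => c) 0.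
Proof. exact: is_derive_cst. Qed.

Lemma is_derive_sqr x : is_derive x 1 (fun y : R => y ^+ 2) (2 * x).
Proof.
have -> : (fun y : R => y ^+ 2) = (fun y => y * y) by apply/funext => y; rewrite expr2.
by apply: (is_derive_eq (is_derive_mulf (is_derive_idf x) (is_derive_idf x))); ring.
Qed.

Lemma le_expRN (u : R) : 0 < u -> expR (- u) <= u^-1.
Proof.
move=> u0; rewrite expRN lef_pV2 ?posrE ?expR_gt0//.
by apply: le_trans (expR_ge1Dx u); rewrite lerDr.
Qed.

Lemma le_expRN2 (u : R) : 0 < u -> expR (- u) <= 4 / u ^+ 2.
Proof.
move=> u0; have -> : - u = - (u / 2) * 2%:R by field.
rewrite expRM_natr; apply: (@le_trans _ _ ((u / 2)^-1 ^+ 2)).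
  by rewrite lerXn2r ?nnegrE ?expR_ge0 ?le_expRN ?invr_ge0 ?divr_ge0 ?divr_gt0// ltW.
by rewrite -subr_ge0 (_ : _ - _ = 0)//; field; rewrite gt_eqF.
Qed.

End RealDerivatives.

Section HeatProfile.
Variable R : realType.
Local Notation mu := (@lebesgue_measure R).
Implicit Types s y : R.

(* [heat s] is the heat kernel of the real line at time [s]; [heat1], [heat2],
   [heat3] are its derivatives in space and [heat22] its second derivative in time. *)
Definition heat s y : R := (Num.sqrt (4 * pi))^-1 * expR (- ln s / 2 - y ^+ 2 / (4 * s)).
Definition heat1 s y : R := - (y / (2 * s)) * heat s y.
Definition heat2 s y : R := (y ^+ 2 / (4 * s ^+ 2) - (2 * s)^-1) * heat s y.
Definition heat3 s y : R := y / (2 * s ^+ 2) * heat s y + (y ^+ 2 / (4 * s ^+ 2) - (2 * s)^-1) * heat1 s y.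
Definition heat22 s y : R :=
  ((y ^+ 2 / (4 * s ^+ 2) - (2 * s)^-1) ^+ 2 - y ^+ 2 / (2 * s ^+ 3) + (2 * s ^+ 2)^-1) * heat s y.

Lemma heat_cst_gt0 : 0 < (Num.sqrt (4 * pi))^-1 :> R.
Proof. by rewrite invr_gt0 sqrtr_gt0 mulr_gt0// pi_gt0. Qed.

Lemma heat_ge0 s y : 0 <= heat s y.
Proof. by rewrite mulr_ge0 ?expR_ge0// ltW// heat_cst_gt0. Qed.

Lemma heat_even s y : heat s (- y) = heat s y.
Proof. by rewrite /heat sqrrN. Qed.

Lemma heat1_odd s y : heat1 s (- y) = - heat1 s y.
Proof. by rewrite /heat1 heat_even; ring. Qed.

Lemma heat2_even s y : heat2 s (- y) = heat2 s y.
Proof. by rewrite /heat2 heat_even sqrrN. Qed.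

Lemma is_derive_heat s y : 0 < s -> is_derive y 1 (heat s) (heat1 s y).
Proof.
move=> s0; have sn := lt0r_neq0 s0.
have d1 : is_derive y 1 (fun z => - ln s / 2 + (- (4 * s)^-1) * z ^+ 2) (- (y / (2 * s))).
  apply: (is_derive_eq (is_derive_addf (is_derive_cstf _ y) (is_derive_scal (- (4 * s)^-1) (is_derive_sqr y)))).
  by field.
have E z : heat s z = (Num.sqrt (4 * pi))^-1 * expR (- ln s / 2 + (- (4 * s)^-1) * z ^+ 2).
  by rewrite /heat; congr (_ * expR _); ring.
rewrite (funext E); apply: (is_derive_eq (is_derive_scal _ (is_derive_expf d1))).
by rewrite /heat1 E; ring.
Qed.

Lemma is_derive_heat1 s y : 0 < s -> is_derive y 1 (heat1 s) (heat2 s y).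
Proof.
move=> s0; have sn := lt0r_neq0 s0.
have d1 : is_derive y 1 (fun z => - (2 * s)^-1 * z) (- (2 * s)^-1 * 1).
  exact: is_derive_scal (is_derive_idf y).
have -> : heat1 s = (fun z => (- (2 * s)^-1 * z) * heat s z).
  by apply/funext => z; rewrite /heat1; ring.
apply: (is_derive_eq (is_derive_mulf d1 (is_derive_heat y s0))).
by rewrite /heat2 /heat1; field.
Qed.

Lemma is_derive_heat2 s y : 0 < s -> is_derive y 1 (heat2 s) (heat3 s y).
Proof.
move=> s0; have sn := lt0r_neq0 s0.
have d1 : is_derive y 1 (fun z => (4 * s ^+ 2)^-1 * z ^+ 2 + - (2 * s)^-1) (y / (2 * s ^+ 2)).
  apply: (is_derive_eq (is_derive_addf (is_derive_scal _ (is_derive_sqr y)) (is_derive_cstf _ y))).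
  by field.
have -> : heat2 s = (fun z => ((4 * s ^+ 2)^-1 * z ^+ 2 + - (2 * s)^-1) * heat s z).
  by apply/funext => z; rewrite /heat2; ring.
apply: (is_derive_eq (is_derive_mulf d1 (is_derive_heat y s0))).
by rewrite /heat3; ring.
Qed.

(** The heat equation on the line. It makes the field of [heat2] both the time derivative and the
    Laplacian of the field of [heat]. *)
Lemma is_derive_heat_time s y : 0 < s -> is_derive s 1 (heat ^~ y) (heat2 s y).
Proof.
move=> s0; have sn := lt0r_neq0 s0.
have d1 : is_derive s 1 (fun z => - 2^-1 * ln z + (- (y ^+ 2 / 4)) * z^-1) (y ^+ 2 / (4 * s ^+ 2) - (2 * s)^-1).
  have dl := is_derive_scal (- 2^-1) (is_derive1_ln s0).
  have di := is_derive_scal (- (y ^+ 2 / 4)) (is_derive_invf sn (is_derive_idf s)).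
  apply: (is_derive_eq (is_derive_addf dl di)).
  by field.
have E z : 0 < z -> heat z y = (Num.sqrt (4 * pi))^-1 * expR (- 2^-1 * ln z + (- (y ^+ 2 / 4)) * z^-1).
  move=> z0; rewrite /heat; congr (_ * expR _); field; exact: lt0r_neq0.
have d2 := is_derive_scal (Num.sqrt (4 * pi))^-1 (is_derive_expf d1).
apply: (@near_eq_is_derive _ _ _ (fun z => (Num.sqrt (4 * pi))^-1 * expR (- 2^-1 * ln z + (- (y ^+ 2 / 4)) * z^-1))).
- exists s => //= z; rewrite /ball_/= ltr_norml => /andP[_ zs]; rewrite E//; lra.
- by apply: (is_derive_eq d2); rewrite /heat2 (E s s0); ring.
Qed.

Lemma is_derive_heat2_time s y : 0 < s -> is_derive s 1 (heat2 ^~ y) (heat22 s y).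
Proof.
move=> s0; have sn := lt0r_neq0 s0.
have s2 : 4 * s ^+ 2 != 0 by rewrite mulf_neq0 ?expf_neq0.
have s1 : 2 * s != 0 by rewrite mulf_neq0.
have d1 : is_derive s 1 (fun z => y ^+ 2 * (4 * z ^+ 2)^-1 + (-1) * (2 * z)^-1)
     (- y ^+ 2 / (2 * s ^+ 3) + (2 * s ^+ 2)^-1).
  have da := is_derive_scal (y ^+ 2) (@is_derive_invf R (fun z => 4 * z ^+ 2) s _ s2 (is_derive_scal 4 (is_derive_sqr s))).
  have db := is_derive_scal (-1) (@is_derive_invf R (fun z => 2 * z) s _ s1 (is_derive_scal 2 (is_derive_idf s))).
  apply: (is_derive_eq (is_derive_addf da db)).
  by field.
have -> : heat2 ^~ y = (fun z => (y ^+ 2 * (4 * z ^+ 2)^-1 + (-1) * (2 * z)^-1) * heat z y).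
  by apply/funext => z; rewrite /heat2 mulN1r.
apply: (is_derive_eq (is_derive_mulf d1 (is_derive_heat_time y s0))).
by rewrite /heat22 /heat2; ring.
Qed.

(** Half of the Gaussian exponent absorbs the polynomial: [1 + y ^+ 2] is at most a constant times
    [expR (y ^+ 2 / (16 * s2))], whose square costs [y ^+ 2 / (8 * s2)]. *)
Lemma poly_gauss_bound (s2 : R) : 0 < s2 -> exists2 M : R, 0 < M &
  forall y, (1 + y ^+ 2) ^+ 2 * expR (- (y ^+ 2 / (4 * s2))) <= M * expR (- (8 * s2)^-1 * y ^+ 2).
Proof.
move=> s0; have sn := lt0r_neq0 s0.
exists ((1 + 16 * s2) ^+ 2); first by rewrite exprn_gt0// addr_gt0// mulr_gt0.
move=> y; set x := y ^+ 2 / (16 * s2).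
have x0 : 0 <= x by rewrite divr_ge0 ?sqr_ge0// mulr_ge0// ltW.
have h : 1 + y ^+ 2 <= (1 + 16 * s2) * expR x.
  apply: (@le_trans _ _ ((1 + 16 * s2) * (1 + x))).
    have -> : y ^+ 2 = 16 * s2 * x by rewrite /x; field.
    by have := mulr_ge0 (ltW s0) x0; lra.
  by rewrite ler_wpM2l ?expR_ge1Dx// addr_ge0// mulr_ge0// ltW.
have -> : expR (- (8 * s2)^-1 * y ^+ 2) = expR x ^+ 2 * expR (- (y ^+ 2 / (4 * s2))).
  by rewrite -expRM_natl -expRD; congr expR; rewrite /x; field.
rewrite mulrA ler_wpM2r ?expR_ge0// -exprMn lerXn2r ?nnegrE//.
  by rewrite addr_ge0 ?sqr_ge0.
by rewrite mulr_ge0 ?expR_ge0// addr_ge0// mulr_ge0// ltW.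
Qed.

Lemma heat_poly_bound (s1 s2 A : R) : 0 < s1 -> s1 <= s2 -> 0 <= A ->
  exists C : R, 0 <= C /\ forall P s y, s1 <= s <= s2 -> `|P| <= A * (1 + y ^+ 2) ^+ 2 ->
  `|P * heat s y| <= C * expR (- (8 * s2)^-1 * y ^+ 2).
Proof.
move=> s10 s12 A0; have s20 : 0 < s2 by exact: lt_le_trans s12.
have [M M0 hM] := poly_gauss_bound s20.
set k := (Num.sqrt (4 * pi))^-1 : R; have k0 : 0 < k by exact: heat_cst_gt0.
exists (A * (k * expR (- ln s1 / 2)) * M); split.
  by rewrite !mulr_ge0 ?expR_ge0// ltW.
move=> P s y /andP[ss1 ss2] hP.
have s0 : 0 < s by exact: lt_le_trans ss1.
rewrite normrM (ger0_norm (heat_ge0 _ _)).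
have hh : heat s y <= k * expR (- ln s1 / 2) * expR (- (y ^+ 2 / (4 * s2))).
  rewrite -mulrA /heat -/k ler_wpM2l ?(ltW k0)// -expRD ler_expR lerB//.
    by rewrite ler_pM2r ?invr_gt0// lerN2 ler_ln.
  by rewrite ler_wpM2l ?sqr_ge0// lef_pV2 ?posrE ?mulr_gt0// ler_pM2l.
have y2 : 0 <= (1 + y ^+ 2) ^+ 2 by exact: sqr_ge0.
apply: (@le_trans _ _ (A * (1 + y ^+ 2) ^+ 2 * (k * expR (- ln s1 / 2) * expR (- (y ^+ 2 / (4 * s2)))))).
  by apply: ler_pM; rewrite ?normr_ge0 ?heat_ge0.
have -> : A * (1 + y ^+ 2) ^+ 2 * (k * expR (- ln s1 / 2) * expR (- (y ^+ 2 / (4 * s2)))) =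
  A * (k * expR (- ln s1 / 2)) * ((1 + y ^+ 2) ^+ 2 * expR (- (y ^+ 2 / (4 * s2)))) by ring.
rewrite -[leRHS]mulrA ler_wpM2l// mulr_ge0// mulr_ge0 ?expR_ge0// ltW//.
Qed.

Lemma heat_bounds (s1 s2 : R) : 0 < s1 -> s1 <= s2 -> exists C : R, 0 <= C /\
  forall s y, s1 <= s <= s2 -> [/\
    `|heat s y| <= C * expR (- (8 * s2)^-1 * y ^+ 2),
    `|heat1 s y| <= C * expR (- (8 * s2)^-1 * y ^+ 2),
    `|heat2 s y| <= C * expR (- (8 * s2)^-1 * y ^+ 2) &
    `|heat22 s y| <= C * expR (- (8 * s2)^-1 * y ^+ 2)].
Proof.
move=> s10 s12; set U := s1^-1.
have U0 : 0 < U by rewrite invr_gt0.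
(* The sum of bounds for the coefficients of [heat], [heat1], [heat2] and [heat22], all relative to
   [(1 + y ^+ 2) ^+ 2]. *)
pose A := 1 + U + (U ^+ 2 + U) + ((U ^+ 2 + U) ^+ 2 + U ^+ 3 + U ^+ 2).
have U2 : 0 < U ^+ 2 by rewrite exprn_gt0.
have U3 : 0 < U ^+ 3 by rewrite exprn_gt0.
have UU : 0 <= (U ^+ 2 + U) ^+ 2 by exact: sqr_ge0.
have A0 : 0 <= A by rewrite /A; lra.
have [C [C0 hC]] := heat_poly_bound s10 s12 A0; exists C; split => // s y hs.
have /andP[ss1 ss2] := hs; have s0 : 0 < s by exact: lt_le_trans ss1.
set u := s^-1; have u0 : 0 < u by rewrite invr_gt0.
have uU : u <= U by rewrite lef_pV2.
have u2 : u ^+ 2 <= U ^+ 2 by rewrite lerXn2r ?nnegrE ?(ltW u0) ?(ltW U0).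
have u3 : u ^+ 3 <= U ^+ 3 by rewrite lerXn2r ?nnegrE ?(ltW u0) ?(ltW U0).
have u20 : 0 < u ^+ 2 by rewrite exprn_gt0.
have u30 : 0 < u ^+ 3 by rewrite exprn_gt0.
set w := y ^+ 2; have w0 : 0 <= w by exact: sqr_ge0.
have W1 : 1 <= (1 + w) ^+ 2 by have -> : (1 + w) ^+ 2 = 1 + 2 * w + w ^+ 2 by [ring]; have := sqr_ge0 w; lra.
have W2 : 1 + w <= (1 + w) ^+ 2 by have -> : (1 + w) ^+ 2 = 1 + 2 * w + w ^+ 2 by [ring]; have := sqr_ge0 w; lra.
have E2 : y ^+ 2 / (4 * s ^+ 2) - (2 * s)^-1 = w * u ^+ 2 / 4 - u / 2.
  by rewrite /w /u; field; rewrite gt_eqF.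
have wu : w * u ^+ 2 <= w * U ^+ 2 by rewrite ler_wpM2l.
have wu3 : w * u ^+ 3 <= w * U ^+ 3 by rewrite ler_wpM2l.
have wu0 : 0 <= w * u ^+ 2 by rewrite mulr_ge0// ltW.
have wu30 : 0 <= w * u ^+ 3 by rewrite mulr_ge0// ltW.
have q2 : `|w * u ^+ 2 / 4 - u / 2| <= (U ^+ 2 + U) * (1 + w).
  have := mulr_ge0 w0 (ltW U0).
  by rewrite ler_norml mulrDl !mulrDr !mulr1 ![_ * w]mulrC; move=> h; apply/andP; split; lra.
have q22 : (w * u ^+ 2 / 4 - u / 2) ^+ 2 <= (U ^+ 2 + U) ^+ 2 * (1 + w) ^+ 2.
  have -> : (U ^+ 2 + U) ^+ 2 * (1 + w) ^+ 2 = ((U ^+ 2 + U) * (1 + w)) ^+ 2 by rewrite exprMn.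
  by rewrite -[leLHS]real_normK ?num_real// lerXn2r ?nnegrE// mulr_ge0//; lra.
have AW c : 0 <= c -> c <= A -> c * (1 + w) ^+ 2 <= A * (1 + w) ^+ 2.
  by move=> c0 cA; rewrite ler_wpM2r// (le_trans ler01).
have A1 : 1 <= A by rewrite /A; lra.
split.
- rewrite -[heat s y]mul1r; apply: hC => //; rewrite normr1.
  by apply: le_trans W1 _; rewrite -[leLHS]mul1r; exact: AW.
- apply: hC => //.
  have -> : - (y / (2 * s)) = - (y * u / 2) by rewrite /u; field; rewrite gt_eqF.
  rewrite normrN; apply: (@le_trans _ _ (U * (1 + w) ^+ 2)); last by apply: AW; rewrite /A; lra.
  have yw : `|y| <= 1 + w.
    have := sqr_ge0 (`|y| - 1); rewrite sqrrB1 real_normK ?num_real// -/w.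
    by have := normr_ge0 y; lra.
  rewrite !normrM (gtr0_norm u0) [`|2^-1|]ger0_norm ?invr_ge0//.
  have h1 : `|y| * u <= (1 + w) * U by apply: ler_pM => //; exact: ltW.
  have h2 : U * (1 + w) <= U * (1 + w) ^+ 2 by rewrite ler_pM2l.
  by have := mulr_ge0 (normr_ge0 y) (ltW u0); lra.
- apply: hC => //; rewrite E2; apply: le_trans q2 _.
  apply: (@le_trans _ _ ((U ^+ 2 + U) * (1 + w) ^+ 2)); last by apply: AW; rewrite /A; lra.
  by rewrite ler_pM2l//; lra.
- apply: hC => //; rewrite E2.
  have -> : y ^+ 2 / (2 * s ^+ 3) = w * u ^+ 3 / 2 by rewrite /w /u; field; rewrite gt_eqF.
  have -> : (2 * s ^+ 2)^-1 = u ^+ 2 / 2 by rewrite /u; field; rewrite gt_eqF.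
  apply: (@le_trans _ _ (((U ^+ 2 + U) ^+ 2 + U ^+ 3 + U ^+ 2) * (1 + w) ^+ 2)); last by apply: AW; rewrite /A; lra.
  rewrite !mulrDl.
  have h0 := sqr_ge0 (w * u ^+ 2 / 4 - u / 2).
  have h3 : U ^+ 3 * (1 + w) <= U ^+ 3 * (1 + w) ^+ 2 by rewrite ler_pM2l.
  have h4 : U ^+ 2 * 1 <= U ^+ 2 * (1 + w) ^+ 2 by rewrite ler_pM2l.
  rewrite ler_norml; apply/andP; split; lra.
Qed.

(** The mean value theorem in time, once for [heat] and once more for [heat2]. The Gaussian factor
    is kept because the sums of waves need it. *)
Lemma heat_time_taylor (s1 s2 : R) : 0 < s1 -> s1 <= s2 -> exists C : R, 0 <= C /\
  forall s h y, s1 <= s -> 0 <= h -> s + h <= s2 ->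
    `|heat (s + h) y - heat s y| <= C * h * expR (- (8 * s2)^-1 * y ^+ 2) /\
    `|heat (s + h) y - heat s y - h * heat2 s y| <= C * h ^+ 2 * expR (- (8 * s2)^-1 * y ^+ 2).
Proof.
move=> s10 s12; have [C [C0 hC]] := heat_bounds s10 s12; exists C; split => // s h y ss1 h0 hs2.
have s0 : 0 < s by exact: lt_le_trans ss1.
have pos z : s <= z -> 0 < z by exact: lt_le_trans.
have shs : s <= s + h by rewrite lerDl.
have mvt (f df : R -> R) (c : R) : s <= c -> (forall z, s <= z -> is_derive z 1 f (df z)) ->
    exists2 d, s <= d <= c & f c - f s = df d * (c - s).
  move=> sc hd.
  have [||d dc E] := @MVT_segment R f df s c sc.
  - by move=> z; rewrite in_itv/= => /andP[/ltW sz _]; exact: hd.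
  - apply: derivable_within_continuous => z; rewrite in_itv/= => /andP[sz _].
    by case: (hd z sz).
  - by exists d => //; move: dc; rewrite in_itv.
have [d1 /andP[sd1 d1h] E1] := mvt _ _ _ shs (fun z sz => is_derive_heat_time y (pos z sz)).
have [d2 /andP[sd2 d2h] E2] := mvt _ _ _ sd1 (fun z sz => is_derive_heat2_time y (pos z sz)).
have Eh : s + h - s = h by ring.
rewrite E1 Eh.
have e0 := expR_ge0 (- (8 * s2)^-1 * y ^+ 2).
have b1 : s1 <= d1 <= s2 by rewrite (le_trans ss1)//= (le_trans d1h).
have b2 : s1 <= d2 <= s2 by rewrite (le_trans ss1)//= (le_trans d2h)// (le_trans d1h).
have [_ _ B1 _] := hC d1 y b1; have [_ _ _ B2] := hC d2 y b2.
split.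
  by rewrite normrM (ger0_norm h0) mulrAC ler_wpM2r.
have -> : heat2 d1 y * h - h * heat2 s y = h * (heat2 d1 y - heat2 s y) by ring.
rewrite E2 normrM (ger0_norm h0) normrM.
have -> : C * h ^+ 2 * expR (- (8 * s2)^-1 * y ^+ 2) = h * (C * expR (- (8 * s2)^-1 * y ^+ 2) * h) by ring.
apply: ler_wpM2l => //; apply: ler_pM => //.
by rewrite ger0_norm; lra.
Qed.

(** In [heat] the power [s^(-1/2)] sits inside the exponential; here it becomes the prefactor of the
    expansion. *)
Lemma heat_at0 s : 0 < s -> heat s 0 = (Num.sqrt (4 * pi * s))^-1.
Proof.
move=> s0; have -> : Num.sqrt (4 * pi * s) = Num.sqrt (4 * pi) * Num.sqrt s.
  by rewrite sqrtrM// mulr_ge0 ?pi_ge0.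
rewrite /heat expr0n/= mul0r subr0 invfM; congr (_ * _).
have E : expR (ln s / 2) ^+ 2 = s by rewrite -expRM_natl mulrC divfK// lnK.
by rewrite -[in RHS]E sqrtr_sqr ger0_norm ?expR_ge0// mulNr expRN.
Qed.

Lemma heat_scale s y : 0 < s -> heat s y = heat s 0 * expR (- y ^+ 2 / (4 * s)).
Proof.
by move=> s0; rewrite /heat -[RHS]mulrA -expRD; congr (_ * expR _); rewrite expr0n/=; ring.
Qed.

(** Half of the exponent is at most [256 s^2 / rho^4] by [le_expRN2], which beats
    [s^(-1/2) <= s^-1]; the other half keeps a Gaussian independent of [s <= 1]. *)
Lemma heat_small_time (rho : R) : 0 < rho -> exists2 C : R, 0 <= C &
  forall s y, 0 < s <= 1 -> rho <= y -> `|heat s y| <= C * s * expR (- 8^-1 * y ^+ 2).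
Proof.
move=> r0; set k := (Num.sqrt (4 * pi))^-1 : R; have k0 : 0 < k by exact: heat_cst_gt0.
exists (k * (256 / rho ^+ 4)); first by rewrite mulr_ge0 ?divr_ge0 ?exprn_ge0// ltW.
move=> s y /andP[s0 s1] ry; have sn := lt0r_neq0 s0; have rn := lt0r_neq0 r0.
have yp0 : 0 <= y by apply: le_trans ry; exact: ltW.
have y2 : rho ^+ 2 <= y ^+ 2 by rewrite lerXn2r ?nnegrE// ltW.
have yp : 0 <= y ^+ 2 by exact: sqr_ge0.
rewrite (ger0_norm (heat_ge0 _ _)) /heat -/k.
have -> : k * (256 / rho ^+ 4) * s * expR (- 8^-1 * y ^+ 2) =
  k * (256 / rho ^+ 4 * s * expR (- 8^-1 * y ^+ 2)) by ring.
rewrite ler_wpM2l ?(ltW k0)//.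
have -> : - ln s / 2 - y ^+ 2 / (4 * s) = - ln s / 2 + (- (y ^+ 2 / (8 * s)) - y ^+ 2 / (8 * s)).
  by field.
rewrite 2!expRD.
have l0 : ln s <= 0 by exact: ln_le0.
have a1 : expR (- ln s / 2) <= s^-1.
  rewrite -[in leRHS](lnK (x := s)) ?posrE// -expRN ler_expR; lra.
have a2 : expR (- (y ^+ 2 / (8 * s))) <= 256 * s ^+ 2 / rho ^+ 4.
  have t0 : 0 < rho ^+ 2 / (8 * s) by rewrite divr_gt0 ?exprn_gt0 ?mulr_gt0.
  apply: (@le_trans _ _ (expR (- (rho ^+ 2 / (8 * s))))).
    by rewrite ler_expR lerN2 ler_pM2r ?invr_gt0 ?mulr_gt0.
  apply: le_trans (le_expRN2 t0) _.
  rewrite -subr_ge0 (_ : _ - _ = 0)//; field; rewrite sn rn//.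
have a3 : expR (- (y ^+ 2 / (8 * s))) <= expR (- 8^-1 * y ^+ 2).
  rewrite ler_expR mulNr lerN2 mulrC ler_wpM2l// lef_pV2 ?posrE ?mulr_gt0// ler_piMr//.
apply: (@le_trans _ _ (s^-1 * (256 * s ^+ 2 / rho ^+ 4 * expR (- 8^-1 * y ^+ 2)))).
  by apply: ler_pM; rewrite ?expR_ge0 ?mulr_ge0 ?expR_ge0//; apply: ler_pM; rewrite ?expR_ge0.
rewrite -subr_ge0 (_ : _ - _ = 0)//; field; rewrite sn rn//.
Qed.

(** Integrability and total mass 1 are borrowed from the normal law of variance [2 s]. *)
Lemma heat_normal s x0 x : 0 < s -> heat s (x - x0) = normal_pdf x0 (Num.sqrt (2 * s)) x.
Proof.
move=> s0; have sn := lt0r_neq0 s0.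
have ss : Num.sqrt (2 * s) ^+ 2 = 2 * s by rewrite sqr_sqrtr// mulr_ge0// ltW.
rewrite normal_pdfE; last by rewrite gt_eqF// sqrtr_gt0 mulr_gt0.
rewrite heat_scale// heat_at0// /normal_peak /normal_fun ss; congr ((Num.sqrt _)^-1 * expR _).
  by rewrite -mulr_natr; ring.
by rewrite -mulr_natr; field.
Qed.

Lemma integrable_heat s x0 : 0 < s -> mu.-integrable setT (EFin \o (fun x => heat s (x - x0))).
Proof.
move=> s0; have := integrable_normal_pdf x0 (Num.sqrt (2 * s)).
by congr (_.-integrable _ _); apply/funext => x; rewrite /= heat_normal.
Qed.

Lemma integral_heat s x0 : 0 < s -> \int[mu]_x (heat s (x - x0)) = 1.
Proof.
move=> s0; rewrite /Rintegral -[RHS]/(fine 1%E) -(integral_normal_pdf x0 (Num.sqrt (2 * s))).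
by congr fine; apply: eq_integral => x _; rewrite heat_normal.
Qed.

(** Beyond [eta], half of the exponent yields the factor [8 s / eta^2]; the rest is the kernel at
    time [2 s], again of mass 1, up to the factor [sqrt 2 <= 2]. *)
Lemma heat_tail s y eta : 0 < s -> 0 < eta -> eta <= `|y| ->
  heat s y <= 16 * s / eta ^+ 2 * heat (2 * s) y.
Proof.
move=> s0 e0 ey; have sn := lt0r_neq0 s0.
have y2 : eta ^+ 2 <= y ^+ 2.
  by rewrite -[leRHS]real_normK ?num_real// lerXn2r ?nnegrE// ltW.
have t0 : 0 < eta ^+ 2 / (8 * s) by rewrite divr_gt0 ?exprn_gt0 ?mulr_gt0.
have a2 : expR (- (y ^+ 2 / (8 * s))) <= 8 * s / eta ^+ 2.
  apply: (@le_trans _ _ (expR (- (eta ^+ 2 / (8 * s))))).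
    by rewrite ler_expR lerN2 ler_pM2r ?invr_gt0 ?mulr_gt0.
  apply: le_trans (le_expRN t0) _.
  by rewrite invf_div.
have a1 : expR (ln 2 / 2) <= 2 :> R.
  rewrite -[in leRHS](lnK (x := 2)) ?posrE// ler_expR; have := ln_ge0 (ler1n R 2); lra.
have -> : heat s y = expR (ln 2 / 2) * expR (- (y ^+ 2 / (8 * s))) * heat (2 * s) y.
  rewrite /heat lnM ?posrE// mulrCA -!expRD; congr (_ * expR _).
  by field.
apply: ler_wpM2r; first exact: heat_ge0.
apply: (@le_trans _ _ (2 * (8 * s / eta ^+ 2))); first by apply: ler_pM; rewrite ?expR_ge0.
by rewrite -subr_ge0 (_ : _ - _ = 0)//; field; exact: lt0r_neq0.
Qed.

End HeatProfile.

(** * The initial point mass *)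

Section ApproximateIdentity.
Variable R : realType.
Local Notation mu := (@lebesgue_measure R).

Lemma continuous_bounded_itv (f : R -> R) (a b : R) : continuous f ->
  exists2 M : R, 0 <= M & forall x, a <= x <= b -> `|f x| <= M.
Proof.
move=> cf.
have cpt : compact (f @` `[a, b]).
  by apply: continuous_compact; [exact: continuous_subspaceT|exact: segment_compact].
have [M [_ hM]] := compact_bounded cpt.
exists (`|M| + 1) => [|x xab]; first by rewrite addr_ge0.
apply: (hM (`|M| + 1)); last by exists x.
by rewrite ltr_pwDr// ler_norm.
Qed.

Lemma heat_approximate_identity (f : R -> R) (l x0 e : R) :
  0 < x0 < l -> continuous f -> 0 < e ->
  exists2 d : R, 0 < d & forall s, 0 < s < d ->
  `|\int[mu]_(x in `[0, l]) (f x * heat s (x - x0)) - f x0| <= e.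
Proof.
move=> /andP[x00 x0l] cf e0.
have [M M0 hM] := continuous_bounded_itv 0 l cf.
have e2 : 0 < e / 2 by rewrite divr_gt0.
have /cvgrPdist_lt/(_ _ e2) := cf x0.
move=> [eta' /= eta'0 heta'].
(* Below [x0] and [l - x0], so that the points closer than [eta] to [x0] lie in the interval, where
   [ft] is [f]. *)
pose eta := Num.min eta' (Num.min x0 (l - x0)).
have eta0 : 0 < eta by rewrite !lt_min eta'0 x00 subr_gt0.
(* [2 M] bounds the variation of [f] and [16 / eta ^+ 2] comes from [heat_tail]. *)
pose B := 32 * M / eta ^+ 2.
have B0 : 0 <= B by rewrite divr_ge0 ?mulr_ge0 ?exprn_ge0// ltW.
exists (e / (2 * (B + 1))); first by rewrite divr_gt0// mulr_gt0// ltr_wpDl.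
move=> s /andP[s0 sd].
pose h x := heat s (x - x0); pose ft := f \_ `[0, l].
have ih : mu.-integrable setT (EFin \o h) by exact: integrable_heat.
have s20 : 0 < 2 * s by rewrite mulr_gt0.
have ih2 : mu.-integrable setT (EFin \o (fun x => heat (2 * s) (x - x0))) by exact: integrable_heat.
have mh : measurable_fun setT h by apply/measurable_EFinP; exact: measurable_int ih.
have mf : measurable_fun `[0, l] f by exact: continuous_measurable_itv.
have mft := (measurable_restrictT f (measurable_itv `[0, l])).1 mf.
have ftM x : `|ft x| <= M.
  rewrite /ft /patch; case: ifPn => [|_]; last by rewrite normr0.
  by rewrite inE/= in_itv/= => /hM.
have ifh : mu.-integrable setT (EFin \o (fun x => ft x * h x)).
  apply: (@le_integrable _ _ _ mu _ measurableT _ (EFin \o (fun x => M * h x))).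
  - by apply/measurable_EFinP; exact: measurable_funM.
  - move=> x _ /=; rewrite lee_fin !normrM (ger0_norm M0).
    by apply: ler_wpM2r => //; exact: ftM.
  - exact: (integrableZl _ M ih).
have -> : \int[mu]_(x in `[0, l]) (f x * heat s (x - x0)) = \int[mu]_x (ft x * h x).
  rewrite Rintegral_mkcond; apply: eq_Rintegral => x _.
  by rewrite /ft /h /patch; case: ifP => // _; rewrite mul0r.
have -> : f x0 = \int[mu]_x (f x0 * h x) by rewrite RintegralZl// integral_heat// mulr1.
have iz : mu.-integrable setT (EFin \o (fun x => f x0 * h x)) by exact: (integrableZl _ (f x0) ih).
rewrite -RintegralB//.
have ibz := integrableB measurableT ifh iz.
apply: le_trans (le_normr_Rintegral _ ibz) _ => //.
have i1 : mu.-integrable setT (EFin \o (fun x => e / 2 * h x)) by exact: (integrableZl _ (e / 2) ih).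
have i2 : mu.-integrable setT (EFin \o (fun x => B * s * heat (2 * s) (x - x0))).
  exact: (integrableZl _ (B * s) ih2).
have i12 := integrableD measurableT i1 i2.
apply: (@le_trans _ _ (\int[mu]_x (e / 2 * h x + B * s * heat (2 * s) (x - x0)))).
  apply: le_Rintegral => //.
    exact: integrable_norm ibz.
  move=> x _ /=; rewrite -mulrBl normrM (ger0_norm (heat_ge0 _ _)).
  have [xe|xe] := leP eta `|x - x0|; last first.
    apply: (@le_trans _ _ (e / 2 * h x)); last first.
      by rewrite lerDl mulr_ge0 ?heat_ge0// mulr_ge0// ltW.
    apply: ler_wpM2r; first exact: heat_ge0.
    have xl : x \in `[0, l]%classic.
      rewrite inE/= in_itv/=; move: xe; rewrite !lt_min => /andP[_ /andP[]].
      by rewrite !ltr_norml => /andP[? ?] /andP[? ?]; apply/andP; split; lra.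
    rewrite /ft /patch xl distrC; apply/ltW; apply: heta'; rewrite /= distrC.
    by move: xe; rewrite lt_min => /andP[].
  apply: (@le_trans _ _ (B * s * heat (2 * s) (x - x0))); last first.
    by rewrite lerDr mulr_ge0 ?heat_ge0// divr_ge0// ltW.
  have -> : B * s * heat (2 * s) (x - x0) = (2 * M) * (16 * s / eta ^+ 2 * heat (2 * s) (x - x0)).
    by rewrite /B; ring.
  apply: ler_pM; rewrite ?normr_ge0 ?heat_ge0//; last exact: heat_tail.
  apply: le_trans (ler_normB _ _) _.
  have := ftM x; have := hM x0; rewrite (ltW x00) (ltW x0l) => /(_ isT); lra.
have E1 : \int[mu]_x (e / 2 * h x) = e / 2.
  by rewrite (RintegralZl (e / 2) measurableT ih) [X in _ * X](integral_heat x0 s0) mulr1.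
have E2 : \int[mu]_x (B * s * heat (2 * s) (x - x0)) = B * s.
  by rewrite (RintegralZl (B * s) measurableT ih2) [X in _ * X](integral_heat x0 s20) mulr1.
rewrite RintegralD// E1 E2.
move: sd; rewrite ltr_pdivlMr ?mulr_gt0 ?ltr_wpDl// => sd.
have : s * (2 * (B + 1)) = 2 * (B * s) + 2 * s by ring.
lra.
Qed.

(** An interval of positive length is not null. Almost everywhere identities thus hold at points
    arbitrarily close to a given one. *)
Lemma ae_dense (P : R -> Prop) (u v : R) : u < v -> {ae mu, forall x, P x} ->
  exists2 x, u < x < v & P x.
Proof.
move=> uv [N [mN N0 hN]]; apply: contrapT => h.
have sub : `]u, v[%classic `<=` N.
  move=> x; rewrite /= in_itv/= => xuv; apply: hN => /= Px; by apply: h; exists x.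
have : (mu `]u, v[%classic <= mu N)%E by apply: le_measure; rewrite ?inE.
by rewrite N0 lebesgue_measure_itv/= lte_fin uv -EFinD lee_fin leNgt subr_gt0 uv.
Qed.

End ApproximateIdentity.

(** * Continuity of the edge coordinate *)

Section PointTopology.
Variables (R : realType) (G : metric_graph R).

(** [pt e] factors through this retraction of the line onto the edge, which makes it continuous on
    the whole line. *)
Definition clamp (l x : R) : R := Num.max 0 (Num.min x l).

Lemma clamp_itv (l x : R) : 0 <= l -> 0 <= clamp l x <= l.
Proof. by move=> l0; rewrite /clamp le_max lexx/= ge_max l0 ge_min lexx orbT. Qed.

Lemma clamp_lipschitz (l x y : R) : `|clamp l x - clamp l y| <= `|x - y|.
Proof.
have norm_bounds (z : R) := conj (ler_norm z) (ler_norm (- z)).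
rewrite /clamp; apply: (@le_trans _ _ `|Num.min x l - Num.min y l|).
  case: (leP 0 (Num.min x l)) => hx; case: (leP 0 (Num.min y l)) => hy //;
    rewrite ler_norml; have := norm_bounds (Num.min x l - Num.min y l);
    rewrite normrN => -[? ?]; apply/andP; split; lra.
case: (leP x l) => hx; case: (leP y l) => hy //;
  rewrite ler_norml; have := norm_bounds (x - y); rewrite normrN => -[? ?];
  apply/andP; split; lra.
Qed.

Lemma pt_clamp (e : edge G) (x : R) : pt e x = pt e (clamp (len e) x).
Proof.
have l0 := len_gt0 e; rewrite /clamp.
have [xl|lx] := leP x (len e).
  have [x0|x0] := leP 0 x => //.
  rewrite /pt !insubF /= ?lexx ?(ltW x0)// ?ltxx//.
  by rewrite ltNge ltW.
rewrite max_r ?(ltW l0)// pt_len /pt insubF /=; first by rewrite leNgt (lt_trans l0 lx).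
by rewrite [x < _]ltNge (ltW lx) andbF.
Qed.

Lemma route_segment (e : edge G) (x y : R) : 0 <= x <= len e -> 0 <= y <= len e ->
  route (pt e x) (pt e y) `|x - y|.
Proof.
move=> hx hy; rewrite -[X in route _ _ X]addr0; apply: route_cons => //; exact: route_nil.
Qed.

Lemma continuous_pt (e : edge G) : continuous (pt e : R -> gpoint G).
Proof.
move=> x; apply/cvg_ballP => eps eps0; exists eps => //= y xy.
rewrite pt_clamp [pt e y]pt_clamp; have l0 := ltW (len_gt0 e).
exists `|clamp (len e) x - clamp (len e) y|; last exact: le_lt_trans (clamp_lipschitz _ _ _) xy.
by apply: route_segment; exact: clamp_itv.
Qed.

End PointTopology.

Section PartialContinuity.
Variables (R : realType) (G : metric_graph R).

Lemma continuous_pair_r (f : gpoint G * gpoint G -> R) (p q : gpoint G) : continuous f ->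
  {for q, continuous (fun y => f (p, y))}.
Proof.
move=> cf; have H : (fun y => (p, y)) @ q --> (p, q).
  apply: (@cvg_pair _ _ _ (nbhs q) (nbhs p) (nbhs q) _ _ _ (fun=> p) id).
    exact: cvg_cst.
  exact: cvg_id.
exact: (cvg_comp _ _ H (cf (p, q))).
Qed.

Lemma continuous_pair_l (f : gpoint G * gpoint G -> R) (p q : gpoint G) : continuous f ->
  {for p, continuous (fun x => f (x, q))}.
Proof.
move=> cf; have H : (fun x => (x, q)) @ p --> (p, q).
  apply: (@cvg_pair _ _ _ (nbhs p) (nbhs p) (nbhs q) _ _ _ id (fun=> q)).
    exact: cvg_id.
  exact: cvg_cst.
exact: (cvg_comp _ _ H (cf (p, q))).
Qed.

End PartialContinuity.

(** * The kernel on the diagonal *)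

Section KernelFormula.
Variables (R : realType) (G : metric_graph R) (e0 : edge G) (x0 a : R).
Local Notation mu := (@lebesgue_measure R).
Hypothesis x0_gt0 : 0 < x0.
Hypothesis x0_lt : x0 < len e0.
Hypothesis a0 : 0 < a.
Hypothesis a_min : forall e : edge G, a <= len e.

Let rho := Num.min x0 (len e0 - x0).

Let rho0 : 0 < rho. Proof. by rewrite lt_min x0_gt0 subr_gt0. Qed.
Let rho_x0 : rho <= x0. Proof. by rewrite ge_min lexx. Qed.
Let rho_len : rho <= len e0 - x0. Proof. by rewrite ge_min lexx orbT. Qed.

Local Notation field := (field e0 x0).
Local Notation waves := (waves e0 x0).
Local Notation graph_field := (graph_field e0 x0).

Lemma heat_dominated (s : R) : 0 < s ->
  [/\ gauss_dominated rho (heat s), gauss_dominated rho (heat1 s) & gauss_dominated rho (heat2 s)].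
Proof.
move=> s0; have [C [C0 hC]] := heat_bounds s0 (lexx s).
have k0 : 0 < (8 * s)^-1 by rewrite invr_gt0 mulr_gt0.
have ss : s <= s <= s by rewrite lexx.
by split; exists C, (8 * s)^-1; split => // z _; case: (hC s z ss).
Qed.

Lemma heat_bounded (s : R) : 0 < s ->
  [/\ exists C : R, forall z, `|heat s z| <= C, exists C : R, forall z, `|heat1 s z| <= C
    & exists C : R, forall z, `|heat2 s z| <= C].
Proof.
move=> s0; have [C [C0 hC]] := heat_bounds s0 (lexx s).
have ss : s <= s <= s by rewrite lexx.
have e1 z : C * expR (- (8 * s)^-1 * z ^+ 2) <= C.
  rewrite ler_piMr// expR_le1 mulNr oppr_le0 mulr_ge0 ?sqr_ge0// invr_ge0 mulr_ge0// ltW//.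
by split; exists C => z; apply: le_trans (e1 z); case: (hC s z ss).
Qed.

Lemma heat_field_L2 (s : R) : 0 < s -> L2 (graph_field (heat s)).
Proof.
move=> s0; have [d0 d1 d2] := heat_dominated s0; have [b0 b1 b2] := heat_bounded s0.
apply: (edge_sq_graph_field rho0 rho_x0 rho_len a0 a_min d0 b0 (q' := heat1 s)).
  by move=> z; exact: is_derive_heat.
by move=> z; exact: heat_even.
Qed.

Lemma heat_field_neg_laplacian (s : R) : 0 < s ->
  neg_laplacian (graph_field (heat s)) (\- graph_field (heat2 s)).
Proof.
move=> s0; have [d0 d1 d2] := heat_dominated s0; have [b0 b1 b2] := heat_bounded s0.
exact: (graph_field_neg_laplacian rho0 rho_x0 rho_len a0 a_min
  (fun z => is_derive_heat z s0) (fun z => is_derive_heat1 z s0) (fun z => is_derive_heat2 z s0)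
  d0 d1 d2 b0 b1 b2 (heat_even s) (heat1_odd s) (heat2_even s)).
Qed.

Lemma heat_fieldE (s : R) e x : 0 < s -> 0 <= x <= len e ->
  graph_field (heat s) (pt e x) = field 1 (heat s) e x.
Proof.
move=> s0 xl; have [d0 d1 d2] := heat_dominated s0.
apply: (graph_fieldE rho0 rho_x0 rho_len a0 a_min) => //; exact: heat_even.
Qed.

Lemma heat2_fieldE (s : R) e x : 0 < s -> 0 <= x <= len e ->
  graph_field (heat2 s) (pt e x) = field 1 (heat2 s) e x.
Proof.
move=> s0 xl; have [d0 d1 d2] := heat_dominated s0.
apply: (graph_fieldE rho0 rho_x0 rho_len a0 a_min) => //; exact: heat2_even.
Qed.

Lemma field_lin c (s : R) p q e x : gauss_dominated rho p -> gauss_dominated rho q ->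
  0 <= x <= len e ->
  field s (fun z => c * p z + q z) e x = c * field s p e x + field s q e x.
Proof.
move=> hp hq /andP[x_ge xl].
rewrite !fieldE (waves_lin rho0 rho_x0 rho_len a0 a_min c (e, false) hp hq)//.
rewrite (waves_lin rho0 rho_x0 rho_len a0 a_min c (e, true) hp hq) ?subr_ge0//.
by case: ifP => _; ring.
Qed.

Lemma field_uniform_bound (kap : R) : 0 < kap -> exists2 M : R, 0 <= M &
  forall p C, (forall z, `|p z| <= C * expR (- kap * z ^+ 2)) ->
  forall e x, 0 <= x <= len e -> `|field 1 p e x| <= M * C.
Proof.
move=> k0; have [M M0 hM] := waves_bound rho0 rho_x0 rho_len a0 a_min k0.
exists (1 + M + M) => [|p C hp e x /andP[x_ge xl]]; first by rewrite !addr_ge0.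
have hp' z : rho <= z -> `|p z| <= C * expR (- kap * z ^+ 2) by move=> _; exact: hp.
have C0 := gauss_const_ge0 hp'.
apply: le_trans (ler_normD _ _) _; rewrite mulrDl; apply: lerD; last first.
  by rewrite mul1r; apply: (hM p C) => //; rewrite subr_ge0.
apply: le_trans (ler_normD _ _) _; rewrite mulrDl; apply: lerD; last exact: (hM p C).
case: ifP => _; last by rewrite normr0 mul1r.
apply: le_trans (hp _) _; rewrite mul1r ler_piMr// expR_le1 mulNr oppr_le0.
by rewrite mulr_ge0 ?sqr_ge0// ltW.
Qed.

(** By linearity a difference of fields is the field of a difference of profiles, so the estimate on
    the line carries over with a constant uniform on the graph. *)
Lemma heat_field_time_taylor (s1 s2 : R) : 0 < s1 -> s1 <= s2 -> exists2 C : R, 0 <= C &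
  forall s h e x, s1 <= s -> 0 <= h -> s + h <= s2 -> 0 <= x <= len e ->
  `|field 1 (heat (s + h)) e x - field 1 (heat s) e x| <= C * h /\
  `|field 1 (heat (s + h)) e x - field 1 (heat s) e x - h * field 1 (heat2 s) e x| <= C * h ^+ 2.
Proof.
move=> s10 s12; have [C [C0 hC]] := heat_time_taylor s10 s12.
have k0 : 0 < (8 * s2)^-1 by rewrite invr_gt0 mulr_gt0// (lt_le_trans s10).
have [M M0 hM] := field_uniform_bound k0.
exists (M * C) => [|s h e x ss h0 hs xl]; first exact: mulr_ge0.
have s0 : 0 < s by exact: lt_le_trans ss.
have [d0 d1 d2] := heat_dominated s0.
have [g0 _ _] := heat_dominated (ltr_pwDl s0 h0).
have D1 := gauss_dominated_lin (-1) d0 g0.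
split.
- have -> : field 1 (heat (s + h)) e x - field 1 (heat s) e x =
    field 1 (fun z => -1 * heat s z + heat (s + h) z) e x.
    by rewrite field_lin//; ring.
  rewrite -mulrA; apply: hM => // z; have [H _] := hC s h z ss h0 hs.
  by rewrite mulN1r addrC.
- have -> : field 1 (heat (s + h)) e x - field 1 (heat s) e x - h * field 1 (heat2 s) e x =
    field 1 (fun z => (- h) * heat2 s z + (-1 * heat s z + heat (s + h) z)) e x.
    by rewrite field_lin// field_lin//; ring.
  rewrite -mulrA; apply: hM => // z; have [_ H] := hC s h z ss h0 hs.
  by have -> : - h * heat2 s z + (-1 * heat s z + heat (s + h) z) =
    heat (s + h) z - heat s z - h * heat2 s z by ring.
Qed.

Lemma L2_dist_bound (f g : gpoint G -> R) (M : R) : L2 f -> L2 g -> 0 <= M ->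
  (forall e (x : R), 0 <= x <= len e -> `|f (pt e x) - g (pt e x)| <= M) ->
  edge_dist (edgewise f) (edgewise g) <= M * Num.sqrt (\sum_(e : edge G) len e).
Proof.
move=> hf hg M0 h; apply: edge_norm_bounded => //.
  by move=> e; have [] := edge_sq_lin (-1) hg hf e.
by move=> e x xl; rewrite /edge_lin /edgewise mulN1r addrC; exact: h.
Qed.

Section Semigroup.
Variable T : R -> (gpoint G -> R) -> (gpoint G -> R).
Hypothesis hT : heat_semigroup T.

(** The start is at a time [s > 0], when the field is in L^2 and in the domain of the Laplacian. *)
Lemma semigroup_heat_field (s t : R) : 0 < s -> 0 <= t ->
  L2eq (T t (graph_field (heat s))) (graph_field (heat (s + t))).
Proof.
move=> s0 t0.
have sp r : 0 <= r -> 0 < s + r by move=> r0; rewrite ltr_pwDl.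
set L := Num.sqrt (\sum_(e : edge G) len e).
have L0 : 0 <= L by exact: sqrtr_ge0.
have := @heat_solution_unique R G T hT (fun r => graph_field (heat (s + r)))
  (fun r => graph_field (heat2 (s + r))) _ _ _ _ t t0.
rewrite addr0; apply.
- by move=> r r0; exact: heat_field_L2 (sp r r0).
- by move=> r r0; exact: heat_field_neg_laplacian (sp r r0).
- move=> r eps r0 eps0; have sr := sp r r0.
  have [C C0 hC] := heat_field_time_taylor sr (ler_wpDr ler01 (lexx (s + r))).
  have CL : 0 <= C * L by exact: mulr_ge0.
  exists (Num.min 1 (eps / (C * L + 1))); first by rewrite lt_min ltr01 divr_gt0// ltr_wpDl.
  move=> h /andP[h0]; rewrite lt_min => /andP[h1 h2].
  have hr : 0 < s + (r + h) by apply: sp; rewrite addr_ge0// ltW.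
  have srh : s + r + h <= s + r + 1 by rewrite lerD2l ltW.
  apply: (@le_trans _ _ (C * h ^+ 2 * L)).
    apply: edge_norm_bounded; first by rewrite mulr_ge0 ?sqr_ge0.
    + have q2 : L2 (graph_field (heat2 (s + r))).
        have [_ h' _] := heat_field_neg_laplacian sr.
        exact: L2_opp.
      by move=> e; have [] := edge_sq_lin (- h) q2 (edge_sq_lin (-1) (heat_field_L2 sr) (heat_field_L2 hr)) e.
    + move=> e x xl; rewrite /edge_lin /edgewise !heat_fieldE// heat2_fieldE//.
      have [_] := hC (s + r) h e x (lexx _) (ltW h0) srh xl.
      have -> : s + (r + h) = s + r + h by rewrite addrA.
      move: (field 1 (heat (s + r + h)) e x) (field 1 (heat (s + r)) e x)
        (field 1 (heat2 (s + r)) e x) => A B D.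
      by have -> : - h * D + (-1 * B + A) = A - B - h * D by ring.
  rewrite ltr_pdivlMr ?ltr_wpDl// in h2.
  have -> : C * h ^+ 2 * L = (h * (C * L)) * h by ring.
  by apply: ler_wpM2r; [exact: ltW|lra].
- move=> r eps r0 eps0.
  have [C C0 hC] := heat_field_time_taylor s0 (ler_wpDr (ltW r0) (lexx s)).
  have CL : 0 <= C * L by exact: mulr_ge0.
  exists (eps / (C * L + 1)); first by rewrite divr_gt0// ltr_wpDl.
  move=> h /andP[h0 h2] hr.
  have rh : 0 <= r - h by rewrite subr_ge0.
  have p1 := sp r (ltW r0); have p2 := sp _ rh.
  apply: (@le_lt_trans _ _ (C * h * L)).
    apply: L2_dist_bound; [exact: heat_field_L2|exact: heat_field_L2|by rewrite mulr_ge0// ltW|].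
    move=> e x xl; rewrite !heat_fieldE//.
    have := hC (s + (r - h)) h e x; rewrite -addrA subrK.
    by move=> /(_ (ler_wpDr rh (lexx s)) (ltW h0) (lexx _) xl)[].
  rewrite ltr_pdivlMr ?ltr_wpDl// in h2.
  have -> : C * h * L = h * (C * L) by ring.
  by lra.
Qed.

End Semigroup.

(** Scattered waves have travelled at least [rho], so they leave no trace in the initial value. *)
Lemma waves_small_time : exists2 C : R, 0 <= C &
  forall s b y, 0 < s <= 1 -> 0 <= y -> `|waves (heat s) b y| <= C * s.
Proof.
have [C C0 hC] := heat_small_time rho0.
have k0 : 0 < 8^-1 :> R by rewrite invr_gt0.
have [M M0 hM] := waves_bound rho0 rho_x0 rho_len a0 a_min k0.
exists (M * C) => [|s b y s01 y0]; first exact: mulr_ge0.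
by rewrite -mulrA; apply: hM => // z hz; exact: hC.
Qed.

Lemma heat_field_initial (h : gpoint G -> R) (eps : R) : continuous h -> 0 < eps ->
  exists2 d : R, 0 < d & forall s, 0 < s < d ->
  `|L2inner h (graph_field (heat s)) - h (pt e0 x0)| <= eps.
Proof.
move=> ch eps0.
have che e : continuous (edgewise h e).
  by move=> x; apply: continuous_comp; [exact: continuous_pt|exact: ch].
have ex_bound : exists2 M : R, 0 <= M & forall e (x : R), 0 <= x <= len e -> `|edgewise h e x| <= M.
  have ex e : exists m : R, 0 <= m /\ forall x, 0 <= x <= len e -> `|edgewise h e x| <= m.
    by have [m m0 hm] := continuous_bounded_itv 0 (len e) (che e); exists m.
  have [m hm] := boolp.choice ex.
  exists (\sum_e m e) => [|e x xl]; first by apply: sumr_ge0 => e _; case: (hm e).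
  apply: le_trans ((hm e).2 x xl) _; rewrite (bigD1 e)//= lerDl.
  by apply: sumr_ge0 => e' _; case: (hm e').
have [M M0 hM] := ex_bound.
have [C C0 hC] := waves_small_time.
have eps2 : 0 < eps / 2 by rewrite divr_gt0.
have x0l : 0 < x0 < len e0 by rewrite x0_gt0.
have [d1 d10 hd1] := heat_approximate_identity x0l (che e0) eps2.
set L := \sum_(e : edge G) len e.
have L0 : 0 <= L by apply: sumr_ge0 => e _; exact/ltW/len_gt0.
pose B := M * (C + C) * L.
have B0 : 0 <= B by rewrite !mulr_ge0// addr_ge0.
exists (Num.min d1 (Num.min 1 (eps / (2 * (B + 1))))).
  by rewrite !lt_min d10 ltr01 divr_gt0// mulr_gt0// ltr_wpDl.
move=> s /andP[s0]; rewrite !lt_min => /andP[sd1 /andP[s1 sd2]].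
have s01 : 0 < s <= 1 by rewrite s0 ltW.
have hd := hd1 s; rewrite s0 sd1 in hd; have {}hd := hd isT.
(* The direct wave, which acts on [h] as an approximate identity; the remainder of the field is at
   most [2 C s]. *)
pose D e x : R := if e == e0 then heat s (x - x0) else 0.
have cheat : continuous (heat s).
  exact: (@is_derive_continuous _ _ (heat1 s) (fun y => is_derive_heat y s0)).
have cD e : continuous (D e).
  move=> x; rewrite /D; case: eqP => _; last exact: cvg_cst.
  apply: (continuous_comp (f := fun x => x - x0)); last exact: cheat.
  by apply: cvgB; [exact: cvg_id|exact: cvg_cst].
have sK := heat_field_L2 s0.
have sh e : sqint 0 (len e) (edgewise h e).
  by apply: sqint_continuous; apply: continuous_subspaceT; exact: che.
have sD e : sqint 0 (len e) (D e).
  by apply: sqint_continuous; apply: continuous_subspaceT; exact: cD.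
have E : L2inner h (graph_field (heat s)) =
   \int[mu]_(x in `[0, len e0]) (edgewise h e0 x * heat s (x - x0)) +
   \sum_e \int[mu]_(x in `[0, len e]) (edgewise h e x * (edgewise (graph_field (heat s)) e x - D e x)).
  have -> : \int[mu]_(x in `[0, len e0]) (edgewise h e0 x * heat s (x - x0)) =
     \sum_e \int[mu]_(x in `[0, len e]) (edgewise h e x * D e x).
    rewrite (bigD1 e0)//= [X in _ = _ + X]big1 ?addr0 => [|e /negbTE ee].
      by apply: eq_Rintegral => x _; rewrite /D eqxx.
    rewrite /D ee; under eq_Rintegral do rewrite mulr0.
    by rewrite Rintegral_cst// mul0r.
  rewrite -big_split; apply: eq_bigr => e _ /=.
  have i1 := integrable_mul_sqint (sh e) (sD e).
  have i2 := integrable_mul_sqint (sh e) (sK e).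
  have -> : \int[mu]_(x in `[0, len e]) (edgewise h e x * (edgewise (graph_field (heat s)) e x - D e x)) =
    \int[mu]_(x in `[0, len e]) (edgewise h e x * edgewise (graph_field (heat s)) e x - edgewise h e x * D e x).
    by apply: eq_Rintegral => x _; rewrite mulrBr.
  by rewrite RintegralB// addrC subrK.
rewrite E addrAC; apply: le_trans (ler_normD _ _) _.
have -> : eps = eps / 2 + eps / 2 by field.
apply: lerD; first exact: hd.
apply: (@le_trans _ _ (B * s)); last first.
  rewrite ltr_pdivlMr ?mulr_gt0 ?ltr_wpDl// in sd2.
  have : s * (2 * (B + 1)) = 2 * (B * s) + 2 * s by ring.
  lra.
apply: le_trans (ler_norm_sum _ _ _) _.
have -> : B * s = \sum_(e : edge G) M * ((C + C) * s) * len e.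
  by rewrite -mulr_sumr -/L /B; ring.
apply: ler_sum => e _; have l0 := ltW (len_gt0 e).
rewrite -[X in _ * X]subr0; apply: Rintegral_bounded => //.
  apply: measurable_funM; first by case: (sh e).
  by apply: measurable_funB; [case: (sK e)|case: (sD e)].
move=> x xl; have /andP[x_ge xle] := xl.
rewrite normrM; apply: ler_pM; rewrite ?normr_ge0 ?hM//.
rewrite /edgewise heat_fieldE//.
have -> : field 1 (heat s) e x - D e x =
  waves (heat s) (e, false) x + waves (heat s) (e, true) (len e - x) by rewrite !fieldE /D; ring.
rewrite mulrDl.
apply: le_trans (ler_normD _ _) _; apply: lerD; apply: hC => //.
by rewrite subr_ge0.
Qed.

(** Apply [T t] to the field at time [s n]: the kernel and [semigroup_heat_field] give the same
    function almost everywhere, outside one null set for all [n]. As [n] grows this yields the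
    formula at almost every [x] of [e0], and both sides are continuous at [x0]. *)
Lemma heat_kernel_formula (H : R -> gpoint G -> gpoint G -> R) (t : R) :
  heat_kernel H -> 0 < t -> H t (pt e0 x0) (pt e0 x0) = field 1 (heat t) e0 x0.
Proof.
move=> [T hT hH] t0; have [cH intH] := hH t t0.
set q := pt e0 x0.
have cHp p : continuous (H t p).
  by move=> q'; exact: (@continuous_pair_r R G (fun z => H t z.1 z.2) p q' cH).
have cHq : continuous (fun p => H t p q).
  by move=> q'; exact: (@continuous_pair_l R G (fun z => H t z.1 z.2) q' q cH).
pose s n : R := n.+1%:R^-1.
have s0 n : 0 < s n by rewrite invr_gt0 ltr0n.
have ae_n n : {ae mu, forall x, `[0, len e0]%classic x ->
    graph_field (heat (s n + t)) (pt e0 x) = L2inner (H t (pt e0 x)) (graph_field (heat (s n)))}.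
  have E1 := semigroup_heat_field hT (s0 n) (ltW t0) e0.
  have E2 := intH _ (heat_field_L2 (s0 n)) e0.
  by apply: filterS2 E1 E2 => x /= h1 h2 xl; rewrite -[LHS](h1 xl); exact: (h2 xl).
have := ae_foralln ae_n.
have limit x : 0 <= x <= len e0 ->
    (forall n, graph_field (heat (s n + t)) (pt e0 x) =
       L2inner (H t (pt e0 x)) (graph_field (heat (s n)))) ->
    field 1 (heat t) e0 x = H t (pt e0 x) q.
  move=> xl hn; apply/eqP; rewrite -subr_eq0 -normr_le0; apply/ler_addgt0Pr => eps eps0.
  rewrite add0r.
  have eps2 : 0 < eps / 2 by rewrite divr_gt0.
  have [d d0 hd] := heat_field_initial (cHp (pt e0 x)) eps2.
  have [C C0 hC] := heat_field_time_taylor t0 (ler_wpDr ler01 (lexx t)).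
  pose d' := Num.min d (eps / (2 * (C + 1))).
  have d'0 : 0 < d' by rewrite lt_min d0 divr_gt0// mulr_gt0// ltr_wpDl.
  have [n hsn] := ltr_add_invr d'0; rewrite add0r -/(s n) in hsn.
  have sn1 : s n <= 1 by rewrite invf_le1// ler1n.
  move: hsn; rewrite lt_min => /andP[snd sn2].
  rewrite ltr_pdivlMr ?mulr_gt0 ?ltr_wpDl// in sn2.
  have h1 := hd (s n); rewrite s0 snd in h1; have {}h1 := h1 isT.
  rewrite -hn heat_fieldE ?addr_gt0// [s n + t]addrC in h1.
  have [h2 _] := hC t (s n) e0 x (lexx t) (ltW (s0 n)) (lerD (lexx t) sn1) xl.
  have -> : field 1 (heat t) e0 x - H t (pt e0 x) q =
    (field 1 (heat (t + s n)) e0 x - H t (pt e0 x) q) -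
    (field 1 (heat (t + s n)) e0 x - field 1 (heat t) e0 x) by ring.
  apply: le_trans (ler_normB _ _) _.
  have E : s n * (2 * (C + 1)) = 2 * (C * s n) + 2 * s n by ring.
  have s0n := s0 n; rewrite -/q in h1; lra.
move=> aeall.
have [d0 d1 _] := heat_dominated t0; have [_ b1 _] := heat_bounded t0.
have cK : {within `[0, len e0], continuous (edgewise (graph_field (heat t)) e0)}.
  apply: H1_continuous; apply: (graph_field_H1 rho0 rho_x0 rho_len a0 a_min (p' := heat1 t) (p'' := heat2 t)) => // z.
  - exact: is_derive_heat.
  - exact: is_derive_heat1.
  - exact: heat_even.
have x0in : x0 \in `]0, len e0[ by rewrite in_itv/= x0_gt0.
have [cin _ _] := (continuous_within_itvP (edgewise (graph_field (heat t)) e0) (len_gt0 e0)).1 cK.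
have cK0 := cin x0 x0in.
have cG0 : {for x0, continuous (fun x => H t (pt e0 x) q)}.
  exact: (@continuous_comp _ _ _ (pt e0 : R -> gpoint G) (fun p => H t p q) x0
    (@continuous_pt R G e0 x0) (cHq (pt e0 x0))).
apply/eqP; rewrite -subr_eq0 -normr_le0; apply/ler_addgt0Pr => eps eps0; rewrite add0r.
have eps2 : 0 < eps / 2 by rewrite divr_gt0.
have /cvgrPdist_lt/(_ _ eps2)[r1 /= r10 hr1] := cK0.
have /cvgrPdist_lt/(_ _ eps2)[r2 /= r20 hr2] := cG0.
(* The bound by [rho] keeps [x0 + r] on the edge. *)
pose r := Num.min (Num.min r1 r2) rho.
have r0 : 0 < r by rewrite lt_min rho0 andbT lt_min r10.
have r_r1 : r <= r1 by rewrite ge_min; apply/orP; left; rewrite ge_min lexx.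
have r_r2 : r <= r2 by rewrite ge_min; apply/orP; left; rewrite ge_min lexx orbT.
have r_rho : r <= rho by rewrite ge_min lexx orbT.
have uv : x0 < x0 + r by rewrite ltrDl.
have [x /andP[x0x xr] hx] := ae_dense uv aeall.
have xl : 0 <= x <= len e0.
  by have := rho_len; have := x0_gt0; move: r_rho; lra.
have xx : `|x0 - x| < r by rewrite ltr_norml; apply/andP; split; lra.
have hxx := limit x xl (fun n => hx n _).
have {}hxx : field 1 (heat t) e0 x = H t (pt e0 x) q.
  by apply: hxx; rewrite /= in_itv.
have h1 := hr1 x (lt_le_trans xx r_r1); have h2 := hr2 x (lt_le_trans xx r_r2).
rewrite /edgewise !heat_fieldE ?(ltW x0_gt0) ?(ltW x0_lt)// hxx -/q in h1.
have -> : H t q q - field 1 (heat t) e0 x0 =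
  (H t q q - H t (pt e0 x) q) - (field 1 (heat t) e0 x0 - H t (pt e0 x) q) by ring.
by apply: le_trans (ler_normB _ _) _; rewrite -/q in h2; lra.
Qed.

End KernelFormula.

(** * Distances in the graph *)

Section GraphDistance.
Variables (R : realType) (G : metric_graph R) (a : R).
Hypothesis a0 : 0 < a.
Hypothesis a_min : forall e : edge G, a <= len e.
Implicit Types (p q : gpoint G) (v w : vert G) (e : edge G).

Lemma route_ge0 p q r : route p q r -> 0 <= r.
Proof. by elim=> // e x y {}q {}r _ _ _ r0; rewrite addr_ge0. Qed.

Lemma gdist_le p q r : route p q r -> gdist p q <= r.
Proof.
move=> pq; apply: ge_inf => //; exists 0 => s /= ps; exact: route_ge0 ps.
Qed.

Definition vertex_gap v w : R := if w == v then 0 else a.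

(* A lower bound for the distance to [v]: a path through another vertex still
   has an edge, of length at least [a], to traverse. *)
Definition dist_bound v p : R :=
  match p with
  | Vertex w => vertex_gap v w
  | Interior z => Num.min (vertex_gap v (src (val z).1) + (val z).2)
                          (vertex_gap v (tgt (val z).1) + (len (val z).1 - (val z).2))
  end.

Lemma vertex_gap_itv v w : 0 <= vertex_gap v w <= a.
Proof. by rewrite /vertex_gap; case: ifP; rewrite ?lexx ?(ltW a0). Qed.

(** At an end of the edge the minimum must select the value of that end; it does, because two gaps
    differ by at most [a <= len e]. *)
Lemma dist_bound_pt v e (x : R) : 0 <= x <= len e ->
  dist_bound v (pt e x) = Num.min (vertex_gap v (src e) + x) (vertex_gap v (tgt e) + (len e - x)).
Proof.
have /andP[s0 sa] := vertex_gap_itv v (src e); have /andP[t0 ta] := vertex_gap_itv v (tgt e).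
have ae := a_min e.
move=> /pt_cases[->|->|h].
- by rewrite pt0 /= addr0 subr0 min_l//; lra.
- by rewrite pt_len /= subrr addr0 min_r//; lra.
- by rewrite (pt_interior h).
Qed.

(** On a closed edge the bound is a minimum of functions of slope 1 and -1, hence 1-Lipschitz along
    each segment. *)
Lemma route_dist_bound v p q r : route p q r -> dist_bound v p <= dist_bound v q + r.
Proof.
elim=> [{}p|e x y {}q {}r hx hy _ IH]; first by rewrite addr0.
apply: (@le_trans _ _ (dist_bound v (pt e y) + `|x - y|)); last lra.
have n1 := ler_norm (x - y); have n2 := ler_norm (y - x); rewrite distrC in n2.
rewrite !dist_bound_pt// -lerBlDr le_min !lerBlDr !ge_min.
by apply/andP; split; apply/orP; [left|right]; lra.
Qed.

Lemma dist_bound_le_gdist v p : (exists r, route p (Vertex v) r) ->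
  dist_bound v p <= gdist p (Vertex v).
Proof.
move=> [r0 hr0]; apply: lb_le_inf; first by exists r0.
move=> r /= /route_dist_bound -/(_ v); rewrite /= /vertex_gap eqxx add0r; exact.
Qed.

(** The points reached from [p] form a set stable under unit balls, hence open and closed. [gdist]
    is an infimum of route lengths, informative only once a route exists. *)
Lemma connected_route p q : connected [set: gpoint G] -> exists r, route p q r.
Proof.
move=> conn; pose A := [set q | exists r, route p q r].
have stable q1 q2 : ball q1 1 q2 -> A q1 -> A q2.
  by move=> [r' h' _] [r h]; exists (r + r'); exact: route_trans h h'.
have oA : open A.
  rewrite openE => q1 Aq1; apply/nbhs_ballP; exists 1 => //= q2 /stable; exact.
have cA : closed A.
  rewrite -openC openE => q1 nAq1; apply/nbhs_ballP; exists 1 => //= q2 b12 Aq2.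
  by apply: nAq1; apply: stable Aq2; exact: ball_sym.
have AT : A = [set: gpoint G].
  apply: conn; first by exists p; exists 0; exact: route_nil.
    by exists A => //; rewrite setTI.
  by exists A => //; rewrite setTI.
by have : A q by rewrite AT.
Qed.

(** The segments to the two ends bound the distances from above, [dist_bound] from below. If the
    minimum in [dist_bound] is reached through a vertex other than [v0], that vertex is nearer by
    [a], a contradiction. For a loop both ends are [v0] and the minimum decides the side. *)
Lemma nearest_vertex_interior e0 (x0 : R) v0 : connected [set: gpoint G] -> 0 < x0 < len e0 ->
  nearest_vertex (pt e0 x0) v0 ->
  [/\ v0 = src e0, gdist (pt e0 x0) (Vertex v0) = x0 & x0 <= len e0 - x0] \/
  [/\ v0 = tgt e0, gdist (pt e0 x0) (Vertex v0) = len e0 - x0 & len e0 - x0 <= x0].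
Proof.
move=> conn /andP[x00 x0l] near0.
have xl : 0 <= x0 <= len e0 by rewrite !ltW.
have l0 := ltW (len_gt0 e0); have ae := a_min e0.
have ds : gdist (pt e0 x0) (Vertex (src e0)) <= x0.
  have := route_segment xl (_ : 0 <= 0 <= len e0); rewrite lexx l0 pt0 subr0 gtr0_norm//.
  by move=> /(_ isT) /gdist_le.
have dt : gdist (pt e0 x0) (Vertex (tgt e0)) <= len e0 - x0.
  have := route_segment xl (_ : 0 <= len e0 <= len e0); rewrite lexx l0 pt_len distrC ger0_norm ?subr_ge0 ?(ltW x0l)//.
  by move=> /(_ isT) /gdist_le.
have n1 := near0 (src e0); have n2 := near0 (tgt e0).
have := dist_bound_le_gdist (connected_route (pt e0 x0) (Vertex v0) conn).
rewrite dist_bound_pt// /vertex_gap ge_min.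
have [sv|sv] := eqVneq (src e0) v0; have [tv|tv] := eqVneq (tgt e0) v0.
- rewrite sv in ds n1; rewrite tv in dt n2; move=> /orP[h|h]; [left|right];
    by split; [by []|apply: le_anti; apply/andP; split; lra|lra].
- rewrite sv in ds n1; move=> /orP[h|h]; last by have : (0 : R) < 0 by [have := a0; lra]; rewrite ltxx.
  by left; split; [by []|apply: le_anti; apply/andP; split; lra|lra].
- rewrite tv in dt n2; move=> /orP[h|h]; first by have : (0 : R) < 0 by [have := a0; lra]; rewrite ltxx.
  by right; split; [by []|apply: le_anti; apply/andP; split; lra|lra].
- by move=> /orP[h|h]; have : (0 : R) < 0 by [have := a0; lra]; rewrite ltxx.
Qed.

Lemma nearest_vertex_vertex v w : connected [set: gpoint G] ->
  nearest_vertex (Vertex w) v -> v = w /\ gdist (Vertex w) (Vertex v) = 0.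
Proof.
move=> conn near0.
have dw : gdist (Vertex w) (Vertex w) <= 0 by apply: gdist_le; exact: route_nil.
have h := dist_bound_le_gdist (connected_route (Vertex w) (Vertex v) conn).
have hw := near0 w.
have g0 := dist_bound_le_gdist (connected_route (Vertex w) (Vertex w) conn).
rewrite /= /vertex_gap eqxx in g0.
move: h; rewrite /= /vertex_gap; have [wv|wv] := eqVneq w v => h; last first.
  by have : (0 : R) < 0 by [have := a0; lra]; rewrite ltxx.
subst v; by split=> //; apply/eqP; rewrite eq_le dw g0.
Qed.

(** The first segment of a route from [w] to the midpoint of an edge lies on an edge that ends at
    [w]. Interior points therefore accumulate at [w]. *)
Lemma vertex_incident w : connected [set: gpoint G] -> (0 < #|edge G|)%N ->
  exists e, src e = w \/ tgt e = w.
Proof.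
move=> conn /card_gt0P[e _].
have h : 0 < len e / 2 < len e by rewrite divr_gt0 ?len_gt0// ltr_pdivrMr// ltr_pMr ?len_gt0 ?ltr1n.
have [r] := connected_route (Vertex w) (pt e (len e / 2)) conn.
move E1 : (Vertex w) => p; move E2 : (pt e (len e / 2)) => q rt.
case: rt E1 E2 => [{}p <-|f x y {}q {}r hx _ _ E1 _]; first by rewrite (pt_interior h).
exists f; have [xe|xe|hx'] := pt_cases hx.
- by left; move: E1; rewrite xe pt0 => -[].
- by right; move: E1; rewrite xe pt_len => -[].
- by move: E1; rewrite (pt_interior hx').
Qed.

End GraphDistance.

(** * The error term *)

Section ErrorBound.
Variable R : realType.

Lemma sum_half_expn (k : nat) : \sum_(0 <= n < k) 2^-1 ^+ n <= 2 :> R.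
Proof.
suff -> : \sum_(0 <= n < k) 2^-1 ^+ n = 2 - 2 * 2^-1 ^+ k :> R.
  by rewrite gerBl mulr_ge0// exprn_ge0// invr_ge0.
elim: k => [|k IH]; first by rewrite big_geq// expr0 mulr1 subrr.
by rewrite big_nat_recr//= IH exprS; field.
Qed.

(** Generation 0 is set apart because it contains the main reflection. For the others, (n + 1)^2 = 1
    + 2 n + n^2 splits off m theta and (m theta^2)^n <= 1, and [M] depends on [theta0] alone. The 32
    is 4 from [wave_gauss], 4 from the extra power of 4, and 2 from the geometric sum. *)
Lemma waves_after_first (G : metric_graph R) (e0 : edge G) (x0 rho a C kap theta0 M : R)
  (p : R -> R) (b : dart G) (y : R) :
  0 < rho -> rho <= x0 -> rho <= len e0 - x0 -> 0 < a -> (forall e : edge G, a <= len e) ->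
  0 < kap -> (forall z, rho <= z -> `|p z| <= C * expR (- kap * z ^+ 2)) ->
  expR (- kap * a ^+ 2) <= theta0 ->
  #|edge G|%:R * expR (- kap * a ^+ 2) ^+ 2 <= 1 ->
  (forall n, 4 ^+ n * theta0 ^+ (n * n) <= M * 2^-1 ^+ n) ->
  0 <= y ->
  `|waves e0 x0 p b y - wave e0 x0 0 p b y| <=
     32 * C * M * (#|edge G|%:R * expR (- kap * a ^+ 2)).
Proof.
move=> rho0 rx rl a0 a_min kap0 hp; set th := expR _; set m : R := #|edge G|%:R.
move=> th_le mth hM y0.
have C0 := gauss_const_ge0 hp.
have th0 : 0 <= th by exact: expR_ge0.
have m0 : 0 <= m by [].
have M0 : 0 <= M by have := hM 0%N; rewrite !expr0 !mulr1; apply: le_trans.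
have hn n : `|wave e0 x0 n.+1 p b y| <= 16 * C * M * (m * th) * 2^-1 ^+ n.
  apply: le_trans (wave_gauss rho0 rx rl a0 a_min kap0 hp n.+1 b y0) _.
  rewrite -/m -/th.
  have -> : (4 * m) ^+ n.+1 * th ^+ (n.+1 * n.+1) =
     4 * (m * th) * ((m * th ^+ 2) ^+ n * (4 ^+ n * th ^+ (n * n))).
    have -> : (n.+1 * n.+1 = 1 + 2 * n + n * n)%N by rewrite mulSn mulnS addnA addSn addnn -mul2n add1n.
    by rewrite [(4 * m) ^+ _]exprS exprD exprD expr1 exprM !exprMn; ring.
  have -> : 16 * C * M * (m * th) * 2^-1 ^+ n = 4 * C * (4 * (m * th) * (M * 2^-1 ^+ n)) by ring.
  apply: ler_wpM2l; first by rewrite mulr_ge0.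
  apply: ler_wpM2l; first by rewrite !mulr_ge0.
  apply: le_trans (hM n); rewrite -[leRHS]mul1r; apply: ler_pM.
  - by rewrite exprn_ge0// mulr_ge0// exprn_ge0.
  - by rewrite mulr_ge0// exprn_ge0.
  - by rewrite exprn_ile1// mulr_ge0// exprn_ge0.
  - by rewrite ler_wpM2l ?exprn_ge0// lerXn2r// nnegrE (le_trans th0).
have gd : gauss_dominated rho p by exists C, kap.
have [D D0 /(_ b y y0)[wc _]] := waves_cvg rho0 rx rl a0 a_min gd.
rewrite distrC; apply: (cvg_dist_le (k := 1%N) wc) => -[//|k] _.
rewrite /waves_upto big_nat_recl// opprD addrA subrr add0r normrN.
apply: le_trans (ler_norm_sum _ _ _) _.
apply: (@le_trans _ _ (\sum_(0 <= n < k) 16 * C * M * (m * th) * 2^-1 ^+ n)).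
  by apply: ler_sum_nat => n _; exact: hn.
rewrite -mulr_sumr; have -> : 32 * C * M * (m * th) = 16 * C * M * (m * th) * 2 by ring.
by apply: ler_wpM2l; [rewrite !mulr_ge0|exact: sum_half_expn].
Qed.

Lemma diagonal_error (theta0 : R) : 0 <= theta0 < 1 -> exists C : R,
  forall (G : metric_graph R) (e0 : edge G) (x0 a t : R) (v0 : vert G) (d : R),
  0 < x0 < len e0 -> 0 < a -> (forall e : edge G, a <= len e) -> 0 < t ->
  expR (- a ^+ 2 / (4 * t)) <= theta0 ->
  #|edge G|%:R * expR (- a ^+ 2 / (4 * t)) ^+ 2 <= 1 ->
  ([/\ v0 = src e0, d = x0 & x0 <= len e0 - x0] \/
   [/\ v0 = tgt e0, d = len e0 - x0 & len e0 - x0 <= x0]) ->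
  `|Num.sqrt (4 * pi * t) * field e0 x0 1 (heat t) e0 x0 -
    (1 + (2 / (degree v0)%:R - 1) * expR (- d ^+ 2 / t))| <=
  C * (#|edge G|%:R * expR (- a ^+ 2 / (4 * t))).
Proof.
move=> th01.
have [M M0 hM] := gauss_dominated_by_geometric (ler0n R 4) th01.
(* Two tails at [32 M] each, and three stray first-generation waves at 2 each. *)
exists (6 + 64 * M) => G e0 x0 a t v0 d /andP[x00 x0l] a0 a_min t0.
have tn := lt0r_neq0 t0.
have -> : - a ^+ 2 / (4 * t) = - (4 * t)^-1 * a ^+ 2 by ring.
set th := expR _; set m : R := #|edge G|%:R => th_le mth hv.
pose rho := Num.min x0 (len e0 - x0).
have rho0 : 0 < rho by rewrite lt_min x00 subr_gt0.
have rx : rho <= x0 by rewrite ge_min lexx.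
have rl : rho <= len e0 - x0 by rewrite ge_min lexx orbT.
have kap0 : 0 < (4 * t)^-1 by rewrite invr_gt0 mulr_gt0.
set h0 := heat t 0.
have h00 : 0 <= h0 by exact: heat_ge0.
have sh : Num.sqrt (4 * pi * t) * h0 = 1.
  by rewrite /h0 heat_at0// divff// gt_eqF// sqrtr_gt0 !mulr_gt0 ?pi_gt0.
have hE z : heat t z = h0 * expR (- (4 * t)^-1 * z ^+ 2).
  by rewrite heat_scale//; congr (_ * expR _); ring.
have hp z : rho <= z -> `|heat t z| <= h0 * expR (- (4 * t)^-1 * z ^+ 2).
  by move=> _; rewrite ger0_norm ?heat_ge0// hE.
have x0ge := ltW x00; have lxge : 0 <= len e0 - x0 by rewrite subr_ge0 ltW.
have W1 := waves_after_first (e0, false) rho0 rx rl a0 a_min kap0 hp th_le mth hM x0ge.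
have W2 := waves_after_first (e0, true) rho0 rx rl a0 a_min kap0 hp th_le mth hM lxge.
rewrite -/th -/m in W1 W2.
have m1 : 1 <= m by rewrite ler1n; apply/card_gt0P; exists e0.
have thm : th <= m * th by rewrite ler_peMl// expR_ge0.
have long z : a <= z -> `|heat t z| <= h0 * (m * th).
  move=> az; rewrite ger0_norm ?heat_ge0// hE; apply: ler_wpM2l => //; apply: le_trans thm.
  have zge : 0 <= z by apply: le_trans az; exact: ltW.
  by rewrite ler_expR !mulNr lerN2 ler_pM2l// lerXn2r ?nnegrE ?(ltW a0).
have small (b b' : dart G) z : a <= z -> `|scat b b' * heat t z| <= 2 * (h0 * (m * th)).
  by move=> az; rewrite normrM; apply: ler_pM; rewrite ?normr_ge0 ?scat_bound ?long.
have aes := a_min e0.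
(* The wave of length [len e0] comes back in its direction of departure: its coefficient vanishes
   unless [e0] is a loop. The other one is the reflection at [src e0]. *)
have E1 : wave e0 x0 0 (heat t) (e0, false) x0 =
   scat (e0, false) (e0, false) * heat t (len e0) +
   (2 / (degree (src e0))%:R - 1) * heat t (2 * x0).
  rewrite /= sum_init_wave subrK; congr (_ + _ * heat t _); last by ring.
  by rewrite /scat /dart_to /dart_from /dart_rev /= !eqxx.
have E2 : wave e0 x0 0 (heat t) (e0, true) (len e0 - x0) =
   (2 / (degree (tgt e0))%:R - 1) * heat t (2 * (len e0 - x0)) +
   scat (e0, true) (e0, true) * heat t (len e0).
  rewrite /= sum_init_wave subrKC; congr (_ * heat t _ + _); last by ring.
  by rewrite /scat /dart_to /dart_from /dart_rev /= !eqxx.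
have S1 : scat (e0, false) (e0, true) = 2 / (degree (src e0))%:R - 1 :> R.
  by rewrite /scat /dart_to /dart_from /dart_rev /= !eqxx.
have S2 : scat (e0, true) (e0, false) = 2 / (degree (tgt e0))%:R - 1 :> R.
  by rewrite /scat /dart_to /dart_from /dart_rev /= !eqxx.
have main_term (c z : R) : c * heat t (2 * z) = h0 * (c * expR (- z ^+ 2 / t)).
  by rewrite hE mulrCA; congr (_ * (_ * expR _)); field.
have F : field e0 x0 1 (heat t) e0 x0 = h0 + waves e0 x0 (heat t) (e0, false) x0 +
    waves e0 x0 (heat t) (e0, true) (len e0 - x0).
  by rewrite fieldE eqxx subrr mul1r.
set W1' := waves e0 x0 (heat t) (e0, false) x0 in W1 F.
set W2' := waves e0 x0 (heat t) (e0, true) (len e0 - x0) in W2 F.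
rewrite E1 in W1; rewrite E2 in W2.
have l1 := small (e0, false) (e0, false) _ aes.
have l2 := small (e0, true) (e0, true) _ aes.
set s0 := Num.sqrt _ in sh *.
have s0ge : 0 <= s0 by exact: sqrtr_ge0.
suff B : `|field e0 x0 1 (heat t) e0 x0 - h0 * (1 + (2 / (degree v0)%:R - 1) * expR (- d ^+ 2 / t))| <=
    h0 * ((6 + 64 * M) * (m * th)).
  have -> : s0 * field e0 x0 1 (heat t) e0 x0 - (1 + (2 / (degree v0)%:R - 1) * expR (- d ^+ 2 / t)) =
     s0 * (field e0 x0 1 (heat t) e0 x0 - h0 * (1 + (2 / (degree v0)%:R - 1) * expR (- d ^+ 2 / t))).
    by rewrite mulrBr mulrA sh mul1r.
  rewrite normrM ger0_norm//; apply: le_trans (ler_wpM2l s0ge B) _.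
  by rewrite [leLHS]mulrA sh mul1r.
have -> : h0 * ((6 + 64 * M) * (m * th)) =
   32 * h0 * M * (m * th) + 32 * h0 * M * (m * th) + 2 * (h0 * (m * th)) + 2 * (h0 * (m * th)) + 2 * (h0 * (m * th)) by ring.
rewrite F; case: hv => -[-> -> hd].
(* The reflection at the farther end travels [2 * (len e0 - x0) >= len e0 >= a], so it belongs to
   the error. *)
- have l3 := small (e0, true) (e0, false) (2 * (len e0 - x0)) _.
  have {}l3 : `|(2 / (degree (tgt e0))%:R - 1) * heat t (2 * (len e0 - x0))| <= 2 * (h0 * (m * th)).
    by rewrite -S2; apply: l3; lra.
  rewrite mulrDr mulr1 -main_term.
  set P1 := (2 / (degree (src e0))%:R - 1) * _ in W1 *.
  set P2 := (2 / (degree (tgt e0))%:R - 1) * _ in W2 l3.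
  set Q1 := scat _ _ * _ in W1 l1; set Q2 := scat _ _ * _ in W2 l2.
  have -> : h0 + W1' + W2' - (h0 + P1) = (W1' - (Q1 + P1)) + (W2' - (P2 + Q2)) + Q1 + P2 + Q2 by ring.
  by do 4 (apply: le_trans (ler_normD _ _) _; apply: lerD => //).
- have l3 := small (e0, false) (e0, true) (2 * x0) _.
  have {}l3 : `|(2 / (degree (src e0))%:R - 1) * heat t (2 * x0)| <= 2 * (h0 * (m * th)).
    by rewrite -S1; apply: l3; lra.
  rewrite mulrDr mulr1 -main_term.
  set P1 := (2 / (degree (src e0))%:R - 1) * _ in W1 l3.
  set P2 := (2 / (degree (tgt e0))%:R - 1) * _ in W2 *.
  set Q1 := scat _ _ * _ in W1 l1; set Q2 := scat _ _ * _ in W2 l2.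
  have -> : h0 + W1' + W2' - (h0 + P2) = (W1' - (Q1 + P1)) + (W2' - (P2 + Q2)) + Q1 + P1 + Q2 by ring.
  by do 4 (apply: le_trans (ler_normD _ _) _; apply: lerD => //).
Qed.

Lemma le_norm_continuous (f : R -> R) (c B : R) : {for c, continuous f} ->
  (forall r : R, 0 < r -> exists2 x, `|c - x| < r & `|f x| <= B) -> `|f c| <= B.
Proof.
move=> cf h; apply/ler_addgt0Pr => e e0.
have /cvgrPdist_lt/(_ e e0)[r /= r0 hr] := cf.
have [x xr fx] := h r r0; have := hr x xr => /ltW he.
have -> : f c = f x + (f c - f x) by ring.
exact: le_trans (ler_normD _ _) (lerD fx he).
Qed.

(** The graph enters the hypotheses on theta only, so [C] can be chosen before it. *)
Lemma diag_expansion_of_small_theta (theta0 : R) : 0 <= theta0 < 1 -> exists C : R,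
  forall (G : metric_graph R) (a t0 : R) (H : R -> gpoint G -> gpoint G -> R),
  connected [set: gpoint G] -> (0 < #|edge G|)%N -> min_edge_length G a -> heat_kernel H ->
  (forall t, 0 < t <= t0 -> expR (- a ^+ 2 / (4 * t)) <= theta0 /\
    #|edge G|%:R * expR (- a ^+ 2 / (4 * t)) ^+ 2 <= 1) ->
  diag_expansion a H t0 C.
Proof.
move=> th01; have [C hC] := diagonal_error th01; exists C.
move=> G a t0 H conn m0 [[e1 ea] a_min] hH hth q v0 near0 t tt0.
have a0 : 0 < a by rewrite -ea len_gt0.
have /andP[t_gt0 _] := tt0; have [th1 th2] := hth t tt0.
set s0 := Num.sqrt (4 * pi * t).
have s0_gt0 : 0 < s0 by rewrite sqrtr_gt0 !mulr_gt0 ?pi_gt0.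
set th := expR _ in th1 th2 *; set m : R := #|edge G|%:R in th2 *.
suff [d hd B] : exists2 d, gdist q (Vertex v0) = d &
    `|s0 * H t q q - (1 + (2 / (degree v0)%:R - 1) * expR (- d ^+ 2 / t))| <= C * (m * th).
  exists (s0 * H t q q - (1 + (2 / (degree v0)%:R - 1) * expR (- d ^+ 2 / t))) => //.
  rewrite /heat_diag hd subrKC mulrA mulVf ?mul1r// gt_eqF//.
(* Stated with the coordinate distance [d] instead of [gdist], so that the passage to a vertex needs
   no continuity of [gdist]. *)
have interior e x v d : 0 < x < len e ->
    ([/\ v = src e, d = x & x <= len e - x] \/ [/\ v = tgt e, d = len e - x & len e - x <= x]) ->
    `|s0 * H t (pt e x) (pt e x) - (1 + (2 / (degree v)%:R - 1) * expR (- d ^+ 2 / t))| <= C * (m * th).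
  move=> hx hv; have /andP[x_gt0 xl] := hx.
  by rewrite (heat_kernel_formula x_gt0 xl a0 a_min hH t_gt0); exact: hC.
case: q near0 => [w|[[e x] /= hx]] near0; last first.
  have Ep : Interior (exist (fun p : edge G * R => 0 < p.2 < len p.1) (e, x) hx) = pt e x.
    by rewrite (pt_interior hx).
  rewrite Ep in near0 *; exists (gdist (pt e x) (Vertex v0)) => //.
  by apply: interior => //; exact: (nearest_vertex_interior a0 a_min conn hx near0).
have [-> gd] := nearest_vertex_vertex a0 a_min conn near0.
exists 0 => //.
have [T hT hK] := hH; have [cH _] := hK t t_gt0.
have cdiag e : continuous (fun x : R => s0 * H t (pt e x) (pt e x)).
  move=> x; apply: cvgMr.
  have h : (fun y : R => (pt e y, pt e y)) @ x --> (pt e x, pt e x).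
    apply: (@cvg_pair _ _ _ (nbhs x) (nbhs (pt e x)) (nbhs (pt e x)) _ _ _ (pt e) (pt e)); exact: continuous_pt.
  exact: (cvg_comp _ _ h (cH (pt e x, pt e x))).
have cexp c : continuous (fun x : R => 1 + (2 / (degree w)%:R - 1) * expR (- (x - c) ^+ 2 / t)).
  set k := 2 / _ - 1.
  have E y : 1 + k * expR (- t^-1 * (- c + y) ^+ 2) = 1 + k * expR (- (y - c) ^+ 2 / t).
    by congr (_ + _ * expR _); rewrite (addrC (- c)); ring.
  have D x := is_derive_addf (is_derive_cstf 1 x) (is_derive_scal k (is_derive_expf
    (is_derive_scal (- t^-1) (is_derive_translate (is_derive_sqr (- c + x)))))).
  by rewrite -(funext E); exact: is_derive_continuous D.
(* Staying in the half edge next to [w] keeps [w] the nearer end, as [interior] requires. *)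
have half (e : edge G) (r : R) : 0 < r -> exists2 x : R, 0 < x < r & x < len e / 2.
  move=> r0; have l2 : 0 < len e / 2 by rewrite divr_gt0// len_gt0.
  exists (Num.min (r / 2) (len e / 4)).
    by rewrite lt_min !divr_gt0 ?len_gt0//= gt_min ltr_pdivrMr// ltr_pMr// ltr1n.
  rewrite gt_min; apply/orP; right; have := len_gt0 e; lra.
have [e [se|te]] := vertex_incident w conn m0.
- have := @le_norm_continuous (fun x => s0 * H t (pt e x) (pt e x) -
    (1 + (2 / (degree w)%:R - 1) * expR (- (x - 0) ^+ 2 / t))) 0 (C * (m * th)).
  rewrite /= pt0 se subr0; apply.
    by apply: cvgB; [exact: (cdiag e 0)|exact: (cexp 0 0)].
  move=> r r0; have [x /andP[x0 xr] xl] := half e r r0; exists x.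
    by rewrite sub0r normrN gtr0_norm.
  by rewrite subr0; apply: interior; [apply/andP; split; lra|left; split=> //; lra].
- have := @le_norm_continuous (fun x => s0 * H t (pt e x) (pt e x) -
    (1 + (2 / (degree w)%:R - 1) * expR (- (x - len e) ^+ 2 / t))) (len e) (C * (m * th)).
  rewrite /= pt_len te subrr; apply.
    by apply: cvgB; [exact: (cdiag e (len e))|exact: (cexp (len e) (len e))].
  move=> r r0; have [x /andP[x0 xr] xl] := half e r r0; exists (len e - x).
    by rewrite opprB addrCA subrr addr0 gtr0_norm.
  rewrite -sqrrN opprB; apply: interior; first by apply/andP; split; lra.
  by right; split=> //; lra.
Qed.

End ErrorBound.

(* For m = 1 the bound a0^2 / (2 log m) is infinite, so t0 is arbitrary; the
   constant then depends on the length of the single edge as well as on t0. *)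
Theorem proposition3p1 (R : realType) :
  (forall t0 : R, exists C : R,
     forall (G : metric_graph R) (a0 : R) (H : R -> gpoint G -> gpoint G -> R),
       connected [set: gpoint G] -> (1 < #|edge G|)%N ->
       min_edge_length G a0 -> heat_kernel H ->
       t0 < a0 ^+ 2 / (2 * ln (#|edge G|%:R)) ->
       diag_expansion a0 H t0 C) /\
  (forall t0 a0 : R, exists C : R,
     forall (G : metric_graph R) (H : R -> gpoint G -> gpoint G -> R),
       connected [set: gpoint G] -> #|edge G| = 1%N ->
       min_edge_length G a0 -> heat_kernel H ->
       diag_expansion a0 H t0 C).
Proof.
split=> t0.
- have ln2 : 0 < ln 2 :> R by rewrite ln_gt0// ltr1n.
  (* [theta0] is [2^(-1/2)], the largest value of [m^(-1/2)] for m >= 2; it does not involve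
     [t0]. *)
  have th01 : 0 <= expR (- (ln 2 / 2) : R) < 1.
    by rewrite expR_ge0/= expR_lt1 oppr_lt0 divr_gt0.
  have [C hC] := diag_expansion_of_small_theta th01; exists C.
  move=> G a0 H conn m1 ha hH ht; apply: hC => //; first exact: ltn_trans m1.
  move=> t /andP[t_gt0 tt0].
  have m_gt0 : 0 < #|edge G|%:R :> R by rewrite ltr0n (ltn_trans _ m1).
  have lnm : ln 2 <= ln (#|edge G|%:R) :> R by rewrite ler_ln ?posrE// ler_nat.
  have lnm0 : 0 < ln (#|edge G|%:R) :> R by exact: lt_le_trans lnm.
  have ht2 : 2 * ln (#|edge G|%:R) * t <= a0 ^+ 2.
    have := le_lt_trans tt0 ht; rewrite ltr_pdivlMr ?mulr_gt0// => /ltW.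
    by rewrite mulrC.
  (* That is, theta <= m^(-1/2), from which both required bounds follow. *)
  have ht3 : ln (#|edge G|%:R) / 2 <= a0 ^+ 2 / (4 * t).
    rewrite ler_pdivlMr ?mulr_gt0//; lra.
  split.
    by rewrite ler_expR mulNr lerN2; lra.
  rewrite -expRM_natl -[X in X * _](lnK (x := #|edge G|%:R)) ?posrE// -expRD expR_le1.
  by rewrite mulNr; lra.
- move=> a0.
  have [t0_gt0|t0_le0] := ltP 0 t0; last first.
    exists 0 => G H _ _ _ _ q v0 _ t /andP[t1 t2]; have := lt_le_trans t1 t2.
    by rewrite ltNge t0_le0.
  have [a_gt0|a_le0] := ltP 0 a0; last first.
    exists 0 => G H _ _ [[e ea] _]; move: a_le0; rewrite -ea leNgt len_gt0//.
  have a2 : 0 < a0 ^+ 2 by rewrite exprn_gt0.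
  (* With m = 1 the condition m theta^2 <= 1 is automatic, and theta is largest at [t = t0]. *)
  have th01 : 0 <= expR (- a0 ^+ 2 / (4 * t0)) < 1.
    by rewrite expR_ge0/= expR_lt1 mulNr oppr_lt0 divr_gt0// mulr_gt0.
  have [C hC] := diag_expansion_of_small_theta th01; exists C.
  move=> G H conn m1 ha hH; apply: hC => //; first by rewrite m1.
  move=> t /andP[t_gt0 tt0]; split.
    rewrite ler_expR !mulNr lerN2 ler_pM2l// lef_pV2 ?posrE ?mulr_gt0// ler_pM2l//.
  rewrite m1 mul1r exprn_ile1 ?expR_ge0// expR_le1 mulNr oppr_le0 divr_ge0 ?(ltW a2)//.
  by rewrite mulr_ge0// ltW.
Qed.
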